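(* There exists a filtration $$0\subset\mathbb F^{(0)}\subset\mathbb F^{(1)}\subset\mathbb F^{(2)}=\mathbb F$$ of $\mathfrak g\oplus\mathfrak g$-submodules of $\mathbb F$, such that $$\mathbb F^{(2)}/\mathbb F^{(1)}\cong\bigoplus_{\lambda\in\mathbf P^+}V_{-\lambda-2}\otimes V^\star_{-\lambda-2},$$ $$\mathbb F^{(1)}/\mathbb F^{(0)}\cong\bigoplus_{\lambda\in\mathbf P^+}\left(V_\lambda\otimes V^\star_{-\lambda-2}\oplus V_{-\lambda-2}\otimes V^\star_\lambda\right),$$ $$\mathbb F^{(0)}\cong\bigoplus_{\lambda\in\mathbf P}V_\lambda\otimes V^\star_\lambda .$$
   Context: Let $\mathfrak g=\mathfrak{sl}(2,\mathbb C)$ with standard basis $\mathbf e,\mathbf h,\mathbf f$, $[\mathbf h,\mathbf e]=2\mathbf e$, $[\mathbf h,\mathbf f]=-2\mathbf f$, $[\mathbf e,\mathbf f]=\mathbf h$, and $\mathfrak h=\mathbb C\mathbf h$. Weights are identified with complex numbers (value on $\mathbf h$), $\mathbf P=\mathbb Z$, $\mathbf P^+=\mathbb Z_{\ge0}$. $V_\lambda$ is the irreducible $\mathfrak g$-module generated by a highest weight vector $v_\lambda$ with $\mathbf e v_\lambda=0$, $\mathbf h v_\lambda=\lambda v_\lambda$. For a $\mathfrak g$-module $V=\bigoplus_\mu V[\mu]$ with weight space decomposition, $V^\star$ is the restricted dual $V'=\bigoplus_\mu V[\mu]'$ with action $\langle g v',v\rangle=-\langle v',\omega(g)v\rangle$,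 where $\omega$ is the involution of $\mathfrak g$ with $\omega(\mathbf e)=-\mathbf f$, $\omega(\mathbf h)=-\mathbf h$, $\omega(\mathbf f)=-\mathbf e$; $V^\star_\lambda:=(V_\lambda)^\star$. In $V\otimes W$ the first copy of $\mathfrak g$ acts on $V$, the second on $W$. $\mathbb F=F(\beta,\gamma)\otimes F(\bar\beta,\bar\gamma)\otimes\mathbb C[\mathbf P]$, where $F(\beta,\gamma)=\mathbb C[\beta]$ with $\gamma=-\partial_\beta$ (so $[\beta,\gamma]=1$), $F(\bar\beta,\bar\gamma)$ is a second such copy, and $\mathbb C[\mathbf P]$ is the group algebra with basis $\mathbf 1_\lambda$, $\mathbf 1_\lambda\mathbf 1_\mu=\mathbf 1_{\lambda+\mu}$, $a\mathbf 1_\lambda=\lambda\mathbf 1_\lambda$. The $\mathfrak g\oplus\mathfrak g$-action on $\mathbb F$ is $$\mathbf e=\gamma,\quad \mathbf h=2\beta\gamma+a,\quad \mathbf f=-\beta^2\gamma-\beta a+\bar\gamma\,\mathbf 1_{-2}$$ (first copy) and $$\bar{\mathbf e}=\bar\gamma,\quad \bar{\mathbf h}=2\bar\beta\bar\gamma+a,\quad \bar{\mathbf f}=-\bar\beta^2\bar\gamma-\bar\beta a+\gamma\,\mathbf 1_{-2}$$ (second copy), with $\mathbf 1_{-2}$ acting by multiplication. *)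

(* Defs.v *)
From HB Require Import structures.
From mathcomp Require Import all_boot all_order all_algebra.
From mathcomp Require Import ring.
From mathcomp Require Export complex freeg.
From mathcomp Require Import boolp classical_sets functions.
From mathcomp Require Export reals.

Set Implicit Arguments.
Unset Strict Implicit.
Unset Printing Implicit Defensive.

Import GRing.Theory.
Local Open Scope ring_scope.

(* [lmod_eq K] proves an identity between two K-linear combinations by comparing
   the coefficients of each atom with [ring]. *)
Section LmodEq.
Variables (K : comNzRingType) (V : lmodType K).

Inductive lexp := LZero | LAtom of nat | LAdd of lexp & lexp | LOpp of lexp
  | LScale of K & lexp.

Fixpoint leval (s : seq V) (e : lexp) : V :=
  match e with
  | LZero => 0
  | LAtom n => s`_n
  | LAdd a b => leval s a + leval s b
  | LOpp a => - leval s a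
  | LScale c a => c *: leval s a
  end.

Fixpoint lcoef (e : lexp) (n : nat) : K :=
  match e with
  | LZero => 0
  | LAtom m => if m == n then 1 else 0
  | LAdd a b => lcoef a n + lcoef b n
  | LOpp a => - lcoef a n
  | LScale c a => c * lcoef a n
  end.

Lemma levalE s e : leval s e = \sum_(i < size s) lcoef e i *: s`_i.
Proof.
elim: e => [|n|a IHa b IHb|a IHa|c a IHa] /=.
- by rewrite big1 // => i _; rewrite scale0r.
- have [ltn|len] := ltnP n (size s); last first.
    rewrite nth_default // big1 // => i _.
    case: eqP => [e|]; last by rewrite scale0r.
    by move: len; rewrite e leqNgt ltn_ord.
  rewrite (bigD1 (Ordinal ltn)) //= eqxx scale1r big1 ?addr0 // => i ne.
  rewrite ifN ?scale0r //; apply: contra ne => /eqP e.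
  by apply/eqP/val_inj; rewrite /= e.
- by rewrite IHa IHb -big_split /=; apply: eq_bigr => i _; rewrite scalerDl.
- by rewrite IHa -sumrN; apply: eq_bigr => i _; rewrite scaleNr.
- by rewrite IHa scaler_sumr; apply: eq_bigr => i _; rewrite scalerA.
Qed.

Lemma lmod_eqP s e1 e2 :
  foldr (fun i P => lcoef e1 i = lcoef e2 i /\ P) True (iota 0 (size s)) ->
  leval s e1 = leval s e2.
Proof.
move=> H; rewrite !levalE; apply: eq_bigr => i _; congr (_ *: _).
have : (val i) \in iota 0 (size s) by rewrite mem_iota add0n /= ltn_ord.
elim: (iota _ _) H => //= j t IH [H1 H2].
by rewrite inE => /orP[/eqP ->|/(IH H2)].
Qed.
End LmodEq.

Ltac lmod_index x s :=
  lazymatch s with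
  | cons x _ => constr:(O)
  | cons _ ?t => let n := lmod_index x t in constr:(S n)
  end.

Ltac lmod_reify K s t :=
  lazymatch t with
  | @GRing.add _ ?a ?b =>
      let a' := lmod_reify K s a in let b' := lmod_reify K s b in
      constr:(LAdd a' b')
  | @GRing.opp _ ?a => let a' := lmod_reify K s a in constr:(LOpp a')
  | @GRing.scale _ _ ?c ?a =>
      let a' := lmod_reify K s a in constr:(@LScale K c a')
  | @GRing.zero _ => constr:(LZero K)
  | ?x => let n := lmod_index x s in constr:(LAtom K n)
  end.

Ltac lmod_atoms s t :=
  lazymatch t with
  | @GRing.add _ ?a ?b => let s' := lmod_atoms s a in lmod_atoms s' b
  | @GRing.opp _ ?a => lmod_atoms s a
  | @GRing.scale _ _ _ ?a => lmod_atoms s a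
  | @GRing.zero _ => s
  | ?x => match s with
          | _ => let n := lmod_index x s in s
          | _ => constr:(cons x s)
          end
  end.

Ltac lmod_eq K :=
  lazymatch goal with
  | |- @eq ?T ?l ?r =>
      let s := lmod_atoms (@nil T) l in
      let s := lmod_atoms s r in
      let l' := lmod_reify K s l in let r' := lmod_reify K s r in
      apply: (@lmod_eqP _ _ s l' r'); rewrite /=;
      repeat (split; first by ring); exact: I
  end.

Section LinearFunctions.
Variable K : comNzRingType.
Implicit Types U V W : lmodType K.

Lemma linfD U V (f : U -> V) : linear f -> forall u v, f (u + v) = f u + f v.
Proof. by move=> lf u v; rewrite -[u]scale1r lf !scale1r. Qed.

Lemma linf0 U V (f : U -> V) : linear f -> f 0 = 0.
Proof.
by move=> lf; apply: (addrI (f 0)); rewrite -(linfD lf) !addr0.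
Qed.

Lemma linfZ U V (f : U -> V) : linear f -> forall a u, f (a *: u) = a *: f u.
Proof. by move=> lf a u; rewrite -[a *: u]addr0 lf (linf0 lf) addr0. Qed.

Lemma linfN U V (f : U -> V) : linear f -> forall u, f (- u) = - f u.
Proof. by move=> lf u; rewrite -scaleN1r (linfZ lf) scaleN1r. Qed.

Lemma linf_sum U V (f : U -> V) : linear f ->
  forall I (r : seq I) (F : I -> U), f (\sum_(i <- r) F i) = \sum_(i <- r) f (F i).
Proof.
move=> lf I r F; elim: r => [|i r IH]; first by rewrite !big_nil linf0.
by rewrite !big_cons (linfD lf) IH.
Qed.

Lemma lin_id V : linear (@id V). Proof. by []. Qed.

Lemma lin_comp U V W (f : V -> W) (g : U -> V) :
  linear f -> linear g -> linear (fun x => f (g x)).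
Proof. by move=> lf lg a u v; rewrite lg lf. Qed.

Lemma lin_add U V (f g : U -> V) :
  linear f -> linear g -> linear (fun x => f x + g x).
Proof. by move=> lf lg a u v; rewrite lf lg scalerDr addrACA. Qed.

Lemma lin_opp U V (f : U -> V) : linear f -> linear (fun x => - f x).
Proof. by move=> lf a u v; rewrite lf opprD scalerN. Qed.

Lemma lin_sub U V (f g : U -> V) :
  linear f -> linear g -> linear (fun x => f x - g x).
Proof. by move=> lf lg; apply/lin_add => //; apply: lin_opp. Qed.

Lemma lin_scale U V c (f : U -> V) : linear f -> linear (fun x => c *: f x).
Proof. by move=> lf a u v; rewrite lf scalerDr !scalerA mulrC. Qed.

End LinearFunctions.

Section Subspaces.
Variables (K : fieldType) (V : lmodType K).

Record subspace := Subspace {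
  subspace_pred :> {pred V};
  subspace_closed : submod_closed subspace_pred }.

HB.instance Definition _ (S : subspace) :=
  GRing.isSubmodClosed.Build K V (subspace_pred S)
    (GRing.submod_closed_semi (subspace_closed S)).

Definition span (A : V -> Prop) : {pred V} :=
  fun v => `[< forall S : subspace, (forall x, A x -> x \in S) -> v \in S >].

Lemma span_closed A : submod_closed (span A).
Proof.
split=> [|a u v /asboolP Hu /asboolP Hv]; apply/asboolP => S AS.
  exact: rpred0.
by apply: rpredD; [apply: rpredZ; apply: Hu | apply: Hv].
Qed.

Definition span_subspace A := Subspace (span_closed A).

Lemma mem_span (A : V -> Prop) x : A x -> x \in span_subspace A.
Proof. by move=> Ax; apply/asboolP => S; apply. Qed.

Variable S : subspace.

Definition subspace_type : Type := {x : V | x \in S}.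

HB.instance Definition _ := [isSub of subspace_type for @sval V _].
HB.instance Definition _ := [Choice of subspace_type by <:].
HB.instance Definition _ := [SubChoice_isSubLmodule of subspace_type by <:].

Lemma subspace_valE a (u v : subspace_type) :
  val (a *: u + v) = a *: val u + val v.
Proof. exact: linearP. Qed.

Definition quot_space : Type := Quotient.quot S.

HB.instance Definition _ := GRing.Zmodule.on quot_space.

Definition quot_pi (v : V) : quot_space := \pi_(Quotient.quot S)%qT v.
Definition quot_repr (x : quot_space) : V := repr (x : Quotient.quot S).

Lemma quot_reprK : cancel quot_repr quot_pi.
Proof. by move=> x; apply: (@reprK _ (Quotient.quot S)). Qed.

Lemma quot_piP u v : quot_pi u = quot_pi v <-> u - v \in S.
Proof.
by rewrite Quotient.idealrBE; split=> [/eqP|/eqP].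
Qed.

Lemma quot_piB u v : quot_pi (u - v) = quot_pi u - quot_pi v.
Proof. exact: (raddfB (\pi_(Quotient.quot S)%qT)). Qed.

Lemma quot_piD u v : quot_pi (u + v) = quot_pi u + quot_pi v.
Proof. exact: (raddfD (\pi_(Quotient.quot S)%qT)). Qed.

Lemma quot_repr_pi v : quot_repr (quot_pi v) - v \in S.
Proof. by apply/quot_piP; rewrite quot_reprK. Qed.

Definition quot_scale (a : K) (x : quot_space) : quot_space :=
  quot_pi (a *: quot_repr x).

Lemma quot_scaleE a v : quot_scale a (quot_pi v) = quot_pi (a *: v).
Proof. by apply/quot_piP; rewrite -scalerBr rpredZ // quot_repr_pi. Qed.

Lemma quot_scaleA a b v : quot_scale a (quot_scale b v) = quot_scale (a * b) v.
Proof. by rewrite -[v]quot_reprK !quot_scaleE scalerA. Qed.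

Lemma quot_scale1 : left_id 1 quot_scale.
Proof. by move=> v; rewrite -[v]quot_reprK quot_scaleE scale1r. Qed.

Lemma quot_scaleDr : right_distributive quot_scale +%R.
Proof.
move=> a u v; rewrite -[u]quot_reprK -[v]quot_reprK.
by rewrite -quot_piD !quot_scaleE scalerDr quot_piD.
Qed.

Lemma quot_scaleDl v : {morph quot_scale^~ v : a b / a + b}.
Proof.
by move=> a b; rewrite -[v]quot_reprK !quot_scaleE scalerDl quot_piD.
Qed.

HB.instance Definition _ := GRing.Zmodule_isLmodule.Build K quot_space
  quot_scaleA quot_scale1 quot_scaleDr quot_scaleDl.

Lemma quot_pi_linear : linear quot_pi.
Proof. by move=> a u v; rewrite quot_piD -quot_scaleE. Qed.

Section Lift.
Variables (W : lmodType K) (f : V -> W).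
Hypotheses (lf : linear f) (fS : forall v, v \in S -> f v = 0).

Lemma quot_liftE v : f (quot_repr (quot_pi v)) = f v.
Proof.
by apply/eqP; rewrite -subr_eq0 -(linfN lf) -(linfD lf) fS // quot_repr_pi.
Qed.

Lemma quot_lift_linear : linear (fun x => f (quot_repr x)).
Proof.
move=> a u v; rewrite -{1}[u]quot_reprK -{1}[v]quot_reprK.
by rewrite -quot_pi_linear quot_liftE lf.
Qed.
End Lift.

End Subspaces.

Section DirectSum.
Variables (K : fieldType) (I : choiceType) (V : I -> lmodType K).

Definition dprod : Type := forall i, V i.

HB.instance Definition _ := gen_eqMixin dprod.
HB.instance Definition _ := gen_choiceMixin dprod.

Let dext (f g : dprod) : (forall i, f i = g i) -> f = g.
Proof. exact: functional_extensionality_dep. Qed.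

Let dadd (f g : dprod) : dprod := fun i => f i + g i.
Let dopp (f : dprod) : dprod := fun i => - f i.
Let dscale (a : K) (f : dprod) : dprod := fun i => a *: f i.

Fact dprod_addA : associative dadd.
Proof. by move=> f g h; apply: dext => i; apply: addrA. Qed.
Fact dprod_addC : commutative dadd.
Proof. by move=> f g; apply: dext => i; apply: addrC. Qed.
Fact dprod_add0 : left_id (fun i => 0) dadd.
Proof. by move=> f; apply: dext => i; apply: add0r. Qed.
Fact dprod_addN : left_inverse (fun i => 0) dopp dadd.
Proof. by move=> f; apply: dext => i; apply: addNr. Qed.

HB.instance Definition _ := GRing.isZmodule.Build dprod
  dprod_addA dprod_addC dprod_add0 dprod_addN.

Fact dprod_scaleA a b f : dscale a (dscale b f) = dscale (a * b) f.
Proof. by apply: dext => i; apply: scalerA. Qed.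
Fact dprod_scale1 : left_id 1 dscale.
Proof. by move=> f; apply: dext => i; apply: scale1r. Qed.
Fact dprod_scaleDr : right_distributive dscale +%R.
Proof. by move=> a f g; apply: dext => i; apply: scalerDr. Qed.
Fact dprod_scaleDl f : {morph dscale^~ f : a b / a + b}.
Proof. by move=> a b; apply: dext => i; apply: scalerDl. Qed.

HB.instance Definition _ := GRing.Zmodule_isLmodule.Build K dprod
  dprod_scaleA dprod_scale1 dprod_scaleDr dprod_scaleDl.

Definition finitely_supported : {pred dprod} :=
  fun f => `[< exists s : seq I, forall i, i \notin s -> f i = 0 >].

Lemma finitely_supported_closed : submod_closed finitely_supported.
Proof.
split=> [|a f g /asboolP[s fs] /asboolP[t gt]]; apply/asboolP.
  by exists [::].
exists (s ++ t) => i; rewrite mem_cat negb_or => /andP[si ti].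
by rewrite -[LHS]/(a *: f i + g i) fs // gt // scaler0 addr0.
Qed.

Definition dsum : lmodType K :=
  subspace_type (Subspace finitely_supported_closed).

Lemma dsum_supp (f : dsum) : exists s : seq I, forall i, i \notin s -> val f i = 0.
Proof. exact: asboolP (valP f). Qed.

Lemma dsumP (f g : dsum) : (forall i, val f i = val g i) -> f = g.
Proof. by move=> H; apply: val_inj; apply: dext. Qed.

End DirectSum.

Section TensorProduct.
Variables (K : fieldType) (V W : lmodType K).

Definition tensor_relation (x : {freeg (V * W) / K}) : Prop :=
  (exists a v v' w, x = << (a *: v + v', w) >> - a *: << (v, w) >> - << (v', w) >>)
  \/
  (exists a v w w', x = << (v, a *: w + w') >> - a *: << (v, w) >> - << (v, w') >>).

Definition tensor : lmodType K := quot_space (span_subspace tensor_relation).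

Definition tens (v : V) (w : W) : tensor := quot_pi _ << (v, w) >>.

End TensorProduct.

Section TensorTheory.
Variable K : fieldType.
Implicit Types U V W : lmodType K.

Lemma fgliftD (X : choiceType) U (f : X -> U) (x y : {freeg X / K}) :
  fglift f (x + y) = fglift f x + fglift f y.
Proof.
have fB u v : fglift f (u - v) = fglift f u - fglift f v.
  exact: lift_is_additive.
have f0 : fglift f 0 = 0 by rewrite -(subrr (0 : {freeg X / K})) fB subrr.
by rewrite -[y in LHS]opprK fB -[- y]add0r fB f0 sub0r opprK.
Qed.

Lemma fglift_sum (X : choiceType) U (f : X -> U) (D : {freeg X / K}) :
  fglift f D = \sum_(x <- dom D) coeff x D *: f x.
Proof.
rewrite -{1}[D]freeg_sumE; elim: (dom D) => [|x s IH].
  by rewrite !big_nil; apply: (addrI (fglift f 0)); rewrite -fgliftD !addr0.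
by rewrite !big_cons fgliftD IH liftU.
Qed.

Lemma fglift1 (X : choiceType) U (f : X -> U) (x : X) : fglift f << x >> = f x.
Proof. by rewrite liftU scale1r. Qed.

Lemma fglift_linear (X : choiceType) U (f : X -> U) : linear (@fglift K U X f).
Proof.
move=> a D E; rewrite fgliftD; congr (_ + _).
have [->|a0] := eqVneq a 0; first by rewrite !scale0r fglift_sum dom0 big_nil.
rewrite !fglift_sum scaler_sumr (perm_big (dom D)) /=.
  by apply: eq_bigr => x _; rewrite coeffZ scalerA.
by apply: uniq_perm; rewrite ?uniq_dom //; apply: domZ.
Qed.

Lemma freeg_ext (X : choiceType) U (f g : {freeg X / K} -> U) :
  linear f -> linear g -> (forall x, f << x >> = g << x >>) -> f =1 g.
Proof.
move=> lf lg fg D; rewrite -[D]freeg_sumE (linf_sum lf) (linf_sum lg).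
apply: eq_bigr => x _.
have -> : << coeff x D *g x >> = coeff x D *: << x >> :> {freeg X / K}.
  by apply/eqP/freeg_eqP => y; rewrite coeffZ !coeffU mul1r.
by rewrite (linfZ lf) (linfZ lg) fg.
Qed.

Lemma tensDZl V W a v v' (w : W) :
  tens (a *: v + v' : V) w = a *: tens v w + tens v' w.
Proof.
rewrite -quot_pi_linear; apply/quot_piP/mem_span; left.
by exists a, v, v', w; rewrite opprD addrA.
Qed.

Lemma tensDZr V W (v : V) a (w w' : W) :
  tens v (a *: w + w') = a *: tens v w + tens v w'.
Proof.
rewrite -quot_pi_linear; apply/quot_piP/mem_span; right.
by exists a, v, w, w'; rewrite opprD addrA.
Qed.

Lemma tens_linl V W (w : W) : linear (fun v : V => tens v w).
Proof. by move=> a v v'; apply: tensDZl. Qed.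

Lemma tens_linr V W (v : V) : linear (fun w : W => tens v w).
Proof. by move=> a w w'; apply: tensDZr. Qed.

Definition bilin U V W (f : V -> W -> U) :=
  (forall w, linear (f^~ w)) /\ (forall v, linear (f v)).

(* The linear map V (x) W -> U sending v (x) w to f v w, for f bilinear. *)
Definition tensor_lift U V W (f : V -> W -> U) (t : tensor V W) : U :=
  fglift (fun p => f p.1 p.2) (quot_repr t).

Section Lift.
Variables (U V W : lmodType K) (f : V -> W -> U).
Hypothesis bf : bilin f.

Let F := @fglift K U (V * W)%type (fun p => f p.1 p.2).

Let FS x : x \in span_subspace (@tensor_relation K V W) -> F x = 0.
Proof.
move=> xS; apply/eqP.
have lF : linear F by exact: fglift_linear.
have kc : submod_closed [pred x | F x == 0].
  split=> [|a u v]; rewrite !inE; first by rewrite (linf0 lF).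
  by move=> /eqP Hu /eqP Hv; rewrite lF Hu Hv scaler0 addr0.
move/asboolP: xS => /(_ (Subspace kc)); apply => {}x; rewrite inE.
case=> [[a [v [v' [w ->]]]]|[a [v [w [w' ->]]]]];
  rewrite !(linfD lF) !(linfN lF) (linfZ lF) /F !fglift1 /=.
  by rewrite bf.1 -addrA -opprD subrr.
by rewrite bf.2 -addrA -opprD subrr.
Qed.

Lemma tensor_lift_tens v w : tensor_lift f (tens v w) = f v w.
Proof.
by rewrite /tensor_lift (quot_liftE (fglift_linear _) FS) /F fglift1.
Qed.

Lemma tensor_lift_linear : linear (tensor_lift f).
Proof. exact: quot_lift_linear (fglift_linear _) FS. Qed.
End Lift.

Lemma tensor_ext U V W (f g : tensor V W -> U) : linear f -> linear g ->
  (forall v w, f (tens v w) = g (tens v w)) -> f =1 g.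
Proof.
move=> lf lg fg t; rewrite -[t]quot_reprK.
apply: (freeg_ext (f := fun x => f (quot_pi _ x)) (g := fun x => g (quot_pi _ x))).
- exact: lin_comp lf (@quot_pi_linear _ _ _).
- exact: lin_comp lg (@quot_pi_linear _ _ _).
- by move=> [v w]; apply: fg.
Qed.

Definition tensor_map V W V' W' (f : V -> V') (g : W -> W') :
  tensor V W -> tensor V' W' := tensor_lift (fun v w => tens (f v) (g w)).

Section Map.
Variables (V W V' W' : lmodType K) (f : V -> V') (g : W -> W').
Hypotheses (lf : linear f) (lg : linear g).

Let bfg : bilin (fun v w => tens (f v) (g w)).
Proof.
split=> [w|v]; first exact: lin_comp (tens_linl _) lf.
exact: lin_comp (tens_linr _) lg.
Qed.

Lemma tensor_map_tens v w : tensor_map f g (tens v w) = tens (f v) (g w).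
Proof. exact: tensor_lift_tens bfg _ _. Qed.

Lemma tensor_map_linear : linear (tensor_map f g).
Proof. exact: tensor_lift_linear bfg. Qed.
End Map.
End TensorTheory.

Section LieAlgebras.
Variable K : fieldType.

Record lie_algebra := LieAlgebra {
  lie_space :> lmodType K;
  lie_bracket : lie_space -> lie_space -> lie_space;
  lie_bracket_bilin : bilin lie_bracket;
  lie_bracket_alt : forall x, lie_bracket x x = 0;
  lie_jacobi : forall x y z,
    lie_bracket x (lie_bracket y z) + lie_bracket y (lie_bracket z x)
    + lie_bracket z (lie_bracket x y) = 0 }.

Record lie_module (g : lie_algebra) := LieModule {
  module_space :> lmodType K;
  act : g -> module_space -> module_space;
  act_bilin : bilin act;
  act_bracket : forall x y v,
    act (lie_bracket x y) v = act x (act y v) - act y (act x v) }.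

Section DirectSumAlgebra.
Variables g1 g2 : lie_algebra.

Definition lie_dsum_bracket (x y : g1 * g2) : g1 * g2 :=
  (lie_bracket x.1 y.1, lie_bracket x.2 y.2).

Fact lie_dsum_bilin : @bilin K _ _ _ lie_dsum_bracket.
Proof.
split=> [y|y] a u v; congr pair.
- exact: (lie_bracket_bilin g1).1.
- exact: (lie_bracket_bilin g2).1.
- exact: (lie_bracket_bilin g1).2.
- exact: (lie_bracket_bilin g2).2.
Qed.

Fact lie_dsum_alt x : lie_dsum_bracket x x = 0.
Proof. by rewrite /lie_dsum_bracket !lie_bracket_alt. Qed.

Fact lie_dsum_jacobi x y z :
  lie_dsum_bracket x (lie_dsum_bracket y z)
  + lie_dsum_bracket y (lie_dsum_bracket z x)
  + lie_dsum_bracket z (lie_dsum_bracket x y) = 0.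
Proof. by congr pair; apply: lie_jacobi. Qed.

Definition lie_dsum := LieAlgebra lie_dsum_bilin lie_dsum_alt lie_dsum_jacobi.
End DirectSumAlgebra.

Section Modules.
Variable g : lie_algebra.
Implicit Types M N : lie_module g.

Lemma act_lin M (x : g) : linear (act x : M -> M).
Proof. exact: (act_bilin M).2. Qed.

Lemma act_linl M (v : M) : linear (fun x : g => act x v).
Proof. exact: (act_bilin M).1. Qed.

Record submodule M := Submodule {
  submodule_space :> subspace M;
  submodule_act : forall x v, v \in submodule_space -> act x v \in submodule_space }.

Definition module_iso M N : Prop := exists f : M -> N,
  [/\ linear f, bijective f & forall x v, f (act x v) = act x (f v)].

Section Sub.
Variables (M : lie_module g) (S : submodule M).

Definition sub_act (x : g) (v : subspace_type S) : subspace_type S :=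
  exist _ (act x (val v)) (submodule_act x (valP v)).

Fact sub_act_bilin : bilin sub_act.
Proof.
split=> [w|w] a u v; apply: val_inj; first exact: (act_bilin M).1.
exact: (act_bilin M).2.
Qed.

Fact sub_act_bracket x y v :
  sub_act (lie_bracket x y) v = sub_act x (sub_act y v) - sub_act y (sub_act x v).
Proof. by apply: val_inj; apply: act_bracket. Qed.

Definition sub_module : lie_module g := LieModule sub_act_bilin sub_act_bracket.

Definition quot_act (x : g) (v : quot_space S) : quot_space S :=
  quot_pi S (act x (quot_repr v)).

Lemma quot_actE x v : quot_act x (quot_pi S v) = quot_pi S (act x v).
Proof.
apply/quot_piP; rewrite -(linfN (act_lin _)) -(linfD (act_lin _)).
exact/submodule_act/quot_repr_pi.
Qed.

Fact quot_act_bilin : bilin quot_act.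
Proof.
split=> [w|w] a u v.
  by rewrite -[w]quot_reprK !quot_actE act_linl quot_pi_linear.
rewrite -[u]quot_reprK -[v]quot_reprK -quot_pi_linear !quot_actE.
by rewrite act_lin quot_pi_linear.
Qed.

Fact quot_act_bracket x y v :
  quot_act (lie_bracket x y) v = quot_act x (quot_act y v) - quot_act y (quot_act x v).
Proof. by rewrite -[v]quot_reprK !quot_actE act_bracket quot_piB. Qed.

Definition quot_module : lie_module g := LieModule quot_act_bilin quot_act_bracket.
End Sub.

Section SubQuotient.
Variables (M : lie_module g) (A B : submodule M).

Definition restrict_pred : {pred sub_module A} := [pred v | val v \in B].

Fact restrict_closed : submod_closed restrict_pred.
Proof.
by split=> [|a u v]; rewrite !inE; [exact: rpred0 | move=> *; rewrite rpredD ?rpredZ].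
Qed.

Fact restrict_act (x : g) (v : sub_module A) :
  v \in Subspace restrict_closed -> act x v \in Subspace restrict_closed.
Proof. by rewrite !inE; apply: submodule_act. Qed.

(* A / B for submodules B <= A of M, where A /\ B is seen as a submodule of A. *)
Definition subquotient : lie_module g := quot_module (Submodule restrict_act).
End SubQuotient.

Section DirectSum.
Variables (I : choiceType) (M : I -> lie_module g).

Let dsact (x : g) (f : dprod (fun i => M i)) : dprod (fun i => M i) :=
  fun i => act x (f i).

Fact dsum_act_supp x (f : dsum (fun i => M i)) :
  dsact x (val f) \in finitely_supported (V := fun i => M i).
Proof.
have [s fs] := dsum_supp f.
by apply/asboolP; exists s => i /fs fi0; rewrite /dsact fi0 (linf0 (act_lin _)).
Qed.

Definition dsum_act (x : g) (f : dsum (fun i => M i)) : dsum (fun i => M i) :=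
  exist _ (dsact x (val f)) (dsum_act_supp x f).

Fact dsum_act_bilin : bilin dsum_act.
Proof.
split=> [w|w] a u v; apply: dsumP => i; first exact: (act_bilin (M i)).1.
exact: (act_bilin (M i)).2.
Qed.

Fact dsum_act_bracket x y v :
  dsum_act (lie_bracket x y) v = dsum_act x (dsum_act y v) - dsum_act y (dsum_act x v).
Proof. by apply: dsumP => i; apply: act_bracket. Qed.

Definition dsum_module : lie_module g := LieModule dsum_act_bilin dsum_act_bracket.
End DirectSum.

Section BinaryDirectSum.
Variables M N : lie_module g.

Definition pair_act (x : g) (v : M * N) : M * N := (act x v.1, act x v.2).

Fact pair_act_bilin : @bilin K _ _ _ pair_act.
Proof.
split=> [w|w] a u v; congr pair; rewrite /= ?act_linl ?act_lin //.
Qed.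

Fact pair_act_bracket x y v :
  pair_act (lie_bracket x y) v = pair_act x (pair_act y v) - pair_act y (pair_act x v).
Proof. by congr pair; apply: act_bracket. Qed.

Definition pair_module : lie_module g := LieModule pair_act_bilin pair_act_bracket.
End BinaryDirectSum.

Definition irreducible M : Prop :=
  (exists v : M, v != 0) /\
  forall S : submodule M, (forall v, v \in S -> v = 0) \/ (forall v, v \in S).

Definition generates M (v : M) : Prop :=
  forall S : submodule M, v \in S -> forall w, w \in S.

End Modules.

(* V (x) W as a (g1 (+) g2)-module, gi acting on the i-th factor. *)
Section TensorModule.
Variables (g1 g2 : lie_algebra) (V : lie_module g1) (W : lie_module g2).

Definition tensor_act (x : lie_dsum g1 g2) : tensor V W -> tensor V W :=
  tensor_lift (fun v w => tens (act x.1 v) w + tens v (act x.2 w)).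

Let tab x : bilin (fun v w => tens (act x.1 v) w + tens v (act x.2 w) : tensor V W).
Proof.
split=> [w|v]; apply: lin_add; do ?exact: tens_linl; do ?exact: tens_linr.
  exact: lin_comp (tens_linl _) (act_lin _).
exact: lin_comp (tens_linr _) (act_lin _).
Qed.

Lemma tensor_act_tens x v w :
  tensor_act x (tens v w) = tens (act x.1 v) w + tens v (act x.2 w).
Proof. exact: tensor_lift_tens (tab x) _ _. Qed.

Lemma tensor_act_linear x : linear (tensor_act x).
Proof. exact: tensor_lift_linear (tab x). Qed.

Fact tensor_act_bilin : bilin tensor_act.
Proof.
split=> [t a x y|x]; last exact: tensor_act_linear.
move: t; apply: tensor_ext (tensor_act_linear _) _ _.
  by apply: lin_add; [apply: lin_scale|]; apply: tensor_act_linear.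
move=> v w; rewrite !tensor_act_tens /= !act_linl tensDZl tensDZr.
by rewrite scalerDr addrACA.
Qed.

Fact tensor_act_bracket x y t :
  tensor_act (lie_bracket x y) t
  = tensor_act x (tensor_act y t) - tensor_act y (tensor_act x t).
Proof.
have lT := tensor_act_linear.
move: t; apply: tensor_ext (lT _) _ _.
  by apply: lin_sub; apply: lin_comp.
move=> v w; rewrite !tensor_act_tens !(linfD (lT _)) !tensor_act_tens /=.
rewrite !act_bracket (linfD (tens_linl _)) (linfN (tens_linl _)).
rewrite (linfD (tens_linr _)) (linfN (tens_linr _)).
lmod_eq K.
Qed.

Definition tensor_module : lie_module (lie_dsum g1 g2) :=
  LieModule tensor_act_bilin tensor_act_bracket.
End TensorModule.

End LieAlgebras.

Section SL2.
Variable K : fieldType.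

Definition trace_zero : {pred 'M[K]_2} := [pred x | \tr x == 0].

Fact trace_zero_closed : submod_closed trace_zero.
Proof.
split=> [|a x y]; rewrite !inE ?mxtrace0 // mxtraceD mxtraceZ.
by move=> /eqP -> /eqP ->; rewrite mulr0 addr0.
Qed.

Definition sl2_space := subspace_type (Subspace trace_zero_closed).

Fact commutator_trace (x y : sl2_space) :
  val x *m val y - val y *m val x \in trace_zero.
Proof. by rewrite inE linearB /= mxtrace_mulC subrr. Qed.

Definition sl2_bracket (x y : sl2_space) : sl2_space :=
  exist _ (val x *m val y - val y *m val x) (commutator_trace x y).

Fact sl2_bilin : bilin sl2_bracket.
Proof.
split=> [w|w] a u v; apply: val_inj => /=.
  rewrite mulmxDl mulmxDr -scalemxAl -scalemxAr.
  by rewrite scalerBr opprD addrACA.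
rewrite mulmxDl mulmxDr -scalemxAl -scalemxAr.
by rewrite scalerBr opprD addrACA.
Qed.

Fact sl2_alt x : sl2_bracket x x = 0.
Proof. by apply: val_inj; apply: subrr. Qed.

Fact sl2_jacobi x y z :
  sl2_bracket x (sl2_bracket y z) + sl2_bracket y (sl2_bracket z x)
  + sl2_bracket z (sl2_bracket x y) = 0.
Proof.
apply: val_inj => /=.
rewrite !mulmxBl !mulmxBr !mulmxA.
lmod_eq K.
Qed.

Definition sl2 : lie_algebra K := LieAlgebra sl2_bilin sl2_alt sl2_jacobi.

Definition sl2_elt (a b c : K) : 'M[K]_2 :=
  \matrix_(i, j) (if i == 0 then if j == 0 then b else a
                  else if j == 0 then c else - b).

Fact sl2_elt_trace a b c : sl2_elt a b c \in trace_zero.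
Proof.
by rewrite inE /mxtrace !big_ord_recl big_ord0 !mxE /= addr0 subrr.
Qed.

Definition sl2_mk a b c : sl2 := exist _ (sl2_elt a b c) (sl2_elt_trace a b c).

Definition sl2_e : sl2 := sl2_mk 1 0 0.
Definition sl2_h : sl2 := sl2_mk 0 1 0.
Definition sl2_f : sl2 := sl2_mk 0 0 1.

Definition sl2_ce (x : sl2) : K := val x 0 1.
Definition sl2_ch (x : sl2) : K := val x 0 0.
Definition sl2_cf (x : sl2) : K := val x 1 0.

Lemma sl2_c11 (x : sl2) : val x 1 1 = - sl2_ch x.
Proof.
have := valP x; rewrite inE /mxtrace !big_ord_recl big_ord0 addr0 addrC.
rewrite addr_eq0 => /eqP; congr (_ = - _); congr (val x _ _); exact: val_inj.
Qed.

Lemma sl2_ext (x y : sl2) : sl2_ce x = sl2_ce y -> sl2_ch x = sl2_ch y ->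
  sl2_cf x = sl2_cf y -> x = y.
Proof.
move=> He Hh Hf; apply/val_inj/matrixP => i j.
have ord2 (k : 'I_2) : k = 0 \/ k = 1.
  by case: k => [[|[|//]] ?]; [left|right]; apply: val_inj.
by case: (ord2 i) (ord2 j) => -> [] ->; rewrite ?sl2_c11 ?Hh.
Qed.

Lemma sl2_cmk a b c : (sl2_ce (sl2_mk a b c) = a) * (sl2_ch (sl2_mk a b c) = b)
  * (sl2_cf (sl2_mk a b c) = c).
Proof. by rewrite /sl2_ce /sl2_ch /sl2_cf /= !mxE. Qed.

Lemma sl2_decomp (x : sl2) :
  x = sl2_ce x *: sl2_e + sl2_ch x *: sl2_h + sl2_cf x *: sl2_f.
Proof.
apply: sl2_ext; rewrite /sl2_ce /sl2_ch /sl2_cf /= !mxE /=.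
- by rewrite mulr1 !mulr0 !addr0.
- by rewrite mulr1 !mulr0 addr0 add0r.
- by rewrite mulr1 !mulr0 !add0r.
Qed.

Lemma sl2_bracket_coef (x y : sl2) :
  (sl2_ce (lie_bracket x y) = 2 * (sl2_ch x * sl2_ce y - sl2_ce x * sl2_ch y))
  * (sl2_ch (lie_bracket x y) = sl2_ce x * sl2_cf y - sl2_cf x * sl2_ce y)
  * (sl2_cf (lie_bracket x y) = 2 * (sl2_cf x * sl2_ch y - sl2_ch x * sl2_cf y)).
Proof.
have l0 : fintype.lift ord0 ord0 = 1 :> 'I_2 by apply: val_inj.
have e0 : ord0 = 0 :> 'I_2 by [].
rewrite /sl2_ce /sl2_ch /sl2_cf /= !mxE !big_ord_recl !big_ord0 !l0 !e0.
by rewrite !sl2_c11 /sl2_ch; split; [split|]; ring.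
Qed.

Lemma sl2_he : lie_bracket sl2_h sl2_e = 2 *: sl2_e.
Proof.
apply: sl2_ext; rewrite !sl2_bracket_coef /sl2_ce /sl2_ch /sl2_cf /= !mxE /=; ring.
Qed.

Lemma sl2_hf : lie_bracket sl2_h sl2_f = - 2 *: sl2_f.
Proof.
apply: sl2_ext; rewrite !sl2_bracket_coef /sl2_ce /sl2_ch /sl2_cf /= !mxE /=; ring.
Qed.

Lemma sl2_ef : lie_bracket sl2_e sl2_f = sl2_h.
Proof.
apply: sl2_ext; rewrite !sl2_bracket_coef /sl2_ce /sl2_ch /sl2_cf /= !mxE /=; ring.
Qed.

(* The involution with omega(e) = -f, omega(h) = -h, omega(f) = -e. *)
Definition omega (x : sl2) : sl2 := sl2_mk (- sl2_cf x) (- sl2_ch x) (- sl2_ce x).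

Lemma omega_e : omega sl2_e = - sl2_f.
Proof. by apply: sl2_ext; rewrite !sl2_cmk /sl2_ce /sl2_ch /sl2_cf /= !mxE /= ?oppr0. Qed.

Lemma omega_h : omega sl2_h = - sl2_h.
Proof. by apply: sl2_ext; rewrite !sl2_cmk /sl2_ce /sl2_ch /sl2_cf /= !mxE /= ?oppr0. Qed.

Lemma omega_f : omega sl2_f = - sl2_e.
Proof. by apply: sl2_ext; rewrite !sl2_cmk /sl2_ce /sl2_ch /sl2_cf /= !mxE /= ?oppr0. Qed.

Lemma sl2_clin (a : K) (x y : sl2) :
  (sl2_ce (a *: x + y) = a * sl2_ce x + sl2_ce y)
  * (sl2_ch (a *: x + y) = a * sl2_ch x + sl2_ch y)
  * (sl2_cf (a *: x + y) = a * sl2_cf x + sl2_cf y).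
Proof. by rewrite /sl2_ce /sl2_ch /sl2_cf /= !mxE. Qed.

Lemma omega_linear : linear omega.
Proof.
by move=> a x y; apply: sl2_ext; rewrite !(sl2_cmk, sl2_clin); ring.
Qed.

Lemma omega_bracket x y : omega (lie_bracket x y) = lie_bracket (omega x) (omega y).
Proof.
by apply: sl2_ext; rewrite !sl2_cmk !sl2_bracket_coef !sl2_cmk; ring.
Qed.

End SL2.

Section SL2Modules.
Variable K : fieldType.

(* An sl2-module from operators satisfying the relations of e, h, f. *)
Section Triple.
Variables (V : lmodType K) (E H F : V -> V).
Hypotheses (lE : linear E) (lH : linear H) (lF : linear F).
Hypothesis HE : forall v, H (E v) - E (H v) = 2 *: E v.
Hypothesis HF : forall v, H (F v) - F (H v) = - 2 *: F v.
Hypothesis EF : forall v, E (F v) - F (E v) = H v.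

Definition triple_act (x : sl2 K) (v : V) : V :=
  sl2_ce x *: E v + sl2_ch x *: H v + sl2_cf x *: F v.

Fact triple_bilin : bilin triple_act.
Proof.
split=> [v a x y|x]; last by do !apply: lin_add; apply: lin_scale.
rewrite /triple_act !sl2_clin; lmod_eq K.
Qed.

Fact triple_bracket x y v : triple_act (lie_bracket x y) v
  = triple_act x (triple_act y v) - triple_act y (triple_act x v).
Proof.
rewrite /triple_act !sl2_bracket_coef.
rewrite !(linfD lE) !(linfD lH) !(linfD lF) !(linfZ lE) !(linfZ lH) !(linfZ lF).
have -> : H (E v) = 2 *: E v + E (H v) by rewrite -HE subrK.
have -> : H (F v) = - 2 *: F v + F (H v) by rewrite -HF subrK.
have -> : E (F v) = H v + F (E v) by rewrite -EF subrK.
lmod_eq K.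
Qed.

Definition triple_module : lie_module (sl2 K) :=
  LieModule triple_bilin triple_bracket.
End Triple.

Lemma triple_act0 (V : lmodType K) (E H F : V -> V) v :
  triple_act E H F 0 v = 0.
Proof.
by rewrite /triple_act /sl2_ce /sl2_ch /sl2_cf /= !mxE !scale0r !addr0.
Qed.

Lemma triple_commute (V : lmodType K) (E H F E' H' F' : V -> V) :
  linear E -> linear H -> linear F -> linear E' -> linear H' -> linear F' ->
  (forall v, E (E' v) = E' (E v)) -> (forall v, E (H' v) = H' (E v)) ->
  (forall v, E (F' v) = F' (E v)) -> (forall v, H (E' v) = E' (H v)) ->
  (forall v, H (H' v) = H' (H v)) -> (forall v, H (F' v) = F' (H v)) ->
  (forall v, F (E' v) = E' (F v)) -> (forall v, F (H' v) = H' (F v)) ->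
  (forall v, F (F' v) = F' (F v)) -> forall x y v,
  triple_act E H F x (triple_act E' H' F' y v)
  = triple_act E' H' F' y (triple_act E H F x v).
Proof.
move=> lE lH lF lE' lH' lF' h1 h2 h3 h4 h5 h6 h7 h8 h9 x y v; rewrite /triple_act.
rewrite !(linfD lE, linfD lH, linfD lF, linfD lE', linfD lH', linfD lF').
rewrite !(linfZ lE, linfZ lH, linfZ lF, linfZ lE', linfZ lH', linfZ lF').
rewrite !(h1, h2, h3, h4, h5, h6, h7, h8, h9); lmod_eq K.
Qed.

(* A (g1 (+) g2)-module from two commuting actions. *)
Section Commuting.
Variables (g1 g2 : lie_algebra K) (V : lmodType K).
Variables (r1 : g1 -> V -> V) (r2 : g2 -> V -> V).
Hypotheses (b1 : bilin r1) (b2 : bilin r2).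
Hypothesis m1 : forall x y v,
  r1 (lie_bracket x y) v = r1 x (r1 y v) - r1 y (r1 x v).
Hypothesis m2 : forall x y v,
  r2 (lie_bracket x y) v = r2 x (r2 y v) - r2 y (r2 x v).
Hypothesis r12 : forall x y v, r1 x (r2 y v) = r2 y (r1 x v).

Definition commuting_act (x : lie_dsum g1 g2) (v : V) : V := r1 x.1 v + r2 x.2 v.

Fact commuting_bilin : bilin commuting_act.
Proof.
split=> [v a x y|x]; last by apply: lin_add; [exact: b1.2 | exact: b2.2].
by rewrite /commuting_act /= b1.1 b2.1 scalerDr addrACA.
Qed.

Fact commuting_bracket x y v : commuting_act (lie_bracket x y) v
  = commuting_act x (commuting_act y v) - commuting_act y (commuting_act x v).
Proof.
rewrite /commuting_act /= m1 m2 !(linfD (b1.2 _)) !(linfD (b2.2 _)) !r12.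
lmod_eq K.
Qed.

Definition commuting_module : lie_module (lie_dsum g1 g2) :=
  LieModule commuting_bilin commuting_bracket.
End Commuting.

Section RestrictedDual.
Variable M : lie_module (sl2 K).

Definition weight_space (mu : K) : {pred M} :=
  [pred v | act (sl2_h K) v == mu *: v].

(* The linear forms killing all but finitely many weight spaces: when M is the
   direct sum of its weight spaces, this is the direct sum of their duals,
   viewed inside the full dual through the pairing. *)
Definition restricted_form : {pred M -> K^o} :=
  fun phi => `[< linear phi /\ exists s : seq K,
    forall mu v, mu \notin s -> v \in weight_space mu -> phi v = 0 >].

Fact restricted_form_closed : submod_closed restricted_form.
Proof.
split=> [|a f g /asboolP[lf [s fs]] /asboolP[lg [t gt]]]; apply/asboolP; split.
- by move=> a u v; rewrite scaler0 addr0.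
- by exists [::].
- by apply: lin_add => //; apply: lin_scale.
exists (s ++ t) => mu v; rewrite mem_cat negb_or => /andP[ms mt] vmu.
by rewrite -[LHS]/(a *: f v + g v) (fs mu) // (gt mu) // scaler0 addr0.
Qed.

Definition rdual_space : lmodType K :=
  subspace_type (Subspace restricted_form_closed).

Definition rdual_fun (x : sl2 K) (phi : rdual_space) : M -> K^o :=
  fun v => - val phi (act (omega x) v).

Lemma weight_e mu v : v \in weight_space mu ->
  act (sl2_e K) v \in weight_space (mu + 2).
Proof.
rewrite !inE => /eqP hv; have := act_bracket (sl2_h K) (sl2_e K) v.
rewrite sl2_he (linfZ (act_linl _)) hv (linfZ (act_lin _)).
by move=> H; apply/eqP; rewrite -[LHS](subrK (mu *: act (sl2_e K) v)) -H -scalerDl addrC.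
Qed.

Lemma weight_f mu v : v \in weight_space mu ->
  act (sl2_f K) v \in weight_space (mu - 2).
Proof.
rewrite !inE => /eqP hv; have := act_bracket (sl2_h K) (sl2_f K) v.
rewrite sl2_hf (linfZ (act_linl _)) hv (linfZ (act_lin _)).
by move=> H; apply/eqP; rewrite -[LHS](subrK (mu *: act (sl2_f K) v)) -H -scalerDl addrC.
Qed.

Fact rdual_fun_subproof x phi : rdual_fun x phi \in restricted_form.
Proof.
have [lphi [s phis]] := asboolP _ (valP phi); apply/asboolP; split.
  by apply: lin_opp; apply: lin_comp => //; apply: act_lin.
exists (s ++ [seq m - 2 | m <- s] ++ [seq m + 2 | m <- s]) => mu v.
rewrite !mem_cat !negb_or => /and3P[ms me mf] vmu.
rewrite /rdual_fun [omega x]sl2_decomp !(linfD (act_linl _)) !(linfZ (act_linl _)).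
rewrite !(linfD lphi) !(linfZ lphi).
rewrite (phis (mu + 2) (act (sl2_e K) v)) ?weight_e //; last first.
  by apply: contra me => H; apply/mapP; exists (mu + 2) => //; rewrite addrK.
rewrite (phis (mu - 2) (act (sl2_f K) v)) ?weight_f //; last first.
  by apply: contra mf => H; apply/mapP; exists (mu - 2) => //; rewrite subrK.
move: (vmu); rewrite inE => /eqP ->.
by rewrite (linfZ lphi) (phis mu v) // !scaler0 !addr0 oppr0.
Qed.

Definition rdual_act (x : sl2 K) (phi : rdual_space) : rdual_space :=
  exist _ (rdual_fun x phi) (rdual_fun_subproof x phi).

Lemma rdual_linear (phi : rdual_space) : linear (val phi : M -> K^o).
Proof. by case/asboolP: (valP phi). Qed.

Let fct_valE (a : K) (f g : M -> K^o) v : (a *: f + g) v = a * f v + g v.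
Proof. by []. Qed.

Lemma rdual_valE a (f g : rdual_space) v :
  val (a *: f + g) v = a * val f v + val g v.
Proof. by rewrite subspace_valE fct_valE. Qed.

Fact rdual_bilin : bilin rdual_act.
Proof.
split=> [phi a x y|x a f g]; apply/val_inj/funext => v.
  rewrite rdual_valE /= /rdual_fun omega_linear act_linl (rdual_linear phi).
  by rewrite opprD -mulrN.
by rewrite rdual_valE /= /rdual_fun rdual_valE opprD mulrN.
Qed.

Fact rdual_bracket x y phi : rdual_act (lie_bracket x y) phi
  = rdual_act x (rdual_act y phi) - rdual_act y (rdual_act x phi).
Proof.
apply/val_inj/funext => v; have lphi := rdual_linear phi.
rewrite -[RHS]/(- - _ - - - _) /= /rdual_fun omega_bracket act_bracket.
by rewrite (linfD lphi) (linfN lphi) !opprK opprB addrC.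
Qed.

Definition restricted_dual : lie_module (sl2 K) :=
  LieModule rdual_bilin rdual_bracket.
Lemma restricted_dualE (x : sl2 K) (phi : restricted_dual) (v : M) :
  val (act x phi) v = - val phi (act (omega x) v).
Proof. by []. Qed.

End RestrictedDual.

(* M is the irreducible module V_lambda. *)
Definition irreducible_hw (lambda : K) (M : lie_module (sl2 K)) : Prop :=
  irreducible M /\
  exists v : M, [/\ v != 0, generates v, act (sl2_e K) v = 0
                  & act (sl2_h K) v = lambda *: v].

End SL2Modules.

Section FreeField.
Variable K : fieldType.

Section Relations.
Variables (V : lmodType K) (B G A T : V -> V).
Hypotheses (lB : linear B) (lG : linear G) (lA : linear A) (lT : linear T).
Hypothesis GB : forall v, G (B v) = B (G v) - v.
Hypothesis AB : forall v, A (B v) = B (A v).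
Hypothesis AG : forall v, A (G v) = G (A v).
Hypothesis TB : forall v, T (B v) = B (T v).
Hypothesis TG : forall v, T (G v) = G (T v).
Hypothesis AT : forall v, A (T v) = T (A v) - 2 *: T v.

(* h = 2 beta gamma + a and f = - beta^2 gamma - beta a + t, where in the
   (sl2 (+) sl2)-action t is the product of the other gamma with 1_{-2}. *)
Definition wakimoto_h (v : V) : V := 2 *: B (G v) + A v.
Definition wakimoto_f (v : V) : V := - B (B (G v)) - B (A v) + T v.

Lemma wakimoto_h_linear : linear wakimoto_h.
Proof.
by apply: lin_add => //; apply: lin_scale; apply: lin_comp.
Qed.

Lemma wakimoto_f_linear : linear wakimoto_f.
Proof.
apply: lin_add => //; apply: lin_sub; last exact: lin_comp.
by apply: lin_opp; do 2!apply: lin_comp => //.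
Qed.

Let lin := (linfD lB, linfD lG, linfD lA, linfD lT, linfN lB, linfN lG, linfN lA,
  linfN lT, linfZ lB, linfZ lG, linfZ lA, linfZ lT).

Lemma wakimoto_he v : wakimoto_h (G v) - G (wakimoto_h v) = 2 *: G v.
Proof.
rewrite /wakimoto_h !(lin, GB, AG).
lmod_eq K.
Qed.

Lemma wakimoto_hf v :
  wakimoto_h (wakimoto_f v) - wakimoto_f (wakimoto_h v) = - 2 *: wakimoto_f v.
Proof.
rewrite /wakimoto_h /wakimoto_f !(lin, GB, AB, AG, TB, TG, AT).
lmod_eq K.
Qed.

Lemma wakimoto_ef v : G (wakimoto_f v) - wakimoto_f (G v) = wakimoto_h v.
Proof.
rewrite /wakimoto_h /wakimoto_f !(lin, GB, AB, AG, TB, TG, AT).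
lmod_eq K.
Qed.

Definition wakimoto_module : lie_module (sl2 K) :=
  triple_module lG wakimoto_h_linear wakimoto_f_linear
    wakimoto_he wakimoto_hf wakimoto_ef.
End Relations.

Section Cross.
Variables (V : lmodType K) (B G B' G' A S : V -> V).
Hypotheses (lB : linear B) (lG : linear G) (lB' : linear B') (lG' : linear G').
Hypotheses (lA : linear A) (lS : linear S).
Hypothesis GB : forall v, G (B v) = B (G v) - v.
Hypothesis GB' : forall v, G' (B' v) = B' (G' v) - v.
Hypothesis BB' : forall v, B (B' v) = B' (B v).
Hypothesis GBx : forall v, G (B' v) = B' (G v).
Hypothesis GBx' : forall v, G' (B v) = B (G' v).
Hypothesis GG' : forall v, G (G' v) = G' (G v).
Hypothesis AB : forall v, A (B v) = B (A v).
Hypothesis AG : forall v, A (G v) = G (A v).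
Hypothesis AB' : forall v, A (B' v) = B' (A v).
Hypothesis AG' : forall v, A (G' v) = G' (A v).
Hypothesis SB : forall v, S (B v) = B (S v).
Hypothesis SG : forall v, S (G v) = G (S v).
Hypothesis SB' : forall v, S (B' v) = B' (S v).
Hypothesis SG' : forall v, S (G' v) = G' (S v).
Hypothesis AS : forall v, A (S v) = S (A v) - 2 *: S v.

Let h := wakimoto_h B G A.
Let f := wakimoto_f B G A (fun v => G' (S v)).
Let h' := wakimoto_h B' G' A.
Let f' := wakimoto_f B' G' A (fun v => G (S v)).

Let lin := (linfD lB, linfD lG, linfD lB', linfD lG', linfD lA, linfD lS,
  linfN lB, linfN lG, linfN lB', linfN lG', linfN lA, linfN lS,
  (linfZ lB, linfZ lG, linfZ lB', linfZ lG', linfZ lA, linfZ lS)).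
Let rel := (GB, GB', BB', GBx, GBx', GG', (AB, AG, AB', AG', SB, SG, SB', SG', AS)).

Lemma wakimoto_commute x y v :
  triple_act G h f x (triple_act G' h' f' y v)
  = triple_act G' h' f' y (triple_act G h f x v).
Proof.
have lT : linear (fun v => G' (S v)) by exact: lin_comp.
have lT' : linear (fun v => G (S v)) by exact: lin_comp.
apply: triple_commute => // {}v; do ?[exact: wakimoto_h_linear
  | exact: wakimoto_f_linear]; rewrite /h /f /h' /f' /wakimoto_h /wakimoto_f.
all: by rewrite !(lin, rel); lmod_eq K.
Qed.
End Cross.

(* F(beta,gamma) (x) F(beta,gamma') (x) K[P] with P = int: the element 1_l of
   the group algebra is the generator << l >> of {freeg int / K}. *)
Definition fock_space : lmodType K :=
  tensor (tensor {poly K} {poly K}) {freeg int / K}.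

Definition fock_beta : fock_space -> fock_space :=
  tensor_map (tensor_map (fun p => 'X * p) id) id.
Definition fock_gamma : fock_space -> fock_space :=
  tensor_map (tensor_map (fun p => - p^`()) id) id.
Definition fock_bbeta : fock_space -> fock_space :=
  tensor_map (tensor_map id (fun p => 'X * p)) id.
Definition fock_bgamma : fock_space -> fock_space :=
  tensor_map (tensor_map id (fun p => - p^`())) id.
Definition fock_a : fock_space -> fock_space :=
  tensor_map id (fglift (fun l : int => l%:~R *: << l >>)).
Definition fock_one (m : int) : fock_space -> fock_space :=
  tensor_map id (fglift (fun l : int => << m + l >>)).

Let lX : linear (fun p : {poly K} => 'X * p).
Proof. by move=> a p q; rewrite mulrDr scalerAr. Qed.

Let lD : linear (fun p : {poly K} => - p^`()).
Proof. by move=> a p q; rewrite derivD derivZ opprD scalerN. Qed.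

Let lid (V : lmodType K) : linear (@id V). Proof. exact: lin_id. Qed.

Let lfg (U : lmodType K) (f : int -> U) : linear (fglift f).
Proof. exact: fglift_linear. Qed.

Let lmap := @tensor_map_linear K.

Lemma fock_beta_linear : linear fock_beta.
Proof. by do !apply: lmap => //. Qed.
Lemma fock_gamma_linear : linear fock_gamma.
Proof. by do !apply: lmap => //. Qed.
Lemma fock_bbeta_linear : linear fock_bbeta.
Proof. by do !apply: lmap => //. Qed.
Lemma fock_bgamma_linear : linear fock_bgamma.
Proof. by do !apply: lmap => //. Qed.
Lemma fock_a_linear : linear fock_a.
Proof. by apply: lmap. Qed.
Lemma fock_one_linear m : linear (fock_one m).
Proof. by apply: lmap. Qed.

Definition fock_vec (p q : {poly K}) (l : int) : fock_space :=
  tens (tens p q) << l >>.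

Lemma fock_ext (U : lmodType K) (f g : fock_space -> U) : linear f -> linear g ->
  (forall p q l, f (fock_vec p q l) = g (fock_vec p q l)) -> f =1 g.
Proof.
move=> lf lg fg; apply: tensor_ext => // t D.
move: D; apply: (freeg_ext (f := fun D => f (tens t D)) (g := fun D => g (tens t D))).
- exact: lin_comp lf (tens_linr _).
- exact: lin_comp lg (tens_linr _).
move=> l; move: t.
apply: (tensor_ext (f := fun t => f (tens t _)) (g := fun t => g (tens t _))).
- exact: lin_comp lf (tens_linl _).
- exact: lin_comp lg (tens_linl _).
- by move=> p q; apply: fg.
Qed.

Lemma fock_beta_vec p q l : fock_beta (fock_vec p q l) = fock_vec ('X * p) q l.
Proof. by rewrite /fock_beta !tensor_map_tens //; apply: lmap. Qed.
Lemma fock_gamma_vec p q l : fock_gamma (fock_vec p q l) = fock_vec (- p^`()) q l.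
Proof. by rewrite /fock_gamma !tensor_map_tens //; apply: lmap. Qed.
Lemma fock_bbeta_vec p q l : fock_bbeta (fock_vec p q l) = fock_vec p ('X * q) l.
Proof. by rewrite /fock_bbeta !tensor_map_tens //; apply: lmap. Qed.
Lemma fock_bgamma_vec p q l : fock_bgamma (fock_vec p q l) = fock_vec p (- q^`()) l.
Proof. by rewrite /fock_bgamma !tensor_map_tens //; apply: lmap. Qed.
Lemma fock_a_vec p q l : fock_a (fock_vec p q l) = l%:~R *: fock_vec p q l.
Proof.
by rewrite /fock_a tensor_map_tens // fglift1 (linfZ (tens_linr _)).
Qed.
Lemma fock_one_vec m p q l : fock_one m (fock_vec p q l) = fock_vec p q (m + l).
Proof. by rewrite /fock_one tensor_map_tens // fglift1. Qed.

Let fvec := (fock_beta_vec, fock_gamma_vec, fock_bbeta_vec, fock_bgamma_vec,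
  fock_a_vec, fock_one_vec).

Ltac flin := first [exact: fock_beta_linear | exact: fock_gamma_linear
  | exact: fock_bbeta_linear | exact: fock_bgamma_linear
  | exact: fock_a_linear | exact: fock_one_linear].

Let vecB p p' q l : fock_vec (p - p') q l = fock_vec p q l - fock_vec p' q l.
Proof.
by rewrite /fock_vec (linfD (tens_linl _)) (linfN (tens_linl _))
  (linfD (tens_linl _)) (linfN (tens_linl _)).
Qed.

Let vecBr p q q' l : fock_vec p (q - q') l = fock_vec p q l - fock_vec p q' l.
Proof.
by rewrite /fock_vec (linfD (tens_linr _)) (linfN (tens_linr _))
  (linfD (tens_linl _)) (linfN (tens_linl _)).
Qed.

Let DX (p : {poly K}) : - ('X * p)^`() = 'X * (- p^`()) - p.
Proof. by rewrite derivM derivX mul1r opprD mulrN addrC. Qed.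

Lemma fock_gamma_beta v : fock_gamma (fock_beta v) = fock_beta (fock_gamma v) - v.
Proof.
move: v; apply: fock_ext => [||p q l].
- exact: lin_comp fock_gamma_linear fock_beta_linear.
- by apply: lin_sub; [exact: lin_comp fock_beta_linear fock_gamma_linear | exact: lin_id].
- by rewrite !fvec DX vecB.
Qed.

Lemma fock_bgamma_bbeta v :
  fock_bgamma (fock_bbeta v) = fock_bbeta (fock_bgamma v) - v.
Proof.
move: v; apply: fock_ext => [||p q l].
- exact: lin_comp fock_bgamma_linear fock_bbeta_linear.
- by apply: lin_sub; [exact: lin_comp fock_bbeta_linear fock_bgamma_linear | exact: lin_id].
- by rewrite !fvec DX vecBr.
Qed.

Lemma fock_a_one m v :
  fock_a (fock_one m v) = fock_one m (fock_a v) + m%:~R *: fock_one m v.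
Proof.
move: v; apply: fock_ext => [||p q l].
- exact: lin_comp fock_a_linear (fock_one_linear _).
- apply: lin_add; last exact: lin_scale (fock_one_linear _).
  exact: lin_comp (fock_one_linear _) fock_a_linear.
- by rewrite !fvec (linfZ (fock_one_linear _)) !fvec intrD scalerDl addrC.
Qed.

Let comm (f g : fock_space -> fock_space) : linear f -> linear g ->
  (forall p q l, f (g (fock_vec p q l)) = g (f (fock_vec p q l))) ->
  forall v, f (g v) = g (f v).
Proof. by move=> lf lg H; apply: fock_ext => //; apply: lin_comp. Qed.

Let flZ := (linfZ fock_beta_linear, linfZ fock_gamma_linear,
  linfZ fock_bbeta_linear, linfZ fock_bgamma_linear, linfZ fock_a_linear).

Ltac fcomm := apply: comm; [flin | flin
  | by move=> p q l; rewrite ?(fvec, flZ)].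

Lemma fock_beta_bbeta v : fock_beta (fock_bbeta v) = fock_bbeta (fock_beta v).
Proof. move: v; fcomm. Qed.
Lemma fock_gamma_bbeta v : fock_gamma (fock_bbeta v) = fock_bbeta (fock_gamma v).
Proof. move: v; fcomm. Qed.
Lemma fock_bgamma_beta v : fock_bgamma (fock_beta v) = fock_beta (fock_bgamma v).
Proof. move: v; fcomm. Qed.
Lemma fock_gamma_bgamma v : fock_gamma (fock_bgamma v) = fock_bgamma (fock_gamma v).
Proof. move: v; fcomm. Qed.
Lemma fock_a_beta v : fock_a (fock_beta v) = fock_beta (fock_a v).
Proof. move: v; fcomm. Qed.
Lemma fock_a_gamma v : fock_a (fock_gamma v) = fock_gamma (fock_a v).
Proof. move: v; fcomm. Qed.
Lemma fock_a_bbeta v : fock_a (fock_bbeta v) = fock_bbeta (fock_a v).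
Proof. move: v; fcomm. Qed.
Lemma fock_a_bgamma v : fock_a (fock_bgamma v) = fock_bgamma (fock_a v).
Proof. move: v; fcomm. Qed.
Lemma fock_one_beta m v : fock_one m (fock_beta v) = fock_beta (fock_one m v).
Proof. move: v; fcomm. Qed.
Lemma fock_one_gamma m v : fock_one m (fock_gamma v) = fock_gamma (fock_one m v).
Proof. move: v; fcomm. Qed.
Lemma fock_one_bbeta m v : fock_one m (fock_bbeta v) = fock_bbeta (fock_one m v).
Proof. move: v; fcomm. Qed.
Lemma fock_one_bgamma m v : fock_one m (fock_bgamma v) = fock_bgamma (fock_one m v).
Proof. move: v; fcomm. Qed.

Definition fock_e : fock_space -> fock_space := fock_gamma.
Definition fock_h (v : fock_space) : fock_space :=
  2 *: fock_beta (fock_gamma v) + fock_a v.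
Definition fock_f (v : fock_space) : fock_space :=
  - fock_beta (fock_beta (fock_gamma v)) - fock_beta (fock_a v)
  + fock_bgamma (fock_one (- 2) v).

Definition fock_be : fock_space -> fock_space := fock_bgamma.
Definition fock_bh (v : fock_space) : fock_space :=
  2 *: fock_bbeta (fock_bgamma v) + fock_a v.
Definition fock_bf (v : fock_space) : fock_space :=
  - fock_bbeta (fock_bbeta (fock_bgamma v)) - fock_bbeta (fock_a v)
  + fock_gamma (fock_one (- 2) v).

Let t v := fock_bgamma (fock_one (- 2) v).
Let bt v := fock_gamma (fock_one (- 2) v).

Let lt : linear t.
Proof. exact: lin_comp fock_bgamma_linear (fock_one_linear _). Qed.
Let lbt : linear bt.
Proof. exact: lin_comp fock_gamma_linear (fock_one_linear _). Qed.

Let t_beta v : t (fock_beta v) = fock_beta (t v).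
Proof. by rewrite /t fock_one_beta fock_bgamma_beta. Qed.
Let t_gamma v : t (fock_gamma v) = fock_gamma (t v).
Proof. by rewrite /t fock_one_gamma fock_gamma_bgamma. Qed.
Let a_t v : fock_a (t v) = t (fock_a v) - 2 *: t v.
Proof.
by rewrite /t fock_a_bgamma fock_a_one (linfD fock_bgamma_linear)
  (linfZ fock_bgamma_linear) mulrNz scaleNr.
Qed.
Let bt_bbeta v : bt (fock_bbeta v) = fock_bbeta (bt v).
Proof. by rewrite /bt fock_one_bbeta fock_gamma_bbeta. Qed.
Let bt_bgamma v : bt (fock_bgamma v) = fock_bgamma (bt v).
Proof. by rewrite /bt fock_one_bgamma fock_gamma_bgamma. Qed.
Let a_bt v : fock_a (bt v) = bt (fock_a v) - 2 *: bt v.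
Proof.
by rewrite /bt fock_a_gamma fock_a_one (linfD fock_gamma_linear)
  (linfZ fock_gamma_linear) mulrNz scaleNr.
Qed.

Lemma fock_h_linear : linear fock_h.
Proof. exact: wakimoto_h_linear fock_beta_linear fock_gamma_linear fock_a_linear. Qed.
Lemma fock_f_linear : linear fock_f.
Proof. exact: wakimoto_f_linear fock_beta_linear fock_gamma_linear fock_a_linear lt. Qed.
Lemma fock_bh_linear : linear fock_bh.
Proof. exact: wakimoto_h_linear fock_bbeta_linear fock_bgamma_linear fock_a_linear. Qed.
Lemma fock_bf_linear : linear fock_bf.
Proof. exact: wakimoto_f_linear fock_bbeta_linear fock_bgamma_linear fock_a_linear lbt. Qed.

Definition fock_left : lie_module (sl2 K) :=
  triple_module fock_gamma_linear fock_h_linear fock_f_linear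
    (wakimoto_he fock_gamma_linear
       fock_gamma_beta fock_a_gamma)
    (wakimoto_hf fock_beta_linear fock_gamma_linear fock_a_linear lt
       fock_gamma_beta fock_a_beta fock_a_gamma t_beta t_gamma a_t)
    (wakimoto_ef fock_beta_linear fock_gamma_linear
       fock_gamma_beta fock_a_gamma t_gamma).

Definition fock_right : lie_module (sl2 K) :=
  triple_module fock_bgamma_linear fock_bh_linear fock_bf_linear
    (wakimoto_he fock_bgamma_linear
       fock_bgamma_bbeta fock_a_bgamma)
    (wakimoto_hf fock_bbeta_linear fock_bgamma_linear fock_a_linear lbt
       fock_bgamma_bbeta fock_a_bbeta fock_a_bgamma bt_bbeta bt_bgamma a_bt)
    (wakimoto_ef fock_bbeta_linear fock_bgamma_linear
       fock_bgamma_bbeta fock_a_bgamma bt_bgamma).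

Let a_one v :
  fock_a (fock_one (- 2) v) = fock_one (- 2) (fock_a v) - 2 *: fock_one (- 2) v.
Proof. by rewrite fock_a_one mulrNz scaleNr. Qed.

Fact fock_commute (x y : sl2 K) (v : fock_space) :
  triple_act fock_e fock_h fock_f x (triple_act fock_be fock_bh fock_bf y v)
  = triple_act fock_be fock_bh fock_bf y (triple_act fock_e fock_h fock_f x v).
Proof.
exact: (wakimoto_commute fock_beta_linear fock_gamma_linear fock_bbeta_linear
  fock_bgamma_linear fock_a_linear (fock_one_linear (- 2)) fock_gamma_beta
  fock_bgamma_bbeta fock_beta_bbeta fock_gamma_bbeta fock_bgamma_beta
  fock_gamma_bgamma fock_a_beta fock_a_gamma fock_a_bbeta fock_a_bgamma
  (fock_one_beta (- 2)) (fock_one_gamma (- 2)) (fock_one_bbeta (- 2))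
  (fock_one_bgamma (- 2)) a_one).
Qed.

(* The first copy of sl2 acts through fock_e, fock_h, fock_f and the second one
   through fock_be, fock_bh, fock_bf. *)
Definition fock_module : lie_module (lie_dsum (sl2 K) (sl2 K)) :=
  commuting_module (act_bilin fock_left) (act_bilin fock_right)
    (@act_bracket _ _ fock_left) (@act_bracket _ _ fock_right) fock_commute.

Lemma fock_actE x y (v : fock_module) : act ((x, y) : lie_dsum _ _) v
  = triple_act fock_e fock_h fock_f x v + triple_act fock_be fock_bh fock_bf y v.
Proof. by []. Qed.

Lemma fock_act_left (v : fock_module) :
  [/\ act ((sl2_e K, 0) : lie_dsum _ _) v = fock_gamma v,
      act ((sl2_h K, 0) : lie_dsum _ _) v
      = 2 *: fock_beta (fock_gamma v) + fock_a v
    & act ((sl2_f K, 0) : lie_dsum _ _) v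
      = - fock_beta (fock_beta (fock_gamma v)) - fock_beta (fock_a v)
        + fock_bgamma (fock_one (- 2) v)].
Proof.
split; rewrite fock_actE triple_act0 addr0;
  by rewrite /triple_act !sl2_cmk !scale0r scale1r ?addr0 ?add0r.
Qed.

Lemma fock_act_right (v : fock_module) :
  [/\ act ((0, sl2_e K) : lie_dsum _ _) v = fock_bgamma v,
      act ((0, sl2_h K) : lie_dsum _ _) v
      = 2 *: fock_bbeta (fock_bgamma v) + fock_a v
    & act ((0, sl2_f K) : lie_dsum _ _) v
      = - fock_bbeta (fock_bbeta (fock_bgamma v)) - fock_bbeta (fock_a v)
        + fock_gamma (fock_one (- 2) v)].
Proof.
split; rewrite fock_actE triple_act0 add0r;
  by rewrite /triple_act !sl2_cmk !scale0r scale1r ?addr0 ?add0r.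
Qed.

End FreeField.

(* V_lambda exists: it is the submodule generated by 1 of F(beta,gamma), where a
   acts by lambda and the last term of f is dropped. *)
Section Existence.
Variables (K : fieldType) (pchar0 : [pchar K] =i pred0) (lambda : K).

Section Generated.
Variables (g : lie_algebra K) (M : lie_module g) (A : M -> Prop).

Definition generated_pred : {pred M} :=
  fun v => `[< forall S : submodule M, (forall x, A x -> x \in S) -> v \in S >].

Fact generated_closed : submod_closed generated_pred.
Proof.
split=> [|a u v /asboolP Hu /asboolP Hv]; apply/asboolP => S AS.
  exact: rpred0.
by apply: rpredD; [apply: rpredZ; apply: Hu | apply: Hv].
Qed.

Fact generated_act (x : g) v : v \in Subspace generated_closed ->
  act x v \in Subspace generated_closed.
Proof. by move=> /asboolP H; apply/asboolP => S AS; apply/submodule_act/H. Qed.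

Definition generated := Submodule generated_act.

Lemma mem_generated x : A x -> x \in generated.
Proof. by move=> Ax; apply/asboolP => S; apply. Qed.

Section Image.
Variable S : submodule (sub_module generated).

Let image_pred : {pred M} := fun v => `[< exists2 u, u \in S & val u = v >].

Let image_closed : submod_closed image_pred.
Proof.
split=> [|a u v /asboolP[u' u'S <-] /asboolP[v' v'S <-]]; apply/asboolP.
  by exists 0; first exact: rpred0.
by exists (a *: u' + v'); [rewrite rpredD ?rpredZ | exact: subspace_valE].
Qed.

Let image_act (x : g) v : v \in Subspace image_closed -> act x v \in Subspace image_closed.
Proof.
move=> /asboolP[u uS <-]; apply/asboolP; exists (act x u) => //.
exact: submodule_act.
Qed.

Lemma generated_generates :
  (forall x, A x -> exists2 u, u \in S & val u = x) -> forall w, w \in S.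
Proof.
move=> AS w; have /asboolP/(_ (Submodule image_act)) := valP w.
case/(_ _)/asboolP => [x /AS Ax|u uS /val_inj <- //]; exact/asboolP.
Qed.
End Image.
End Generated.

Let B (p : {poly K}) := 'X * p.
Let G (p : {poly K}) := - p^`().
Let A (p : {poly K}) := lambda *: p.
Let T (p : {poly K}) : {poly K} := 0.

Let lB : linear B.
Proof. by move=> a p q; rewrite /B mulrDr scalerAr. Qed.
Let lG : linear G.
Proof. by move=> a p q; rewrite /G derivD derivZ opprD scalerN. Qed.
Let lA : linear A.
Proof. exact/lin_scale/lin_id. Qed.
Let lT : linear T.
Proof. by move=> a p q; rewrite /T scaler0 addr0. Qed.
Let GB p : G (B p) = B (G p) - p.
Proof. by rewrite /G /B derivM derivX mul1r opprD mulrN addrC. Qed.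
Let AB p : A (B p) = B (A p).
Proof. by rewrite (linfZ lB). Qed.
Let AG p : A (G p) = G (A p).
Proof. by rewrite (linfZ lG). Qed.
Let TB p : T (B p) = B (T p).
Proof. by rewrite (linf0 lB). Qed.
Let TG p : T (G p) = G (T p).
Proof. by rewrite (linf0 lG). Qed.
Let AT p : A (T p) = T (A p) - 2 *: T p.
Proof. by rewrite (linf0 lA) scaler0 subr0. Qed.

Let M := wakimoto_module lB lG lA lT GB AB AG TB TG AT.

Let is_one (p : M) : Prop := p = 1 :> {poly K}.

Definition hw_module : lie_module (sl2 K) := sub_module (generated is_one).

Let one : hw_module := exist _ (1 : {poly K}) (@mem_generated _ M is_one _ erefl).

Let act_e (p : M) : act (sl2_e K) p = G p.
Proof.
by rewrite /= /triple_act !sl2_cmk scale1r !scale0r !addr0.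
Qed.

Let act_h (p : M) : act (sl2_h K) p = wakimoto_h B G A p.
Proof.
by rewrite /= /triple_act !sl2_cmk scale1r !scale0r addr0 add0r.
Qed.

Let val_act x (v : hw_module) : val (act x v) = act x (val v : M).
Proof. by []. Qed.

Let deriv_neq0 (p : {poly K}) : (1 < size p)%N -> p^`() != 0.
Proof.
move=> sp; have p0 : p != 0 by rewrite -size_poly_gt0 ltnW.
apply/negP => /eqP/(congr1 (fun q : {poly K} => q`_(size p).-2)).
rewrite coef_deriv coef0 -mulr_natr => /eqP; rewrite mulf_eq0.
have -> : (size p).-2.+1 = (size p).-1 by case: (size p) sp => [|[]].
rewrite -lead_coefE lead_coef_eq0 (negbTE p0) /= => /eqP n0.
have n_gt0 : (0 < (size p).-1)%N by case: (size p) sp => [|[]].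
by have := natf0_pchar n_gt0 (introT eqP n0) => -[q]; rewrite pchar0.
Qed.

Let sub_one (S : submodule hw_module) v : v \in S -> v != 0 -> one \in S.
Proof.
have [n] := ubnP (size (val v : {poly K})).
elim: n v => // n IH v; rewrite ltnS => sv vS v0.
have vp0 : (val v : {poly K}) != 0.
  by apply: contra v0 => /eqP e; apply/eqP/val_inj.
have [s1|s1] := leqP (size (val v : {poly K})) 1.
  have e := size1_polyC s1; set c := _`_0 in e.
  have c0 : c != 0 by apply: contra vp0 => /eqP c0; rewrite e c0.
  have -> : one = c^-1 *: v.
    apply: val_inj; rewrite -[c^-1 *: v]addr0 subspace_valE addr0 /=.
    by rewrite [sval v]e -mul_polyC -polyCM mulVf.
  exact: rpredZ.
have ve : (val (act (sl2_e K) v) : {poly K}) = - (val v : {poly K})^`().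
  by rewrite val_act act_e.
apply: (IH (act (sl2_e K) v)); last 1 first.
- apply: contra (deriv_neq0 s1) => /eqP e0.
  by rewrite -oppr_eq0 -ve e0.
- by rewrite ve size_polyN (leq_trans (lt_size_deriv vp0)).
- exact: submodule_act.
Qed.

Let one_all (S : submodule hw_module) : one \in S -> forall v, v \in S.
Proof. by move=> oS; apply: generated_generates => x ->; exists one. Qed.

Lemma irreducible_hw_exists : irreducible_hw lambda hw_module.
Proof.
have one0 : one != 0.
  apply/eqP => /(congr1 (fun v : hw_module => (val v : {poly K}))) /eqP.
  by rewrite /= oner_eq0.
split; [split; first by exists one|exists one; split].
- move=> S; have [[v vS v0]|nv] := pselect (exists2 v, v \in S & v != 0).
    by right; apply/one_all/(sub_one vS).
  by left => v vS; apply/eqP; apply: contrapT => /negP v0; apply: nv; exists v.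
- exact: one0.
- by move=> S; apply: one_all.
- by apply: val_inj; rewrite val_act act_e /= /G derivC oppr0.
- apply: val_inj; rewrite -[lambda *: one]addr0 subspace_valE addr0 val_act act_h.
  by rewrite /wakimoto_h /G /= derivC oppr0 (linf0 lB) scaler0 add0r.
Qed.

End Existence.

Lemma irreducible_hw_family (R : realType) :
  exists V : int -> lie_module (sl2 R[i]),
    forall l, irreducible_hw l%:~R (V l).
Proof.
exists (fun l => hw_module (l%:~R : R[i])) => l.
exact/irreducible_hw_exists/Num.Theory.pchar_num.
Qed.

(* Main.v *)
Require Import Defs.
From mathcomp Require Import all_boot all_order all_algebra.
From mathcomp Require Import ring zify boolp.

Set Implicit Arguments.
Unset Strict Implicit.
Unset Printing Implicit Defensive.

Import GRing.Theory Num.Theory.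
Local Open Scope ring_scope.

(** Write x(i,j,l) for the monomial beta^i bbeta^j 1_l.  The three layers of the
filtration are the submodules generated by more and more of the vectors

  - vacuum l = x(0,0,l), of weights (l, l), for all integers l;
  - mixed (n, true) = x(0,n+1,n) and mixed (n, false) = x(n+1,0,n), of weights
    (n, -n-2) and (-n-2, n), for n >= 0;
  - top n = x(n+1,n+1,n) + lower terms, of weights (-n-2, -n-2), for n >= 0.

Each family is singular (killed by both e's) modulo the layer below it, and
nonzero there.  So each successive quotient is generated by singular vectors of
pairwise distinct weights, and where a weight is an integer n >= 0 the power
f^(n+1) kills the generator.  Such a module is determined up to isomorphism by the
weights (hw_system_iso): the vectors f^i fbar^j n_s span it, those that are not
forced to vanish are linearly independent, because raising back to n_s multiplies
by a nonzero number, and the action on them depends on the weights only.  The direct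
sum of the V_a (x) V_b^* is a module of the same kind (tensor_hw_system), since
the restricted dual of V_b again has a singular generator of weight b, the form
dual to the highest weight vector (dual_hw_generator).  Comparing the two sides
gives the three isomorphisms.

What remains is to check the properties of the three families.

Generation (reach_all): the leading term of f x(i,j,l) is (i-l) x(i+1,j,l) and
the other term has smaller exponents, so a monomial can fail to be reached from
smaller ones only when i or j passes l >= 0, where mixed or top is supplied.

Singularity of mixed: one e kills it, and the other one sends it to a multiple of
fbar^n (vacuum n) or f^n (vacuum n).  The vector f^(n+1) (mixed (n, true)) is killed
by both e's in the Fock space itself, hence is a combination of vacua.

Singularity of top: the Casimir elements of the two copies of sl2 act by the same
operator, a^2 + 2a + 4 gamma bgamma 1_{-2} up to a factor, which is triangular on
monomials.  The lower terms of top n are chosen so that this operator maps top n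
to n(n+2) (top n) plus a multiple of vacuum (-n-2) (casimir_top).  So e (top n)
and ebar (top n) are Casimir eigenvectors, and every weight vector that is a
Casimir eigenvector lies in the second layer (casimir_eigen).

Nonvanishing: linear forms that vanish on the images of f and fbar and have a weight
are easy to solve for on monomials.  Such a form vanishes on a submodule as soon
as it vanishes on what the e's make of the generators (generated_coinvariant),
and explicit forms of this kind detect mixed and top (mixed_coinvariant,
top_coinvariant). *)

(** * Eigenvectors and sl2-triples *)

(** Applying the product of the T - nu over the eigenvalues nu != mu that occur kills
the other components and rescales this one by a nonzero factor.  This is how weights
separate vectors everywhere below, without a weight space decomposition. *)
Lemma eigen_component (K : fieldType) (V : lmodType K) (T : V -> V)
    (X : eqType) (s : seq X) (w : X -> K) (g : X -> V) (mu : K) :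
  linear T -> (forall x, T (g x) = w x *: g x) ->
  \sum_(x <- s) g x = 0 -> \sum_(x <- s | w x == mu) g x = 0.
Proof.
move=> lT Tg s0.
pose op (L : seq K) v := foldr (fun nu u => T u - nu *: u) v L.
have lop L : linear (op L).
  by elim: L => [|nu L IH] //=; apply: lin_sub; [exact: lin_comp | exact: lin_scale].
have opg L x : op L (g x) = (\prod_(nu <- L) (w x - nu)) *: g x.
  elim: L => [|nu L IH] /=; first by rewrite big_nil scale1r.
  rewrite big_cons -/(op L (g x)) IH (linfZ lT) Tg !scalerA -scalerBl.
  by congr (_ *: _); ring.
pose L := [seq nu <- map w s | nu != mu].
have := congr1 (op L) s0; rewrite (linf0 (lop L)) (linf_sum (lop L)).
rewrite (bigID (fun x => w x == mu)) /= [X in _ + X]big1_seq ?addr0; last first.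
  move=> x /andP[wx xs]; rewrite opg; apply/eqP; rewrite scaler_eq0.
  apply/orP; left; rewrite prodf_seq_eq0; apply/hasP; exists (w x).
    by rewrite mem_filter wx map_f.
  by rewrite /= subrr.
under eq_bigr => x /eqP wx do rewrite opg wx.
rewrite -scaler_sumr => /eqP; rewrite scaler_eq0 => /orP[|/eqP //].
rewrite prodf_seq_eq0 => /hasP[nu]; rewrite mem_filter => /andP[nu_mu _].
by rewrite /= subr_eq0 eq_sym (negbTE nu_mu).
Qed.

Lemma iter_comm (T : Type) (A B : T -> T) i v :
  (forall v, A (B v) = B (A v)) -> A (iter i B v) = iter i B (A v).
Proof. by move=> AB; elim: i => //= i <-. Qed.

Lemma iter_iter_comm (T : Type) (A B : T -> T) i j v :
  (forall v, A (B v) = B (A v)) -> iter i A (iter j B v) = iter j B (iter i A v).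
Proof. by move=> AB; elim: i => //= i ->; apply: iter_comm. Qed.

Lemma lin_iter (K : fieldType) (V : lmodType K) (T : V -> V) i :
  linear T -> linear (iter i T).
Proof. by move=> lT; elim: i => // i IH; apply: (lin_comp lT IH). Qed.

Section Triples.
Variables (K : fieldType) (V : lmodType K).

Record sl2_triple (E H F : V -> V) : Prop := Sl2Triple {
  tripleE : linear E;
  tripleH : linear H;
  tripleF : linear F;
  tripleEF : forall v, E (F v) = F (E v) + H v;
  tripleHE : forall v, H (E v) = E (H v) + 2 *: E v;
  tripleHF : forall v, H (F v) = F (H v) - 2 *: F v }.

(** The scalar by which E^i F^i acts on a singular vector of weight p.  Its vanishing
says that the Shapovalov form degenerates in degree i; for natural p this happens
exactly when i > p. *)
Definition hw_norm (p : K) (i : nat) : K := \prod_(k < i) (k.+1%:R * (p - k%:R)).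

Variables (E H F : V -> V).
Hypothesis t : sl2_triple E H F.

Lemma weight_lower p v i : H v = p *: v ->
  H (iter i F v) = (p - (2 * i)%:R) *: iter i F v.
Proof.
move=> hv; elim: i => [|i IH]; first by rewrite muln0 subr0.
rewrite iterS (tripleHF t) IH (linfZ (tripleF t)) -scalerBl mulnS natrD.
by congr (_ *: _); ring.
Qed.

Section Singular.
Variables (p : K) (v : V).
Hypotheses (Ev : E v = 0) (Hv : H v = p *: v).

Lemma raise_lower1 i :
  E (iter i.+1 F v) = (i.+1%:R * (p - i%:R)) *: iter i F v.
Proof.
elim: i => [|i IH].
  by rewrite /= (tripleEF t) Ev (linf0 (tripleF t)) add0r Hv; congr (_ *: _); ring.
rewrite iterS (tripleEF t) IH (linfZ (tripleF t)) (weight_lower i.+1 Hv) -scalerDl.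
by congr (_ *: _); rewrite natrM; ring.
Qed.

Lemma raise_lower_eq i : iter i E (iter i F v) = hw_norm p i *: v.
Proof.
elim: i => [|i IH]; first by rewrite /hw_norm big_ord0 scale1r.
rewrite iterSr raise_lower1 (linfZ (lin_iter _ (tripleE t))) IH scalerA.
by rewrite /hw_norm big_ord_recr mulrC.
Qed.

Lemma raise_lower_gt i j : (i < j)%N -> iter j E (iter i F v) = 0.
Proof.
move=> /subnK <-; rewrite iterD iterS raise_lower_eq (linfZ (tripleE t)) Ev.
by rewrite scaler0 (linf0 (lin_iter _ (tripleE t))).
Qed.

Lemma raise_lower_add i j :
  exists c, iter j E (iter (j + i) F v) = c *: iter i F v.
Proof.
elim: j => [|j [c IH]]; first by exists 1; rewrite scale1r.
exists ((j + i).+1%:R * (p - (j + i)%:R) * c).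
by rewrite iterSr addSn raise_lower1 (linfZ (lin_iter _ (tripleE t))) IH scalerA.
Qed.

End Singular.
End Triples.

(** * Linear combinations of a family *)

Section Combinations.
Variables (K : fieldType) (V : lmodType K) (X : choiceType) (g : X -> V).

(** Spans are described through the free module on X, whose elements serve both
as coefficient families here and as formal preimages when a map is defined on a
spanning family. *)
Definition combination_pred : {pred V} :=
  fun v => `[< exists D : {freeg X / K}, v = fglift g D >].

Fact combination_closed : submod_closed combination_pred.
Proof.
split=> [|a u v /asboolP[D ->] /asboolP[D' ->]]; apply/asboolP.
  by exists 0; rewrite (linf0 (fglift_linear _)).
by exists (a *: D + D'); rewrite fglift_linear.
Qed.

Definition combinations := Subspace combination_closed.

Lemma combinationsP v :
  reflect (exists D : {freeg X / K}, v = fglift g D) (v \in combinations).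
Proof. exact: asboolP. Qed.

Lemma mem_combinations x : g x \in combinations.
Proof. by apply/combinationsP; exists << x >>; rewrite fglift1. Qed.

Lemma combinations_stable (T : V -> V) : linear T ->
  (forall x, T (g x) \in combinations) ->
  forall v, v \in combinations -> T v \in combinations.
Proof.
move=> lT Tg v /combinationsP[D ->].
rewrite fglift_sum (linf_sum lT) rpred_sum // => x _.
by rewrite (linfZ lT) rpredZ.
Qed.
End Combinations.

(** * Modules over sl2 (+) sl2 *)

Section SL2Action.
Variable K : fieldType.

Lemma act_triple (M : lie_module (sl2 K)) :
  @sl2_triple K M (act (sl2_e K)) (act (sl2_h K)) (act (sl2_f K)).
Proof.
split; do ?[exact: act_lin]; move=> v.
- by rewrite -sl2_ef act_bracket addrC subrK.
- by rewrite -(linfZ (act_linl v)) -sl2_he act_bracket addrC subrK.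
- by rewrite -scaleNr -(linfZ (act_linl v)) -sl2_hf act_bracket addrC subrK.
Qed.

Lemma act_sl2 (M : lie_module (sl2 K)) (x : sl2 K) (v : M) : act x v =
  sl2_ce x *: act (sl2_e K) v + sl2_ch x *: act (sl2_h K) v
  + sl2_cf x *: act (sl2_f K) v.
Proof.
by rewrite {1}(sl2_decomp x) !(linfD (act_linl v)) !(linfZ (act_linl v)).
Qed.

Definition bi_sl2 := lie_dsum (sl2 K) (sl2 K).
Definition eL : bi_sl2 := (sl2_e K, 0).
Definition hL : bi_sl2 := (sl2_h K, 0).
Definition fL : bi_sl2 := (sl2_f K, 0).
Definition eR : bi_sl2 := (0, sl2_e K).
Definition hR : bi_sl2 := (0, sl2_h K).
Definition fR : bi_sl2 := (0, sl2_f K).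

Lemma bi_bracket (x y x' y' : sl2 K) :
  lie_bracket ((x, y) : bi_sl2) ((x', y') : bi_sl2)
  = ((lie_bracket x x' : sl2 K), (lie_bracket y y' : sl2 K)).
Proof. by []. Qed.

Lemma left_scale (c : K) (x : sl2 K) :
  ((c *: x, 0) : bi_sl2) = c *: ((x, 0) : bi_sl2).
Proof. by congr pair; rewrite scaler0. Qed.

Lemma right_scale (c : K) (x : sl2 K) :
  ((0, c *: x) : bi_sl2) = c *: ((0, x) : bi_sl2).
Proof. by congr pair; rewrite scaler0. Qed.

Lemma lie_bracket0 (g : lie_algebra K) (x : g) :
  (lie_bracket x 0 = 0) * (lie_bracket 0 x = 0).
Proof.
by rewrite (linf0 ((lie_bracket_bilin g).2 x)) (linf0 ((lie_bracket_bilin g).1 x)).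
Qed.

Variable N : lie_module bi_sl2.

Lemma left_right (x y : sl2 K) (v : N) :
  act ((x, 0) : bi_sl2) (act ((0, y) : bi_sl2) v)
  = act ((0, y) : bi_sl2) (act ((x, 0) : bi_sl2) v).
Proof.
apply/eqP; rewrite -subr_eq0 -act_bracket bi_bracket !lie_bracket0.
by rewrite (linf0 (act_linl v)).
Qed.

Lemma left_triple : @sl2_triple K N (act eL) (act hL) (act fL).
Proof.
split; do ?[exact: act_lin]; move=> v; apply/eqP; rewrite addrC -subr_eq -act_bracket.
- by rewrite bi_bracket sl2_ef lie_bracket0.
- by rewrite bi_bracket sl2_he lie_bracket0 left_scale (linfZ (act_linl v)).
- by rewrite bi_bracket sl2_hf lie_bracket0 left_scale (linfZ (act_linl v)) scaleNr.
Qed.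

Lemma right_triple : @sl2_triple K N (act eR) (act hR) (act fR).
Proof.
split; do ?[exact: act_lin]; move=> v; apply/eqP; rewrite addrC -subr_eq -act_bracket.
- by rewrite bi_bracket sl2_ef lie_bracket0.
- by rewrite bi_bracket sl2_he lie_bracket0 right_scale (linfZ (act_linl v)).
- by rewrite bi_bracket sl2_hf lie_bracket0 right_scale (linfZ (act_linl v)) scaleNr.
Qed.

Lemma act_bi_sl2 (x : bi_sl2) (v : N) : act x v =
  sl2_ce x.1 *: act eL v + sl2_ch x.1 *: act hL v + sl2_cf x.1 *: act fL v
  + (sl2_ce x.2 *: act eR v + sl2_ch x.2 *: act hR v + sl2_cf x.2 *: act fR v).
Proof.
have l1 : linear (fun y : sl2 K => act ((y, 0) : bi_sl2) v).
  by move=> a y y'; rewrite -act_linl; congr act; congr pair; rewrite /= scaler0 addr0.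
have l2 : linear (fun y : sl2 K => act ((0, y) : bi_sl2) v).
  by move=> a y y'; rewrite -act_linl; congr act; congr pair; rewrite /= scaler0 addr0.
case: x => x y; have {1}-> : (x, y) = (x, 0) + (0, y) :> bi_sl2.
  by congr pair; rewrite ?addr0 ?add0r.
rewrite (linfD (act_linl v)) /= {1}(sl2_decomp x) {1}(sl2_decomp y).
rewrite !(linfD l1) !(linfD l2) !(linfZ l1) !(linfZ l2).
by [].
Qed.

Definition stable_under (S : subspace N) (T : N -> N) : Prop :=
  forall v, v \in S -> T v \in S.

(** The e's and f's generate the algebra, since h = [e, f]. *)
Lemma stable_bi_sl2 (S : subspace N) :
  stable_under S (act eL) -> stable_under S (act fL) ->
  stable_under S (act eR) -> stable_under S (act fR) ->
  forall (x : bi_sl2) v, v \in S -> act x v \in S.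
Proof.
move=> se sf sre srf x v vS; rewrite act_bi_sl2.
have sh : act hL v \in S.
  rewrite -[act hL v](addKr (act fL (act eL v))) -(tripleEF left_triple).
  by apply: rpredD; [apply: rpredNr; exact/sf/se | exact/se/sf].
have srh : act hR v \in S.
  rewrite -[act hR v](addKr (act fR (act eR v))) -(tripleEF right_triple).
  by apply: rpredD; [apply: rpredNr; exact/srf/sre | exact/sre/srf].
apply: rpredD; apply: rpredD; first apply: rpredD; last first.
- exact/rpredZ/srf.
- by apply: rpredD; apply: rpredZ => //; apply: sre.
- exact/rpredZ/sf.
- exact: rpredZ.
- exact/rpredZ/se.
Qed.
End SL2Action.

(** * Modules generated by singular vectors *)

Section Isomorphisms.
Variables (K : fieldType) (g : lie_algebra K).

Lemma module_iso_trans (M N P : lie_module g) :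
  module_iso M N -> module_iso N P -> module_iso M P.
Proof.
move=> [f [lf bf af]] [h [lh bh ah]]; exists (fun x => h (f x)); split.
- exact: lin_comp.
- exact: bij_comp.
- by move=> x v; rewrite af ah.
Qed.

(** Both modules are quotients of the free module on X, so equal kernels identify
them as vector spaces; equal structure constants make the identification equivariant.
Going through the free module avoids building a map out of either side, in particular
out of a direct sum of tensor products. *)
Lemma iso_of_relations (M N : lie_module g) (X : choiceType) (u : X -> M) (w : X -> N) :
  (forall x, x \in combinations u) -> (forall y, y \in combinations w) ->
  (forall D : {freeg X / K}, fglift u D = 0 <-> fglift w D = 0) ->
  (forall x t, exists D : {freeg X / K},
     act x (u t) = fglift u D /\ act x (w t) = fglift w D) ->
  module_iso M N.
Proof.
move=> su sw ker_uw act_uw.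
have [cu cuK] := choice (fun x => elimT (combinationsP _ _) (su x)).
have [cw cwK] := choice (fun x => elimT (combinationsP _ _) (sw x)).
have lift_sub (V : lmodType K) (v : X -> V) (D E : {freeg X / K}) :
    fglift v (D - E) = fglift v D - fglift v E.
  by rewrite (linfD (fglift_linear v)) (linfN (fglift_linear v)).
pose f x := fglift w (cu x); pose h y := fglift u (cw y).
have fE D : f (fglift u D) = fglift w D.
  by apply/eqP; rewrite -subr_eq0 -lift_sub; apply/eqP/ker_uw; rewrite lift_sub -cuK subrr.
have hE D : h (fglift w D) = fglift u D.
  by apply/eqP; rewrite -subr_eq0 -lift_sub; apply/eqP/ker_uw; rewrite lift_sub -cwK subrr.
have lf : linear f.
  move=> a x y; rewrite [x]cuK [y]cuK -fglift_linear !fE; exact: fglift_linear.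
exists f; split=> //.
  by exists h => x; [rewrite [x in f x]cuK fE hE -cuK | rewrite [x in h x]cwK hE fE -cwK].
move=> x v; rewrite [v]cuK fE !fglift_sum (linf_sum (act_lin x)) (linf_sum lf).
rewrite (linf_sum (act_lin x)); apply: eq_bigr => t _.
rewrite !(linfZ (act_lin x)) (linfZ lf); congr (_ *: _).
by have [D [-> ->]] := act_uw x t.
Qed.
End Isomorphisms.

Section HighestWeightSystems.
Variables (K : fieldType) (I : choiceType) (a b : I -> K).

(** The last three fields say that the module is generated by the n s and that every
f^i that is null in the irreducible quotient of the Verma module is null on n s.
Stating integrability through hw_norm covers dominant weights, where f^(p+1) n = 0
is meant, and all the others, where nothing is, in one clause. *)
Record hw_system (N : lie_module (bi_sl2 K)) (n : I -> N) : Prop := HwSystem {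
  sys_neq0 : forall s, n s != 0;
  sys_e : forall s, act (eL K) (n s) = 0;
  sys_re : forall s, act (eR K) (n s) = 0;
  sys_h : forall s, act (hL K) (n s) = a s *: n s;
  sys_rh : forall s, act (hR K) (n s) = b s *: n s;
  sys_f : forall s i, hw_norm (a s) i = 0 -> iter i (act (fL K)) (n s) = 0;
  sys_rf : forall s i, hw_norm (b s) i = 0 -> iter i (act (fR K)) (n s) = 0;
  sys_gen : forall S : submodule N, (forall s, n s \in S) -> forall v, v \in S }.

Definition lowered (N : lie_module (bi_sl2 K)) (n : I -> N) (t : I * nat * nat) : N :=
  iter t.1.2 (act (fL K)) (iter t.2 (act (fR K)) (n t.1.1)).

(** The exponents for which raising back to n s has a nonzero coefficient. *)
Definition surviving (t : I * nat * nat) : bool :=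
  (hw_norm (a t.1.1) t.1.2 != 0) && (hw_norm (b t.1.1) t.2 != 0).

Section Theory.
Variables (N : lie_module (bi_sl2 K)) (n : I -> N).
Hypothesis sys : hw_system n.

Let lr x y := left_right (N := N) x y.
Let rl x y v := esym (left_right (N := N) y x v).

Lemma loweredC s i j :
  lowered n (s, i, j) = iter j (act (fR K)) (iter i (act (fL K)) (n s)).
Proof. exact/iter_iter_comm/lr. Qed.

Lemma lowered_e s i j : act (eL K) (lowered n (s, i, j)) =
  (i%:R * (a s - i.-1%:R)) *: lowered n (s, i.-1, j).
Proof.
have Ev : act (eL K) (iter j (act (fR K)) (n s)) = 0.
  by rewrite (iter_comm _ _ (lr _ _)) (sys_e sys) (linf0 (lin_iter _ (act_lin _))).
have Hv : act (hL K) (iter j (act (fR K)) (n s)) = a s *: iter j (act (fR K)) (n s).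
  by rewrite (iter_comm _ _ (lr _ _)) (sys_h sys) (linfZ (lin_iter _ (act_lin _))).
case: i => [|i]; first by rewrite mul0r scale0r.
exact: (raise_lower1 (left_triple N) Ev Hv).
Qed.

Lemma lowered_re s i j : act (eR K) (lowered n (s, i, j)) =
  (j%:R * (b s - j.-1%:R)) *: lowered n (s, i, j.-1).
Proof.
rewrite !loweredC.
have Ev : act (eR K) (iter i (act (fL K)) (n s)) = 0.
  by rewrite (iter_comm _ _ (rl _ _)) (sys_re sys) (linf0 (lin_iter _ (act_lin _))).
have Hv : act (hR K) (iter i (act (fL K)) (n s)) = b s *: iter i (act (fL K)) (n s).
  by rewrite (iter_comm _ _ (rl _ _)) (sys_rh sys) (linfZ (lin_iter _ (act_lin _))).
case: j => [|j]; first by rewrite mul0r scale0r.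
exact: (raise_lower1 (right_triple N) Ev Hv).
Qed.

Lemma lowered_f s i j : act (fL K) (lowered n (s, i, j)) = lowered n (s, i.+1, j).
Proof. by []. Qed.

Lemma lowered_rf s i j : act (fR K) (lowered n (s, i, j)) = lowered n (s, i, j.+1).
Proof. by rewrite !loweredC. Qed.

Lemma lowered_dead t : ~~ surviving t -> lowered n t = 0.
Proof.
case: t => [[s i] j]; rewrite negb_and !negbK => /orP[] /eqP /=.
  move=> ai; rewrite loweredC (sys_f sys ai); exact: (linf0 (lin_iter _ (act_lin _))).
by move=> bj; rewrite /lowered (sys_rf sys bj); apply: (linf0 (lin_iter _ (act_lin _))).
Qed.

Lemma lowered_span v : v \in combinations (lowered n).
Proof.
have st (x : bi_sl2 K) u : u \in combinations (lowered n) ->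
    act x u \in combinations (lowered n).
  apply: stable_bi_sl2 => {}u; apply: combinations_stable (act_lin _) _ u
    => -[[s i] j].
  - by rewrite lowered_e rpredZ ?mem_combinations.
  - by rewrite lowered_f mem_combinations.
  - by rewrite lowered_re rpredZ ?mem_combinations.
  - by rewrite lowered_rf mem_combinations.
apply: (sys_gen sys (S := Submodule st)) => s.
exact: (mem_combinations (lowered n) (s, 0%N, 0%N)).
Qed.

Lemma raise_lowered i j s i' j' :
  iter i (act (eL K)) (iter j (act (eR K)) (lowered n (s, i', j'))) =
  iter i (act (eL K)) (iter i' (act (fL K))
    (iter j (act (eR K)) (iter j' (act (fR K)) (n s)))).
Proof. by rewrite /lowered /= (iter_iter_comm _ _ _ (rl _ _)). Qed.

Lemma raise_lowered_lt i j s i' j' : (i' < i)%N || (j' < j)%N ->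
  iter i (act (eL K)) (iter j (act (eR K)) (lowered n (s, i', j'))) = 0.
Proof.
rewrite raise_lowered => /orP[lt|lt].
  rewrite (iter_iter_comm i' j _ (lr _ _)) (iter_iter_comm i' j' _ (lr _ _)).
  rewrite (iter_iter_comm i j _ (lr _ _)) (iter_iter_comm i j' _ (lr _ _)).
  rewrite (raise_lower_gt (left_triple N) (sys_e sys s) (sys_h sys s) lt).
  by rewrite !(linf0 (lin_iter _ (act_lin _))).
rewrite (raise_lower_gt (right_triple N) (sys_re sys s) (sys_rh sys s) lt).
by rewrite !(linf0 (lin_iter _ (act_lin _))).
Qed.

Lemma raise_lowered_eq s i j :
  iter i (act (eL K)) (iter j (act (eR K)) (lowered n (s, i, j))) =
  (hw_norm (a s) i * hw_norm (b s) j) *: n s.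
Proof.
rewrite raise_lowered (raise_lower_eq (right_triple N) (sys_re sys s) (sys_rh sys s)).
rewrite !(linfZ (lin_iter _ (act_lin _))).
rewrite (raise_lower_eq (left_triple N) (sys_e sys s) (sys_h sys s)).
by rewrite scalerA mulrC.
Qed.

Hypothesis ab_inj : injective (fun s => (a s, b s)).

(** Take a surviving index (s0, i0, j0) with nonzero coefficient and i0 + j0 maximal.
Raising i0 times on the left and j0 times on the right sends every other term of the
relation to 0, except those with the same (i0, j0), which become multiples of the n s.
These are separated by their pairs of weights. *)
Lemma lowered_free (D : {freeg (I * nat * nat) / K}) : fglift (lowered n) D = 0 ->
  forall t, surviving t -> coeff t D = 0.
Proof.
move=> D0.
(* Downward induction on i + j, starting above the degrees that occur in D. *)
pose B := \max_(t <- dom D) (t.1.2 + t.2)%N.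
suff ind m t : (B < m + (t.1.2 + t.2))%N -> surviving t -> coeff t D = 0.
  by move=> t; apply: (ind B.+1); rewrite addSn ltnS leq_addr.
elim: m t => [|m IH] [[s0 i0] j0] /=; rewrite ?add0n.
  move=> ltB _; apply: coeff_outdom; apply: contraL ltB => tD; rewrite -leqNgt.
  exact: (leq_bigmax_seq (F := fun t => (t.1.2 + t.2)%N) _ tD).
move=> ltB s0P; set t0 := (s0, i0, j0).
have [t0D|] := boolP (t0 \in dom D); last exact: coeff_outdom.
pose up v := iter i0 (act (eL K)) (iter j0 (act (eR K)) v) : N.
have lup : linear up.
  exact: lin_comp (lin_iter _ (act_lin _)) (lin_iter _ (act_lin _)).
pose h t := coeff t D *: up (lowered n t).
have hE t : h t = (if (t.1.2 == i0) && (t.2 == j0) then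
    coeff t D * (hw_norm (a t.1.1) i0 * hw_norm (b t.1.1) j0) else 0) *: n t.1.1.
  case: t => [[s i] j] /=; rewrite /h /up.
  have [lt|] := boolP ((i < i0) || (j < j0))%N.
    rewrite raise_lowered_lt // scaler0 ifN ?scale0r //.
    by case/orP: lt => /ltn_eqF -> //=; rewrite andbF.
  rewrite negb_or -!leqNgt => /andP[le le'].
  have [/andP[/eqP -> /eqP ->]|neq] := boolP ((i == i0) && (j == j0)).
    by rewrite raise_lowered_eq scalerA.
  have lt : (i0 + j0 < i + j)%N.
    rewrite ltn_neqAle leq_add // andbT; apply: contra neq => /eqP e.
    have ei : i = i0.
      apply/eqP; rewrite eqn_leq le andbT -(leq_add2r j0) e.
      by rewrite leq_add2l.
    by move/eqP: e; rewrite ei eqn_add2l eqxx eq_sym.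
  have [ok|dead] := boolP (surviving (s, i, j)).
    rewrite (IH (s, i, j)) ?scale0r //=.
    by apply: leq_trans ltB _; rewrite addSnnS leq_add2l.
  by rewrite lowered_dead // -/(up 0) (linf0 lup) scaler0 scale0r.
have h0 : \sum_(t <- dom D) h t = 0.
  transitivity (up (fglift (lowered n) D)); last by rewrite D0 (linf0 lup).
  by rewrite fglift_sum (linf_sum lup); apply: eq_bigr => t _; rewrite (linfZ lup).
have Lh t : act (hL K) (h t) = a t.1.1 *: h t.
  by rewrite hE (linfZ (act_lin _)) (sys_h sys) !scalerA mulrC.
have Rh t : act (hR K) (h t) = b t.1.1 *: h t.
  by rewrite hE (linfZ (act_lin _)) (sys_rh sys) !scalerA mulrC.
have h1 := eigen_component (a s0) (act_lin (hL K)) Lh h0.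
rewrite -big_filter in h1.
have := eigen_component (b s0) (act_lin (hR K)) Rh h1.
rewrite big_filter_cond big_mkcond (bigD1_seq t0) ?uniq_dom //= !eqxx /= big1.
  rewrite addr0 hE /= !eqxx /= => /eqP; rewrite scaler_eq0 (negbTE (sys_neq0 sys _)).
  rewrite orbF mulf_eq0 => /orP[/eqP //|]; rewrite mulf_eq0.
  by move/andP: s0P => /= [/negbTE -> /negbTE ->].
move=> [[s i] j] ne; case: ifP => //= /andP[/eqP ea /eqP eb].
have es : s = s0 by apply: ab_inj; rewrite /= ea eb.
rewrite hE /= ifN ?scale0r //; apply: contra ne => /andP[/eqP -> /eqP ->].
by rewrite es.
Qed.

Lemma lowered_kernel (D : {freeg (I * nat * nat) / K}) : fglift (lowered n) D = 0 <->
  forall t, surviving t -> coeff t D = 0.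
Proof.
split=> [/lowered_free //|D0]; rewrite fglift_sum big1 // => t _.
have [/D0 ->|/lowered_dead ->] := boolP (surviving t); first by rewrite scale0r.
exact: scaler0.
Qed.
End Theory.

(** The vectors lowered n (s, i, j) span; by lowered_kernel the relations between them
are those forced by the weights, and the structure constants depend on the weights
only. *)
Theorem hw_system_iso (N N' : lie_module (bi_sl2 K)) (n : I -> N) (n' : I -> N') :
  injective (fun s => (a s, b s)) -> hw_system n -> hw_system n' -> module_iso N N'.
Proof.
move=> ab_inj sn sn'.
apply: (iso_of_relations (lowered_span sn) (lowered_span sn')).
  by move=> D; rewrite (lowered_kernel sn ab_inj) (lowered_kernel sn' ab_inj).
move=> x [[s i] j].
pose c : {freeg (I * nat * nat) / K} :=
  sl2_ce x.1 *: ((i%:R * (a s - i.-1%:R)) *: << (s, i.-1, j) >>)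
  + sl2_ch x.1 *: ((a s - (2 * i)%:R) *: << (s, i, j) >>)
  + sl2_cf x.1 *: << (s, i.+1, j) >>
  + (sl2_ce x.2 *: ((j%:R * (b s - j.-1%:R)) *: << (s, i, j.-1) >>)
  + sl2_ch x.2 *: ((b s - (2 * j)%:R) *: << (s, i, j) >>)
  + sl2_cf x.2 *: << (s, i, j.+1) >>).
suff cE (M : lie_module (bi_sl2 K)) (m : I -> M) : hw_system m -> act x (lowered m (s, i, j)) = fglift (lowered m) c.
  by exists c; rewrite -!cE.
move=> sm; rewrite act_bi_sl2 lowered_e // lowered_f lowered_re // lowered_rf //.
have lg := fglift_linear (lowered m).
rewrite /c !(linfD lg) !(linfZ lg) !fglift1.
rewrite (weight_lower (left_triple M) _ (p := a s)); last first.
  rewrite (iter_comm _ _ (left_right _ _)) (sys_h sm).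
  by rewrite (linfZ (lin_iter _ (act_lin _))).
rewrite [X in act (hR K) X]loweredC // (weight_lower (right_triple M) _ (p := b s)).
  by rewrite -loweredC.
rewrite (iter_comm _ _ (fun v => esym (left_right _ _ v))) (sys_rh sm).
by rewrite (linfZ (lin_iter _ (act_lin _))).
Qed.
End HighestWeightSystems.

(** * Irreducible highest weight modules and their restricted duals *)

Lemma eigen_not_sum (K : fieldType) (V : lmodType K) (T : V -> V)
    (X : eqType) (s : seq X) (w : X -> K) (g : X -> V) (mu : K) (v : V) :
  linear T -> (forall x, T (g x) = w x *: g x) -> (forall x, w x != mu) ->
  T v = mu *: v -> v = \sum_(x <- s) g x -> v = 0.
Proof.
move=> lT Tg wmu Tv vE.
pose g' o := if o is Some x then - g x else v.
pose w' o := if o is Some x then w x else mu.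
have Tg' o : T (g' o) = w' o *: g' o.
  by case: o => [x|] //=; rewrite (linfN lT) Tg scalerN.
have := @eigen_component _ _ T _ (None :: map some s) w' g' mu lT Tg'.
rewrite !big_cons /= eqxx !big_map /= sumrN -vE subrr => /(_ erefl).
by rewrite big1 ?addr0 // => x /eqP e; have := wmu x; rewrite e eqxx.
Qed.

(** What V_lambda and its restricted dual have in common, and all that is used to
recognize their tensor products. *)
Record hw_generator (K : fieldType) (M : lie_module (sl2 K)) (l : K) (v : M) : Prop := HwGenerator {
  gen_neq0 : v != 0;
  gen_all : generates v;
  gen_e : act (sl2_e K) v = 0;
  gen_h : act (sl2_h K) v = l *: v;
  gen_f : forall i, hw_norm l i = 0 -> iter i (act (sl2_f K)) v = 0 }.

Section Generators.
Variables (K : fieldType) (M : lie_module (sl2 K)).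
Hypothesis pchar0 : [pchar K] =i pred0.

Let E : M -> M := act (sl2_e K).
Let H : M -> M := act (sl2_h K).
Let F : M -> M := act (sl2_f K).
Let tr : sl2_triple E H F := act_triple M.
Let lE : linear E := act_lin _.
Let lH : linear H := act_lin _.
Let lF : linear F := act_lin _.

Let natS n : n.+1%:R != 0 :> K.
Proof. by rewrite ((pcharf0P K).1 pchar0). Qed.

Lemma weight_inj (p : K) : injective (fun k => p - (2 * k)%:R).
Proof.
move=> i j; wlog le : i j / (i <= j)%N => [th e|].
  by have [/th/(_ e)|/ltnW/th/(_ (esym e))] := leqP i j.
move=> /addrI/oppr_inj; rewrite -(subnK le) mulnDr natrD => /eqP.
rewrite -subr_eq0 opprD addrCA subrr addr0 oppr_eq0 ((pcharf0P K).1 pchar0).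
by rewrite muln_eq0 /= => /eqP ->.
Qed.

Lemma weight_neq (p : K) k : p - (2 * k.+1)%:R != p.
Proof. by rewrite -subr_eq0 addrAC subrr sub0r oppr_eq0 ((pcharf0P K).1 pchar0). Qed.

Lemma stable_sl2 (S : subspace M) :
  (forall v, v \in S -> E v \in S) -> (forall v, v \in S -> F v \in S) ->
  forall x v, v \in S -> act x v \in S.
Proof.
move=> se sf x v vS; rewrite act_sl2.
have sh : H v \in S.
  rewrite -[H v](addKr (F (E v))) -(tripleEF tr).
  by apply: rpredD; [apply: rpredNr; exact/sf/se | exact/se/sf].
by apply: rpredD; [apply: rpredD|]; apply: rpredZ => //; [exact: se | exact: sf].
Qed.

Definition lower_span (v : M) := combinations (fun k : nat => iter k F v).

Lemma lower_span_act (p : K) (v : M) : E v = 0 -> H v = p *: v ->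
  forall x u, u \in lower_span v -> act x u \in lower_span v.
Proof.
move=> Ev Hv; apply: stable_sl2 => u; apply: combinations_stable => // k.
  case: k => [|k]; first by rewrite [E _]Ev rpred0.
  by rewrite (raise_lower1 tr Ev Hv) rpredZ // (mem_combinations (fun k => iter k F v)).
exact: (mem_combinations (fun k => iter k F v) k.+1).
Qed.

Lemma mem_lower_span v : v \in lower_span v.
Proof. exact: (mem_combinations (fun k => iter k F v) 0%N). Qed.

(** A nonzero u would span, together with its images under f, a submodule equal
to M; but all its weights differ from l, so it cannot contain v. *)
Lemma singular_vanishes (l p : K) (v u : M) : irreducible M ->
  v != 0 -> H v = l *: v -> E u = 0 -> H u = p *: u ->
  (forall k, p - (2 * k)%:R != l) -> u = 0.
Proof.
move=> [_ irr] v0 Hv Eu Hu ne.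
have [S0|/(_ v) /= /combinationsP[D vE]] := irr (Submodule (lower_span_act Eu Hu)).
  exact/S0/mem_lower_span.
case/eqP: v0; move: vE; rewrite fglift_sum.
apply: (eigen_not_sum lH (w := fun k => p - (2 * k)%:R)) => // k.
by rewrite (linfZ lH) (weight_lower tr k Hu) !scalerA mulrC.
Qed.

Lemma hw_norm_eq0 (l : K) i : hw_norm l i = 0 -> exists2 k, (k < i)%N & l = k%:R.
Proof.
move=> /eqP/prodf_eq0[k _]; rewrite mulf_eq0 (negbTE (natS k)) /= subr_eq0 => /eqP e.
by exists k.
Qed.

(** If hw_norm l i = 0 then l is a natural number k < i, and f^(k+1) v is singular
of weight -k-2, hence 0. *)
Lemma irreducible_hw_generator l : irreducible_hw l M -> exists v : M, hw_generator l v.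
Proof.
move=> [irr [v [v0 gen Ev Hv]]]; exists v; split=> // i /hw_norm_eq0[k ki lk].
have u0 : iter k.+1 F v = 0.
  apply: (singular_vanishes irr v0 Hv (p := l - (2 * k.+1)%:R)).
  - by rewrite (raise_lower1 tr Ev Hv) lk subrr mulr0 scale0r.
  - exact: (weight_lower tr k.+1 Hv).
  - by move=> j; rewrite -addrA -opprD -natrD -mulnDr addSn weight_neq.
by rewrite -(subnK ki) iterD u0; apply: (linf0 (lin_iter _ lF)).
Qed.

Section Dual.
Variables (l : K) (v : M).
Hypothesis gv : hw_generator l v.

Let Ev : E v = 0 := gen_e gv.
Let Hv : H v = l *: v := gen_h gv.

Lemma lower_spanT x : x \in lower_span v.
Proof.
exact: (gen_all gv (S := Submodule (lower_span_act Ev Hv)) (mem_lower_span v)).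
Qed.

Lemma lower_ext (W : lmodType K) (f h : M -> W) : linear f -> linear h ->
  (forall k, f (iter k F v) = h (iter k F v)) -> f =1 h.
Proof.
move=> lf lh fh x; have /combinationsP[D ->] := lower_spanT x.
rewrite !fglift_sum (linf_sum lf) (linf_sum lh); apply: eq_bigr => k _.
by rewrite (linfZ lf) (linfZ lh) fh.
Qed.

Lemma top_or_lowered x : exists c, exists y, x = c *: v + F y.
Proof.
have /combinationsP[D ->] := lower_spanT x; rewrite fglift_sum.
elim: (dom D) => [|k s [c [y IH]]].
  by exists 0, 0; rewrite big_nil scale0r (linf0 lF) addr0.
rewrite big_cons IH; case: k => [|k].
  by exists (coeff 0%N D + c), y; rewrite addrA scalerDl.
exists c, (coeff k.+1 D *: iter k F v + y).
by rewrite (linfD lF) (linfZ lF) addrCA.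
Qed.

(** F y only has weights l - 2(k+1), which differ from l in characteristic 0. *)
Lemma top_not_lowered c y : c *: v = F y -> c = 0.
Proof.
have /combinationsP[D ->] := lower_spanT y; rewrite fglift_sum (linf_sum lF) => e.
have /eqP : c *: v = 0.
  apply: (eigen_not_sum lH (w := fun k => l - (2 * k.+1)%:R) _ _ _ e).
  - move=> k; rewrite (linfZ lF) (linfZ lH) -iterS (weight_lower tr k.+1 Hv).
    by rewrite !scalerA mulrC.
  - by move=> k; apply: weight_neq.
  - by rewrite (linfZ lH) Hv !scalerA mulrC.
by rewrite scaler_eq0 (negbTE (gen_neq0 gv)) orbF => /eqP.
Qed.

(** M is the direct sum of the line of v and of F M, by weights; phi is the
projection to the line.  It lies in the restricted dual because it kills every weight
other than l. *)
Lemma top_form : exists phi : restricted_dual M,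
  val phi v = 1 /\ forall x, val phi (F x) = 0.
Proof.
have [c cP] := choice top_or_lowered; have [y yP] := choice cP.
have cE d z : c (d *: v + F z) = d.
  apply/eqP; rewrite -subr_eq0; apply/eqP/(top_not_lowered (y := z - y (d *: v + F z))).
  rewrite (linfD lF) (linfN lF) scalerBl; set x := _ + F z.
  have e : d *: v + F z = c x *: v + F (y x) := yP x.
  by rewrite -[F z](addKr (d *: v)) e addrA addrK addrC.
have lc : linear (c : M -> K^o).
  move=> a x z; rewrite {1}[x]yP {1}[z]yP scalerDr scalerA -(linfZ lF).
  by rewrite addrACA -scalerDl -(linfD lF) cE.
have cv : c v = 1 by have := cE 1 0; rewrite scale1r (linf0 lF) addr0.
have cF x : c (F x) = 0 by have := cE 0 x; rewrite scale0r add0r.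
have cH x : c (H x) = l * c x.
  rewrite {1}[x]yP (linfD lH) (linfZ lH) Hv scalerA (tripleHF tr) -(linfZ lF).
  by rewrite -(linfN lF) -(linfD lF) cE mulrC.
have cR : (c : M -> K^o) \in @restricted_form K M.
  apply/asboolP; split=> //; exists [:: l] => mu x.
  rewrite !inE => mul /eqP Hx; have := cH x; rewrite -/(H x) in Hx.
  rewrite Hx (linfZ lc) => /eqP; rewrite -subr_eq0 -mulrBl mulf_eq0 subr_eq0.
  by rewrite (negbTE mul) => /eqP.
by exists (exist _ (c : M -> K^o) cR).
Qed.

Lemma rdual_iter_f (phi : restricted_dual M) i x :
  val (iter i (act (sl2_f K)) phi) x = val phi (iter i E x).
Proof.
elim: i x => // i IH x; rewrite iterS restricted_dualE omega_f (linfN (act_linl x)).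
by rewrite (linfN (rdual_linear _)) opprK IH -iterSr.
Qed.

Lemma weights_avoid (s : seq K) : exists n, forall k, (n <= k)%N -> l - (2 * k)%:R \notin s.
Proof.
elim: s => [|m s [n IH]]; first by exists 0%N.
have [[k0 e0]|ne] := pselect (exists k0, l - (2 * k0)%:R = m); last first.
  exists n => k /IH; rewrite inE negb_or => ->; rewrite andbT.
  by apply/eqP => e; apply: ne; exists k.
exists (maxn n k0.+1) => k; rewrite geq_max => /andP[/IH ks lt].
rewrite inE negb_or ks andbT -e0; apply: contraL lt => /eqP/weight_inj ->.
by rewrite ltnn.
Qed.

(** Since omega exchanges e and f up to sign, f^i phi is phi composed with e^i.  It
takes the value hw_norm l i at f^i v and 0 at the other f^k v, so the f^i phi form,
up to scalars, the basis dual to the f^i v; a restricted form involves finitely many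
of them. *)
Lemma dual_hw_generator (phi : restricted_dual M) :
  val phi v = 1 -> (forall x, val phi (F x) = 0) -> hw_generator l phi.
Proof.
move=> phiv phiF; have lphi := rdual_linear phi.
have phi_low i k : (k < i)%N -> val phi (iter i E (iter k F v)) = 0.
  by move=> ki; rewrite (raise_lower_gt tr Ev Hv ki) (linf0 lphi).
have phi_high i k : (i < k)%N -> val phi (iter i E (iter k F v)) = 0.
  move=> /subnKC <-; rewrite addSnnS.
  have [c ->] := raise_lower_add tr Ev Hv (k - i.+1).+1 i.
  by rewrite (linfZ lphi) iterS phiF scaler0.
split.
- by apply/eqP => phi0; have := phiv; rewrite phi0 => /esym/eqP; rewrite oner_eq0.
- move=> S phiS xi.
  have [lxi [s xis]] := asboolP _ (valP xi).
  have [n sn] := weights_avoid s.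
  have xi_high k : (n <= k)%N -> val xi (iter k F v) = 0.
    move=> /sn/xis; apply; rewrite inE; apply/eqP.
    exact: (weight_lower tr k Hv).
  pose c k := val xi (iter k F v) / hw_norm l k.
  suff -> : xi = \sum_(k < n) c k *: iter k (act (sl2_f K)) phi.
    apply: rpred_sum => k _; apply: rpredZ; elim: (k : nat) => [//|i IH].
    exact: (submodule_act (sl2_f K) IH).
  set eta := \sum_(k < n) _; apply/val_inj/funext; apply: lower_ext.
  - exact: lxi.
  - exact: rdual_linear.
  have etaE x : val eta x = \sum_(k < n) c k * val phi (iter k E x).
    rewrite /eta; elim/big_rec2: _ => [|k y z _ IH]; first by [].
    by rewrite rdual_valE IH rdual_iter_f.
  move=> k; rewrite etaE; have [lt|ge] := ltnP k n; last first.
    by rewrite xi_high // big1 // => i _; rewrite phi_high ?mulr0 // (leq_trans _ ge).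
  rewrite (bigD1 (Ordinal lt)) //= big1 ?addr0 => [|i ne]; last first.
    have [ik|ki|e] := ltngtP i k; first by rewrite phi_high ?mulr0.
      by rewrite phi_low ?mulr0.
    by case/eqP: ne; apply: val_inj.
  rewrite (raise_lower_eq tr Ev Hv) (linfZ lphi) phiv /c.
  have [/(gen_f gv) e|nz] := eqVneq (hw_norm l k) 0; last first.
    by rewrite -[_ *: _]/(_ * _) mulr1 divfK.
  by rewrite -/F in e; rewrite e !(linf0 lxi) !mul0r.
- apply/val_inj/funext => x; rewrite restricted_dualE omega_e (linfN (act_linl x)).
  by rewrite (linfN lphi) opprK phiF.
- apply/val_inj/funext; apply: lower_ext; do ?exact: rdual_linear.
  move=> k; rewrite restricted_dualE omega_h (linfN (act_linl _)) (linfN lphi) opprK.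
  rewrite -/H (weight_lower tr k Hv) (linfZ lphi).
  rewrite -[l *: phi]addr0 rdual_valE addr0.
  case: k => [|k]; first by rewrite muln0 subr0.
  by rewrite iterS phiF scaler0 mulr0.
- move=> i /(gen_f gv) e; rewrite -/F in e.
  apply/val_inj/funext; apply: lower_ext; do ?exact: rdual_linear.
  move=> k; rewrite rdual_iter_f; have [/phi_low -> //|ik] := ltnP k i.
  rewrite -(subnK ik) iterD e (linf0 (lin_iter _ lF)) (linf0 (lin_iter _ lE)).
  exact: linf0.
Qed.
End Dual.
End Generators.

(** * Direct sums of tensor products *)

Section Preimage.
Variables (K : fieldType) (V W : lmodType K) (f : V -> W) (lf : linear f).
Variable S : subspace W.

Definition preimage_pred : {pred V} := [pred v | f v \in S].

Fact preimage_closed : submod_closed preimage_pred.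
Proof.
split=> [|a u v]; rewrite !inE; first by rewrite (linf0 lf) rpred0.
by move=> fu fv; rewrite lf rpredD ?rpredZ.
Qed.

Definition preimage := Subspace preimage_closed.
End Preimage.

Section Summands.
Variables (K : fieldType) (g : lie_algebra K) (I : choiceType) (M : I -> lie_module g).

Definition summand_fun s (x : M s) : dprod (fun i => M i) :=
  dfwith (fun i => 0 : M i) x.

Fact summand_supp s (x : M s) :
  summand_fun x \in finitely_supported (V := fun i => M i).
Proof.
apply/asboolP; exists [:: s] => i; rewrite inE => ne.
by rewrite /summand_fun dfwith_out // eq_sym.
Qed.

Definition summand s (x : M s) : dsum_module M := exist _ (summand_fun x) (summand_supp x).

Lemma summand_in s (x : M s) : val (summand x) s = x.
Proof. exact: dfwith_in. Qed.

Lemma summand_out s (x : M s) i : s != i -> val (summand x) i = 0.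
Proof. exact: dfwith_out. Qed.

Lemma dsum_valE a (u v : dsum_module M) i : val (a *: u + v) i = a *: val u i + val v i.
Proof. by rewrite subspace_valE. Qed.

Lemma summand_linear s : linear (@summand s).
Proof.
move=> a x y; apply: dsumP => i; rewrite dsum_valE.
have [<-|ne] := eqVneq s i; first by rewrite !summand_in.
by rewrite !summand_out // scaler0 addr0.
Qed.

Lemma summand_act s x (v : M s) : act x (summand v) = summand (act x v).
Proof.
apply: dsumP => i; rewrite -[LHS]/(act x (val (summand v) i)).
have [<-|ne] := eqVneq s i; first by rewrite !summand_in.
by rewrite !summand_out // (linf0 (act_lin x)).
Qed.

Lemma dsum_sum_summand (f : dsum_module M) :
  exists r : seq I, f = \sum_(s <- r) summand (val f s).
Proof.
have [r0 r0P] := dsum_supp f; exists (undup r0); apply: dsumP => i.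
have lval : linear (fun u : dsum_module M => val u i) by move=> a u v; apply: dsum_valE.
rewrite [RHS](linf_sum lval (undup r0) (fun s => summand (val f s))).
have [ir|nir] := boolP (i \in undup r0).
  rewrite (bigD1_seq i) ?undup_uniq // summand_in big1 => [|s ne]; first exact/esym/addr0.
  by rewrite summand_out.
rewrite big1_seq; first by apply: r0P; rewrite -mem_undup.
by move=> s /andP[_ sr]; rewrite summand_out //; apply: contraNneq nir => <-.
Qed.

Lemma summand_gen (S : subspace (dsum_module M)) :
  (forall s (x : M s), summand x \in S) -> forall f, f \in S.
Proof. by move=> sS f; have [r ->] := dsum_sum_summand f; apply: rpred_sum => s _. Qed.
End Summands.

(** Equality of linear maps on pure tensors, applied to the projection modulo S. *)
Lemma tensor_gen (K : fieldType) (V W : lmodType K) (S : subspace (tensor V W)) :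
  (forall v w, tens v w \in S) -> forall t, t \in S.
Proof.
move=> tS t; rewrite -[t]subr0; apply/quot_piP; move: t.
apply: tensor_ext => [||v w].
- exact: quot_pi_linear.
- by move=> a u v; rewrite -quot_pi_linear scaler0 addr0.
- by apply/quot_piP; rewrite subr0.
Qed.

Section TensorSystem.
Variables (K : fieldType) (I : choiceType) (a b : I -> K).
Variables (A B : I -> lie_module (sl2 K)) (v : forall s, A s) (w : forall s, B s).
Hypotheses (gv : forall s, hw_generator (a s) (v s)).
Hypotheses (gw : forall s, hw_generator (b s) (w s)).
Hypothesis vw0 : forall s, tens (v s) (w s) != 0.

Let N := dsum_module (fun s => tensor_module (A s) (B s)).
Let top s : N := summand (tens (v s) (w s) : tensor_module (A s) (B s)).

Let act_left x s (c : A s) (d : B s) :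
  act ((x, 0) : bi_sl2 K) (tens c d : tensor_module (A s) (B s)) = tens (act x c) d.
Proof.
rewrite [LHS]tensor_act_tens /= (linf0 (act_linl d)) (linf0 (tens_linr _)).
exact: addr0.
Qed.

Let act_right x s (c : A s) (d : B s) :
  act ((0, x) : bi_sl2 K) (tens c d : tensor_module (A s) (B s)) = tens c (act x d).
Proof.
rewrite [LHS]tensor_act_tens /= (linf0 (act_linl c)) (linf0 (tens_linl _)).
exact: add0r.
Qed.

Let s_linl s d : linear (fun c => summand (tens c d : tensor_module (A s) (B s)) : N).
Proof. by move=> k c1 c2; rewrite tensDZl; apply: summand_linear. Qed.

Let s_linr s c : linear (fun d => summand (tens c d : tensor_module (A s) (B s)) : N).
Proof. by move=> k d1 d2; rewrite tensDZr; apply: summand_linear. Qed.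

Let s_left x s c d : act ((x, 0) : bi_sl2 K)
    (summand (tens c d : tensor_module (A s) (B s)) : N)
  = summand (tens (act x c) d : tensor_module (A s) (B s)).
Proof. by rewrite [LHS]summand_act act_left. Qed.

Let s_right x s c d : act ((0, x) : bi_sl2 K)
    (summand (tens c d : tensor_module (A s) (B s)) : N)
  = summand (tens c (act x d) : tensor_module (A s) (B s)).
Proof. by rewrite [LHS]summand_act act_right. Qed.

(** For a fixed second factor the vectors c with c (x) w s in a given submodule form
a submodule of A s that contains v s, hence everything; the same argument in the second
factor and then linearity reach all of the direct sum. *)
Lemma tensor_hw_system : hw_system a b top.
Proof.
split=> [s|s|s|s|s|s i|s i|S tS]; rewrite ?/top.
- apply: contra (vw0 s) => /eqP e; have := congr1 (fun f : N => val f s) e.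
  by rewrite summand_in => ->.
- by rewrite s_left (gen_e (gv s)) (linf0 (s_linl _)).
- by rewrite s_right (gen_e (gw s)) (linf0 (s_linr _)).
- by rewrite s_left (gen_h (gv s)) (linfZ (s_linl _)).
- by rewrite s_right (gen_h (gw s)) (linfZ (s_linr _)).
- move=> /(gen_f (gv s)) e.
  have -> : iter i (act (fL K)) (top s)
      = summand (tens (iter i (act (sl2_f K)) (v s)) (w s) : tensor_module _ _).
    by elim: i {e} => [//|i IH]; rewrite iterS IH; apply: s_left.
  by rewrite e (linf0 (s_linl _)).
- move=> /(gen_f (gw s)) e.
  have -> : iter i (act (fR K)) (top s)
      = summand (tens (v s) (iter i (act (sl2_f K)) (w s)) : tensor_module _ _).
    by elim: i {e} => [//|i IH]; rewrite iterS IH; apply: s_right.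
  by rewrite e (linf0 (s_linr _)).
apply: summand_gen => s.
have S1 c : summand (tens c (w s) : tensor_module (A s) (B s)) \in S.
  have st x c' : c' \in preimage (s_linl (w s)) S ->
      act x c' \in preimage (s_linl (w s)) S.
    by rewrite !inE => h; rewrite -s_left; apply: submodule_act.
  exact: (gen_all (gv s) (S := Submodule st) (tS s)).
have S2 c d : summand (tens c d : tensor_module (A s) (B s)) \in S.
  have st x d' : d' \in preimage (s_linr c) S -> act x d' \in preimage (s_linr c) S.
    by rewrite !inE => h; rewrite -s_right; apply: submodule_act.
  exact: (gen_all (gw s) (S := Submodule st) (S1 c)).
exact: (tensor_gen (S := preimage (@summand_linear _ _ _ _ s) S) S2).
Qed.
End TensorSystem.

(** The bilinear map f v * g w factors through the tensor product. *)
Lemma tens_neq0 (K : fieldType) (V W : lmodType K) (f : V -> K^o) (g : W -> K^o) v w :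
  linear f -> linear g -> f v != 0 -> g w != 0 -> tens v w != 0.
Proof.
move=> lf lg fv gw.
have bfg : @bilin K K^o V W (fun x y => f x * g y).
  split=> [y|x] c u u'; first by rewrite lf mulrDl -mulrA.
  by rewrite lg mulrDr mulrCA.
apply: contra (mulf_neq0 fv gw) => /eqP e.
by rewrite -(tensor_lift_tens bfg) e (linf0 (tensor_lift_linear bfg)).
Qed.

(** Turns a sum of binary sums into a sum over pairs, to which hw_system_iso
applies. *)
Lemma dsum_pair_iso (K : fieldType) (g : lie_algebra K) (I : choiceType)
    (M : I * bool -> lie_module g) :
  module_iso (dsum_module M)
    (dsum_module (fun s => pair_module (M (s, true)) (M (s, false)))).
Proof.
pose P s := pair_module (M (s, true)) (M (s, false)).
pose ff (u : dsum_module M) : dprod (fun s => P s) :=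
  fun s => (val u (s, true), val u (s, false)).
have fS u : ff u \in finitely_supported (V := fun s => P s).
  have [r rP] := dsum_supp u; apply/asboolP; exists (map fst r) => s sr.
  by congr pair; apply: rP; apply: contra sr => h; apply: (map_f fst h).
pose hh (u : dsum_module P) : dprod (fun p => M p) :=
  fun p => match p with (s, true) => (val u s).1 | (s, false) => (val u s).2 end.
have hS u : hh u \in finitely_supported (V := fun p => M p).
  have [r rP] := dsum_supp u; apply/asboolP.
  exists (map (fun s => (s, true)) r ++ map (fun s => (s, false)) r).
  have out b s : (s, b) \notin map (pair^~ true) r ++ map (pair^~ false) r -> s \notin r.
    apply: contra => sr; rewrite mem_cat; case: b; apply/orP; [left|right];
      by apply/mapP; exists s.
  by case=> s [] /out sr; rewrite /hh rP.
exists (fun u => exist _ (ff u) (fS u) : dsum_module P); split.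
- by move=> c x y; apply: dsumP => s; rewrite dsum_valE /= /ff !dsum_valE.
- exists (fun u => exist _ (hh u) (hS u) : dsum_module M) => u; apply: dsumP.
    by case=> s [].
  by move=> s /=; rewrite /ff /=; case: (val u s).
- by move=> x u; apply: dsumP.
Qed.

(** * Monomials of the Fock space *)

Section PolyEval.
Variables (K : fieldType) (U : lmodType K).

(** The linear map from polynomials to U that sends 'X^i to u i. *)
Definition coef_comb (u : nat -> U) (p : {poly K}) : U := \sum_(i < size p) p`_i *: u i.

Lemma coef_combE u (p : {poly K}) n : (size p <= n)%N ->
  coef_comb u p = \sum_(i < n) p`_i *: u i.
Proof.
move=> le; rewrite /coef_comb (big_ord_widen n (fun i => p`_i *: u i)) // big_mkcond /=.
apply: eq_bigr => i _; case: ifP => // /negbT; rewrite -leqNgt => h.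
by rewrite nth_default // scale0r.
Qed.

Lemma coef_comb_linear u : linear (coef_comb u).
Proof.
move=> a p q; pose n := maxn (size (a *: p + q)) (maxn (size p) (size q)).
rewrite !(@coef_combE _ _ n) ?leq_max ?leqnn ?orbT // scaler_sumr -big_split.
by apply: eq_bigr => i _; rewrite coefD coefZ scalerDl scalerA.
Qed.

Lemma coef_comb_Xn u i : coef_comb u 'X^i = u i.
Proof.
rewrite (@coef_combE _ _ i.+1) ?size_polyXn // (bigD1 ord_max) //= coefXn eqxx scale1r.
by rewrite big1 ?addr0 // => j; rewrite -val_eqE coefXn => /negbTE /= ->; apply: scale0r.
Qed.

End PolyEval.

Section Monomials.
Variable K : numFieldType.

Definition monomial (t : nat * nat * int) : fock_module K :=
  fock_vec 'X^(t.1.1) 'X^(t.1.2) t.2.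

Local Notation x i j l := (monomial (i, j, l)).

Lemma vec_linl q l : linear (fun p : {poly K} => fock_vec p q l).
Proof. by move=> a p p'; rewrite /fock_vec !tensDZl. Qed.

Lemma vec_linr p l : linear (fun q : {poly K} => fock_vec p q l).
Proof. by move=> a q q'; rewrite /fock_vec tensDZr tensDZl. Qed.

Lemma monomial_span v : v \in combinations monomial.
Proof.
have vecS p q l : fock_vec p q l \in combinations monomial.
  rewrite -[p]coefK poly_def (linf_sum (vec_linl q l)); apply: rpred_sum => i _.
  rewrite (linfZ (vec_linl q l)); apply: rpredZ.
  rewrite -[q]coefK poly_def (linf_sum (vec_linr _ l)); apply: rpred_sum => j _.
  rewrite (linfZ (vec_linr _ l)); apply: rpredZ.
  exact: (mem_combinations monomial (val i, val j, l)).
rewrite -[v]subr0; apply/quot_piP; move: v; apply: fock_ext => [||p q l].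
- exact: quot_pi_linear.
- by move=> a u v; rewrite -quot_pi_linear scaler0 addr0.
- by apply/quot_piP; rewrite subr0.
Qed.

Lemma monomial_ext (U : lmodType K) (f g : fock_module K -> U) :
  linear f -> linear g -> (forall i j l, f (x i j l) = g (x i j l)) -> f =1 g.
Proof.
move=> lf lg fg v; have /combinationsP[D ->] := monomial_span v.
rewrite !fglift_sum (linf_sum lf) (linf_sum lg); apply: eq_bigr => -[[i j] l] _.
by rewrite (linfZ lf) (linfZ lg) fg.
Qed.

Section Forms.
Variable g : nat -> nat -> int -> K^o.

Let pe (l : int) (p q : {poly K}) : K^o :=
  coef_comb (fun i => coef_comb (fun j => g i j l) q) p.

Let pe_bilin l : bilin (pe l).
Proof.
split=> [q|p]; first exact: coef_comb_linear.
move=> a q q'; rewrite /pe !(coef_combE _ (leqnn (size p))) scaler_sumr -big_split.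
apply: eq_bigr => i _; rewrite [coef_comb _ (a *: q + q')]coef_comb_linear.
by rewrite scalerDr !scalerA mulrC.
Qed.

(** The linear form with prescribed values g on the monomials, which are therefore
linearly independent. *)
Definition fock_form : fock_module K -> K^o :=
  tensor_lift (fun t D => fglift (fun l => tensor_lift (pe l) t) D).

Let fb : bilin (fun t D => fglift (fun l => tensor_lift (pe l) t) D).
Proof.
split=> [D|t]; last exact: fglift_linear.
move=> a t t'; rewrite !fglift_sum scaler_sumr -big_split; apply: eq_bigr => l _.
by rewrite (tensor_lift_linear (pe_bilin l)) scalerDr !scalerA mulrC.
Qed.

Lemma fock_form_linear : linear fock_form.
Proof. exact: tensor_lift_linear fb. Qed.

Lemma fock_formE i j l : fock_form (x i j l) = g i j l.
Proof.
rewrite /fock_form /monomial /fock_vec (tensor_lift_tens fb) fglift1.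
by rewrite (tensor_lift_tens (pe_bilin l)) /pe !coef_comb_Xn.
Qed.
End Forms.

Definition fock_coef (t : nat * nat * int) : fock_module K -> K^o :=
  fock_form (fun i j l => ((i, j, l) == t)%:R).

Lemma fock_coef_linear t : linear (fock_coef t).
Proof. exact: fock_form_linear. Qed.

Lemma fock_coefE t i j l : fock_coef t (x i j l) = ((i, j, l) == t)%:R.
Proof. exact: fock_formE. Qed.

Lemma fock_coef_lift t (D : {freeg (nat * nat * int) / K}) :
  fock_coef t (fglift monomial D) = coeff t D.
Proof.
rewrite fglift_sum (linf_sum (fock_coef_linear t)).
have cE u : fock_coef t (coeff u D *: monomial u) = coeff u D *+ (u == t).
  case: u => [[i j] l]; rewrite (linfZ (fock_coef_linear t)) fock_coefE.
  by case: eqP => _; [apply: mulr1 | apply: mulr0].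
rewrite (eq_bigr _ (fun u _ => cE u)); have [tD|tD] := boolP (t \in dom D).
  by rewrite (bigD1_seq t) ?uniq_dom //= eqxx big1 ?addr0 // => u /negbTE ->.
rewrite coeff_outdom // big1_seq // => u /= uD; case: eqP => // e.
by rewrite -e uD in tD.
Qed.

Lemma mem_by_coef (S : subspace (fock_module K)) v :
  (forall t, fock_coef t v != 0 -> monomial t \in S) -> v \in S.
Proof.
have /combinationsP[D ->] := monomial_span v => DS.
rewrite fglift_sum big_seq; apply: rpred_sum => t; rewrite mem_dom => tD.
by apply/rpredZ/DS; rewrite fock_coef_lift.
Qed.

Lemma act_eL (v : fock_module K) : act (eL K) v = fock_gamma v.
Proof. by have [-> _ _] := fock_act_left v. Qed.
Lemma act_eR (v : fock_module K) : act (eR K) v = fock_bgamma v.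
Proof. by have [-> _ _] := fock_act_right v. Qed.

Let gammaE i j l : fock_gamma (x i j l) = - i%:R *: x i.-1 j l.
Proof.
rewrite /monomial fock_gamma_vec derivXn -scaler_nat -scaleNr.
exact: (linfZ (vec_linl _ l)).
Qed.

Let bgammaE i j l : fock_bgamma (x i j l) = - j%:R *: x i j.-1 l.
Proof.
rewrite /monomial fock_bgamma_vec derivXn -scaler_nat -scaleNr.
exact: (linfZ (vec_linr _ l)).
Qed.

Let betaE i j l : fock_beta (x i j l) = x i.+1 j l.
Proof. by rewrite /monomial fock_beta_vec -exprS. Qed.
Let bbetaE i j l : fock_bbeta (x i j l) = x i j.+1 l.
Proof. by rewrite /monomial fock_bbeta_vec -exprS. Qed.
Let aE i j l : fock_a (x i j l) = l%:~R *: x i j l.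
Proof. exact: fock_a_vec. Qed.
Let oneE i j l : fock_one (- 2) (x i j l) = x i j (l - 2).
Proof. by rewrite /monomial fock_one_vec addrC. Qed.

Let lb := @fock_beta_linear K.
Let lbb := @fock_bbeta_linear K.
Let lg := @fock_gamma_linear K.
Let lbg := @fock_bgamma_linear K.
Let la := @fock_a_linear K.
Let lo := @fock_one_linear K.

Lemma eL_x i j l : act (eL K) (x i j l) = - i%:R *: x i.-1 j l.
Proof. by rewrite act_eL gammaE. Qed.

Lemma eR_x i j l : act (eR K) (x i j l) = - j%:R *: x i j.-1 l.
Proof. by rewrite act_eR bgammaE. Qed.

Lemma hL_x i j l : act (hL K) (x i j l) = (l%:~R - (2 * i)%:R) *: x i j l.
Proof.
have [_ -> _] := fock_act_left (x i j l); rewrite aE gammaE (linfZ lb) betaE.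
case: i => [|i]; last by rewrite /= natrM scalerA -scalerDl; congr (_ *: _); ring.
by rewrite muln0 subr0 oppr0 scale0r scaler0 add0r.
Qed.

Lemma hR_x i j l : act (hR K) (x i j l) = (l%:~R - (2 * j)%:R) *: x i j l.
Proof.
have [_ -> _] := fock_act_right (x i j l); rewrite aE bgammaE (linfZ lbb) bbetaE.
case: j => [|j]; last by rewrite /= natrM scalerA -scalerDl; congr (_ *: _); ring.
by rewrite muln0 subr0 oppr0 scale0r scaler0 add0r.
Qed.

Lemma fL_x i j l : act (fL K) (x i j l) =
  (i%:R - l%:~R) *: x i.+1 j l - j%:R *: x i j.-1 (l - 2).
Proof.
have [_ _ ->] := fock_act_left (x i j l).
rewrite oneE aE gammaE bgammaE !(linfZ lb) !betaE scaleNr; congr (_ - _).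
case: i => [|i]; last by rewrite /= -scaleNr -scalerBl; congr (_ *: _); ring.
by rewrite !oppr0 !scale0r oppr0 add0r sub0r scaleNr.
Qed.

Lemma fR_x i j l : act (fR K) (x i j l) =
  (j%:R - l%:~R) *: x i j.+1 l - i%:R *: x i.-1 j (l - 2).
Proof.
have [_ _ ->] := fock_act_right (x i j l).
rewrite oneE aE gammaE bgammaE !(linfZ lbb) !bbetaE scaleNr; congr (_ - _).
case: j => [|j]; last by rewrite /= -scaleNr -scalerBl; congr (_ *: _); ring.
by rewrite !oppr0 !scale0r oppr0 add0r sub0r scaleNr.
Qed.

(** Equal to 4 f e + h^2 + 2 h for each of the two copies of sl2 (casimir_left,
casimir_right); in this form it is visibly triangular on the monomials. *)
Definition casimir (v : fock_module K) : fock_module K :=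
  4 *: fock_gamma (fock_bgamma (fock_one (- 2) v)) + fock_a (fock_a v) + 2 *: fock_a v.

Lemma casimir_linear : linear casimir.
Proof.
have l1 := lin_scale 4 (lin_comp lg (lin_comp lbg (lo (- 2)))).
exact: lin_add (lin_add l1 (lin_comp la la)) (lin_scale 2 la).
Qed.

Lemma casimir_x i j l : casimir (x i j l) =
  (l * (l + 2))%:~R *: x i j l + (4 * (i * j))%:R *: x i.-1 j.-1 (l - 2).
Proof.
rewrite /casimir oneE bgammaE (linfZ lg) gammaE aE (linfZ la) aE -addrA addrC !scalerA.
rewrite -scalerDl; congr (_ *: _ + _ *: _); last by rewrite !natrM; ring.
by rewrite intrM intrD; ring.
Qed.

Lemma casimir_eL v : casimir (act (eL K) v) = act (eL K) (casimir v).
Proof.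
rewrite !act_eL /casimir !(linfD lg) !(linfZ lg) !fock_a_gamma.
by rewrite fock_one_gamma -fock_gamma_bgamma.
Qed.

Lemma casimir_eR v : casimir (act (eR K) v) = act (eR K) (casimir v).
Proof.
rewrite !act_eR /casimir !(linfD lbg) !(linfZ lbg) !fock_a_bgamma.
by rewrite fock_one_bgamma fock_gamma_bgamma.
Qed.

Lemma casimir_left v : casimir v =
  4 *: act (fL K) (act (eL K) v) + act (hL K) (act (hL K) v) + 2 *: act (hL K) v.
Proof.
move: v; apply: monomial_ext => [||i j l].
- exact: casimir_linear.
- have a2 y z := lin_comp (act_lin y) (act_lin z) : linear (fun v : fock_module K => _).
  exact: lin_add (lin_add (lin_scale 4 (a2 _ _)) (a2 _ _)) (lin_scale 2 (act_lin _)).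
rewrite casimir_x eL_x !hL_x (linfZ (act_lin (fL K))) (linfZ (act_lin (hL K))) hL_x fL_x.
case: i => [|i] /=.
  by rewrite !scalerA mul0n muln0 oppr0 mulr0 !scale0r add0r addr0 -scalerDl;
    congr (_ *: _); rewrite intrM intrD; ring.
rewrite !natrM !intrM !intrD; lmod_eq K.
Qed.

Lemma casimir_right v : casimir v =
  4 *: act (fR K) (act (eR K) v) + act (hR K) (act (hR K) v) + 2 *: act (hR K) v.
Proof.
move: v; apply: monomial_ext => [||i j l].
- exact: casimir_linear.
- have a2 y z := lin_comp (act_lin y) (act_lin z) : linear (fun v : fock_module K => _).
  exact: lin_add (lin_add (lin_scale 4 (a2 _ _)) (a2 _ _)) (lin_scale 2 (act_lin _)).
rewrite casimir_x eR_x !hR_x (linfZ (act_lin (fR K))) (linfZ (act_lin (hR K))) hR_x fR_x.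
case: j => [|j] /=.
  by rewrite !scalerA muln0 oppr0 mulr0 !scale0r add0r addr0 -scalerDl;
    congr (_ *: _); rewrite intrM intrD; ring.
rewrite !natrM !intrM !intrD; lmod_eq K.
Qed.

End Monomials.

(** * Generated submodules and their quotients *)

Section Generated.
Variables (K : fieldType) (g : lie_algebra K) (M : lie_module g).

Lemma generated_min (P : M -> Prop) (S : submodule M) :
  (forall x, P x -> x \in S) -> forall v, v \in generated P -> v \in S.
Proof. by move=> PS v /asboolP; apply. Qed.

Section Quotient.
Variables (A B : submodule M).

Definition subquotient_class (v : sub_module A) : subquotient A B := quot_pi _ v.

Lemma subquotient_class_linear : linear subquotient_class.
Proof. exact: quot_pi_linear. Qed.

Lemma subquotient_class_act x v :
  act x (subquotient_class v) = subquotient_class (act x v).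
Proof. exact: quot_actE. Qed.

Lemma subquotient_class_eq0 v : subquotient_class v = 0 <-> val v \in B.
Proof.
rewrite -(linf0 subquotient_class_linear); split=> [/quot_piP|vB].
  by rewrite subr0 inE.
by apply/quot_piP; rewrite subr0 inE.
Qed.

Lemma subquotient_class_surj w : exists v, w = subquotient_class v.
Proof. by exists (quot_repr w); rewrite /subquotient_class quot_reprK. Qed.
End Quotient.
End Generated.

Section Systems.
Variables (K : fieldType) (I : choiceType) (a b : I -> K).
Variables (M : lie_module (bi_sl2 K)) (P : M -> Prop) (m : I -> M).
Hypothesis mP : forall s, P (m s).

Let val_act x (v : sub_module (generated P)) : val (act x v) = act x (val v).
Proof. by []. Qed.

Let val_iter i x (v : sub_module (generated P)) :
  val (iter i (act x) v) = iter i (act x) (val v).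
Proof. by elim: i => // i IH; rewrite !iterS val_act IH. Qed.

Let valZ c (v : sub_module (generated P)) : val (c *: v) = c *: val v.
Proof. by rewrite -[c *: v]addr0 subspace_valE addr0. Qed.

Let top s : sub_module (generated P) := exist _ (m s) (mem_generated (mP s)).

Lemma generated_hw_system :
  (forall s, m s != 0) ->
  (forall s, act (eL K) (m s) = 0) -> (forall s, act (eR K) (m s) = 0) ->
  (forall s, act (hL K) (m s) = a s *: m s) ->
  (forall s, act (hR K) (m s) = b s *: m s) ->
  (forall s i, hw_norm (a s) i = 0 -> iter i (act (fL K)) (m s) = 0) ->
  (forall s i, hw_norm (b s) i = 0 -> iter i (act (fR K)) (m s) = 0) ->
  (forall x, P x -> exists s, x = m s) ->
  hw_system a b top.
Proof.
move=> m0 me mre mh mrh mf mrf Pm; split.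
- by move=> s; apply: contra (m0 s) => /eqP e; have /(congr1 val) /= -> := e.
- by move=> s; apply: val_inj; rewrite val_act me.
- by move=> s; apply: val_inj; rewrite val_act mre.
- by move=> s; apply: val_inj; rewrite val_act valZ mh.
- by move=> s; apply: val_inj; rewrite val_act valZ mrh.
- by move=> s i e; apply: val_inj; rewrite val_iter mf.
- by move=> s i e; apply: val_inj; rewrite val_iter mrf.
- by move=> S topS; apply: generated_generates => x /Pm[s ->]; exists (top s).
Qed.

Variable B : submodule M.
Let cls := @subquotient_class _ _ _ (generated P) B.

(** The relations among the generators are needed modulo B only, and those generators
that lie in B are dropped. *)
Lemma subquotient_hw_system :
  (forall s, m s \notin B) ->
  (forall s, act (eL K) (m s) \in B) -> (forall s, act (eR K) (m s) \in B) ->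
  (forall s, act (hL K) (m s) = a s *: m s) ->
  (forall s, act (hR K) (m s) = b s *: m s) ->
  (forall s i, hw_norm (a s) i = 0 -> iter i (act (fL K)) (m s) \in B) ->
  (forall s i, hw_norm (b s) i = 0 -> iter i (act (fR K)) (m s) \in B) ->
  (forall x, P x -> x \in B \/ exists s, x = m s) ->
  hw_system a b (fun s => cls (top s)).
Proof.
move=> m0 me mre mh mrh mf mrf Pm.
have cls_iter i x v : iter i (act x) (cls v) = cls (iter i (act x) v).
  by elim: i => // i IH; rewrite !iterS IH [LHS]subquotient_class_act.
split.
- by move=> s; apply: contra (m0 s) => /eqP/subquotient_class_eq0.
- move=> s; rewrite [LHS]subquotient_class_act; apply/subquotient_class_eq0.
  exact: me.
- move=> s; rewrite [LHS]subquotient_class_act; apply/subquotient_class_eq0.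
  exact: mre.
- move=> s; rewrite [LHS]subquotient_class_act -(linfZ (@subquotient_class_linear _ _ _ _ _)).
  by congr subquotient_class; apply: val_inj; rewrite val_act valZ mh.
- move=> s; rewrite [LHS]subquotient_class_act -(linfZ (@subquotient_class_linear _ _ _ _ _)).
  by congr subquotient_class; apply: val_inj; rewrite val_act valZ mrh.
- move=> s i e; rewrite cls_iter; apply/subquotient_class_eq0.
  by rewrite val_iter mf.
- move=> s i e; rewrite cls_iter; apply/subquotient_class_eq0.
  by rewrite val_iter mrf.
move=> S topS w; have [v ->] := subquotient_class_surj w.
have st x v' : v' \in preimage (@subquotient_class_linear _ _ _ (generated P) B) S ->
    act x v' \in preimage (@subquotient_class_linear _ _ _ (generated P) B) S.
  by rewrite !inE => h; rewrite -subquotient_class_act; apply: submodule_act.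
have : v \in Submodule st; last by rewrite inE.
move: v; apply: generated_generates => x Px.
exists (exist _ x (mem_generated Px)) => //; rewrite inE.
have [xB|[s xs]] := Pm x Px.
  have -> : subquotient_class B (exist _ x (mem_generated Px) : sub_module (generated P)) = 0.
    exact/subquotient_class_eq0.
  exact: rpred0.
have -> : exist _ x (mem_generated Px) = top s by apply: val_inj.
exact: topS.
Qed.
End Systems.

(** * Monomial coefficients of the images of the operators *)

Section Coefficients.
Variable K : numFieldType.
Local Notation x i j l := (@monomial K (i, j, l)).
Local Notation M := (fock_module K).

Lemma coef_eL i j l (v : M) :
  fock_coef (i, j, l) (act (eL K) v) = - i.+1%:R * fock_coef (i.+1, j, l) v.
Proof.
move: v; apply: monomial_ext.
- exact: lin_comp (@fock_coef_linear K _) (act_lin _).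
- exact: lin_scale (@fock_coef_linear K _).
move=> i' j' l'; rewrite eL_x (linfZ (@fock_coef_linear K _)) !fock_coefE.
case: i' => [|i'] /=; first by rewrite oppr0 scale0r mulr0.
by rewrite !xpair_eqE eqSS; case: (i' =P i) => [->|] //= _; rewrite mulr0; apply: mulr0.
Qed.

Lemma coef_eR i j l (v : M) :
  fock_coef (i, j, l) (act (eR K) v) = - j.+1%:R * fock_coef (i, j.+1, l) v.
Proof.
move: v; apply: monomial_ext.
- exact: lin_comp (@fock_coef_linear K _) (act_lin _).
- exact: lin_scale (@fock_coef_linear K _).
move=> i' j' l'; rewrite eR_x (linfZ (@fock_coef_linear K _)) !fock_coefE.
case: j' => [|j'] /=; first by rewrite oppr0 scale0r !xpair_eqE andbF mulr0.
by rewrite !xpair_eqE eqSS; case: (j' =P j) => [->|] //= _; rewrite andbF mulr0; apply: mulr0.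
Qed.

Lemma coef_hL i j l (v : M) :
  fock_coef (i, j, l) (act (hL K) v) = (l%:~R - (2 * i)%:R) * fock_coef (i, j, l) v.
Proof.
move: v; apply: monomial_ext.
- exact: lin_comp (@fock_coef_linear K _) (act_lin _).
- exact: lin_scale (@fock_coef_linear K _).
move=> i' j' l'; rewrite hL_x (linfZ (@fock_coef_linear K _)) !fock_coefE.
by case: eqP => [[-> _ ->]|_] //; rewrite mulr0; apply: mulr0.
Qed.

Lemma coef_hR i j l (v : M) :
  fock_coef (i, j, l) (act (hR K) v) = (l%:~R - (2 * j)%:R) * fock_coef (i, j, l) v.
Proof.
move: v; apply: monomial_ext.
- exact: lin_comp (@fock_coef_linear K _) (act_lin _).
- exact: lin_scale (@fock_coef_linear K _).
move=> i' j' l'; rewrite hR_x (linfZ (@fock_coef_linear K _)) !fock_coefE.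
by case: eqP => [[_ -> ->]|_] //; rewrite mulr0; apply: mulr0.
Qed.

Lemma coef_casimir i j l (v : M) : fock_coef (i, j, l) (casimir v) =
  (l * (l + 2))%:~R * fock_coef (i, j, l) v
  + (4 * (i.+1 * j.+1))%:R * fock_coef (i.+1, j.+1, l + 2) v.
Proof.
have lc := @fock_coef_linear K.
move: v; apply: monomial_ext.
- exact: lin_comp (lc _) (@casimir_linear K).
- exact: (lin_add (lin_scale _ (lc _)) (lin_scale _ (lc _))).
move=> i' j' l'; rewrite casimir_x (linfD (lc _)) !(linfZ (lc _)) !fock_coefE.
congr (_ + _).
  by case: eqP => [[_ _ ->]|_] //; rewrite mulr0; apply: mulr0.
case: i' => [|i']; first by rewrite mul0n muln0 scale0r mulr0.
case: j' => [|j']; first by rewrite !muln0 scale0r !xpair_eqE andbF mulr0.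
rewrite !xpair_eqE !eqSS subr_eq /=.
case: (i' =P i) => [->|_] /=; last by rewrite mulr0; apply: mulr0.
case: (j' =P j) => [->|_] /=; last by rewrite mulr0; apply: mulr0.
by [].
Qed.

Lemma weight_left (v : M) (p : int) i j l : act (hL K) v = p%:~R *: v ->
  fock_coef (i, j, l) v != 0 -> l = p + (2 * i)%:R.
Proof.
move=> hv c0; have := coef_hL i j l v; rewrite hv (linfZ (@fock_coef_linear K _)).
move=> /(mulIf c0)/eqP; rewrite eq_sym subr_eq -[(2 * i)%:R]mulrz_nat -intrD eqr_int.
by move=> /eqP ->; rewrite natz.
Qed.

Lemma weight_right (v : M) (q : int) i j l : act (hR K) v = q%:~R *: v ->
  fock_coef (i, j, l) v != 0 -> l = q + (2 * j)%:R.
Proof.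
move=> hv c0; have := coef_hR i j l v; rewrite hv (linfZ (@fock_coef_linear K _)).
move=> /(mulIf c0)/eqP; rewrite eq_sym subr_eq -[(2 * j)%:R]mulrz_nat -intrD eqr_int.
by move=> /eqP ->; rewrite natz.
Qed.
End Coefficients.

(** * Submodules containing the vacua *)

Section Reaching.
Variable K : numFieldType.
Local Notation x i j l := (@monomial K (i, j, l)).
Local Notation M := (fock_module K).
Implicit Types (v : M) (S : submodule M).

Lemma raise_monomial i j a b l : exists c,
  iter i (act (eL K)) (iter j (act (eR K)) (x a b l)) = c *: x (a - i)%N (b - j)%N l.
Proof.
have [c ->] : exists c, iter j (act (eR K)) (x a b l) = c *: x a (b - j)%N l.
  elim: j => [|j [c IH]]; first by exists 1; rewrite subn0 scale1r.
  by exists (c * - (b - j)%N%:R); rewrite iterS IH (linfZ (act_lin _)) eR_x scalerA subnS.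
elim: i => [|i [d IH]]; first by exists c; rewrite subn0.
by exists (d * - (a - i)%N%:R); rewrite iterS IH (linfZ (act_lin _)) eL_x scalerA subnS.
Qed.

Lemma lower_left_monomial i l :
  iter i (act (fL K)) (x 0 0 l) = (\prod_(k < i) (k%:R - l%:~R)) *: x i 0 l.
Proof.
elim: i => [|i IH]; first by rewrite big_ord0 scale1r.
rewrite iterS IH (linfZ (act_lin _)) fL_x scale0r subr0 scalerA.
by rewrite big_ord_recr.
Qed.

Lemma lower_right_monomial j l :
  iter j (act (fR K)) (x 0 0 l) = (\prod_(k < j) (k%:R - l%:~R)) *: x 0 j l.
Proof.
elim: j => [|j IH]; first by rewrite big_ord0 scale1r.
rewrite iterS IH (linfZ (act_lin _)) fR_x scale0r subr0 scalerA.
by rewrite big_ord_recr.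
Qed.

Lemma subr_nat_int (k : nat) (l : int) : k%:R - l%:~R = (k%:Z - l)%:~R :> K.
Proof. by rewrite intrB. Qed.

Lemma hw_norm_int_eq0 (l : int) i : hw_norm (l%:~R : K) i = 0 ->
  exists2 k : nat, (k < i)%N & l = k%:Z.
Proof.
move/(hw_norm_eq0 (@pchar_num K)) => [k ki /eqP].
by rewrite -[k%:R]mulrz_nat eqr_int natz => /eqP lk; exists k.
Qed.

Lemma lower_left_vanish i l : hw_norm (l%:~R : K) i = 0 ->
  iter i (act (fL K)) (x 0 0 l) = 0.
Proof.
move/hw_norm_int_eq0 => [k ki ->]; rewrite lower_left_monomial.
by rewrite (bigD1 (Ordinal ki)) //= subr_nat_int subrr mul0r scale0r.
Qed.

Lemma lower_right_vanish i l : hw_norm (l%:~R : K) i = 0 ->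
  iter i (act (fR K)) (x 0 0 l) = 0.
Proof.
move/hw_norm_int_eq0 => [k ki ->]; rewrite lower_right_monomial.
by rewrite (bigD1 (Ordinal ki)) //= subr_nat_int subrr mul0r scale0r.
Qed.

Section Reach.
Variable S : submodule M.

(** The leading coefficient i - l of f x(i,j,l) is invertible, so x(i+1,j,l) is reached
unless i = l. *)
Lemma reach_left i j l : i%:Z != l ->
  x i j l \in S -> (j != 0%N -> x i j.-1 (l - 2) \in S) -> x i.+1 j l \in S.
Proof.
move=> il xS xS'; have := submodule_act (fL K) xS; rewrite fL_x => h.
have c0 : i%:R - l%:~R != 0 :> K by rewrite subr_nat_int intr_eq0 subr_eq0.
rewrite -[x i.+1 j l]scale1r -(mulVf c0) -scalerA; apply: rpredZ.
rewrite -[X in X \in _](subrK (j%:R *: x i j.-1 (l - 2))); apply: rpredD => //.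
by case: j {xS h} xS' => [|j] xS'; [rewrite scale0r rpred0 | apply/rpredZ/xS'].
Qed.

Lemma reach_right i j l : j%:Z != l ->
  x i j l \in S -> (i != 0%N -> x i.-1 j (l - 2) \in S) -> x i j.+1 l \in S.
Proof.
move=> jl xS xS'; have := submodule_act (fR K) xS; rewrite fR_x => h.
have c0 : j%:R - l%:~R != 0 :> K by rewrite subr_nat_int intr_eq0 subr_eq0.
rewrite -[x i j.+1 l]scale1r -(mulVf c0) -scalerA; apply: rpredZ.
rewrite -[X in X \in _](subrK (i%:R *: x i.-1 j (l - 2))); apply: rpredD => //.
by case: i {xS h} xS' => [|i] xS'; [rewrite scale0r rpred0 | apply/rpredZ/xS'].
Qed.

Hypothesis vacS : forall l, x 0 0 l \in S.

Lemma reach_edge_right_le (n j : nat) : (j <= n)%N -> x 0 j n%:Z \in S.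
Proof.
elim: j => [//|j IH] jn; apply: reach_right => //; last exact/IH/ltnW.
by rewrite eqz_nat ltn_eqF.
Qed.

Lemma reach_edge_left_le (n i : nat) : (i <= n)%N -> x i 0 n%:Z \in S.
Proof.
elim: i => [//|i IH] jn; apply: reach_left => //; last exact/IH/ltnW.
by rewrite eqz_nat ltn_eqF.
Qed.

(** The only vectors killed by both e's are the combinations of vacua, since the e's
are derivatives in beta and bbeta. *)
Lemma reach_singular v : act (eL K) v = 0 -> act (eR K) v = 0 -> v \in S.
Proof.
move=> ev erv; apply: mem_by_coef => -[[i j] l] c0.
case: i c0 => [|i] c0; last first.
  have := coef_eL i j l v; rewrite ev (linf0 (@fock_coef_linear K _)) => /esym/eqP.
  by rewrite mulf_eq0 oppr_eq0 pnatr_eq0 (negbTE c0).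
case: j c0 => [|j] c0; first exact: vacS.
have := coef_eR 0 j l v; rewrite erv (linf0 (@fock_coef_linear K _)) => /esym/eqP.
by rewrite mulf_eq0 oppr_eq0 pnatr_eq0 (negbTE c0).
Qed.

Hypothesis mixS : forall n : nat, x 0 n.+1 n%:Z \in S /\ x n.+1 0 n%:Z \in S.

Lemma reach_edge_right j l : x 0 j l \in S.
Proof.
elim: j => [//|j IH]; have [<-|jl] := eqVneq j%:Z l; first by have [] := mixS j.
exact: reach_right.
Qed.

Lemma reach_edge_left i l : x i 0 l \in S.
Proof.
elim: i => [//|i IH]; have [<-|il] := eqVneq i%:Z l; first by have [] := mixS i.
exact: reach_left.
Qed.

(** Induction on the first exponent, then on the second.  The step to x(i+1,j+1,l) uses
fL if i <> l and fR if j <> l; when both fail the monomial is x(n+1,n+1,n), and it is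
enough to reach it knowing all monomials with first exponent at most n. *)
Lemma reach_all :
  (forall n : nat, (forall i j l, (i <= n)%N -> x i j l \in S) -> x n.+1 n.+1 n%:Z \in S) ->
  forall v, v \in S.
Proof.
move=> topS v; apply: mem_by_coef => -[[i j] l] _.
elim/ltn_ind: i j l => -[|i] IH j l; first exact: reach_edge_right.
have [e|il] := eqVneq i%:Z l; last first.
  by apply: reach_left => // [|_]; apply: IH.
rewrite -e; elim: j => [|j IHj]; first exact: reach_edge_left.
have [e'|ji] := eqVneq j%:Z i%:Z.
  by case: e' => ->; apply: topS => i' j' l' le; apply: IH; rewrite ltnS.
by apply: reach_right => // _; apply: IH.
Qed.

(** On the weight space (p, q) the Casimir operator is bidiagonal in the monomials
x(i, j, p+2i), with nonzero off-diagonal entries for i >= 1.  Reading the eigenvalue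
equation from i = 0 upwards, where the diagonal entry is the eigenvalue itself, all
coefficients with i >= 1 vanish. *)
Lemma casimir_edge_right v (p q : int) : casimir v = (p * (p + 2))%:~R *: v ->
  act (hL K) v = p%:~R *: v -> act (hR K) v = q%:~R *: v -> q <= p -> v \in S.
Proof.
move=> cv hv hrv qp.
suff c0 i j l : fock_coef (i.+1, j, l) v = 0.
  apply: mem_by_coef => -[[[|i] j] l]; first by move=> _; apply: reach_edge_right.
  by rewrite c0 eqxx.
elim: i j l => [|i IH] j l; apply/eqP/negP => /negP c0.
  have e1 := weight_left hv c0; have e2 := weight_right hrv c0.
  (* The weights give j >= i + 1, as q <= p. *)
  case: j c0 e2 => [|j] c0 e2; first by lia.
  have := coef_casimir 0 j p v; rewrite cv (linfZ (@fock_coef_linear K _)).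
  have -> : p + 2 = l by lia.
  rewrite -[LHS]addr0 => /addrI/esym/eqP; rewrite mulf_eq0 (negbTE c0).
  by rewrite pnatr_eq0.
have e1 := weight_left hv c0; have e2 := weight_right hrv c0.
case: j c0 e2 => [|j] c0 e2; first by lia.
have := coef_casimir i.+1 j (l - 2) v; rewrite cv (linfZ (@fock_coef_linear K _)).
rewrite subrK IH scaler0 mulr0 add0r => /esym/eqP; rewrite mulf_eq0 (negbTE c0).
by rewrite pnatr_eq0.
Qed.

Lemma casimir_edge_left v (p q : int) : casimir v = (q * (q + 2))%:~R *: v ->
  act (hL K) v = p%:~R *: v -> act (hR K) v = q%:~R *: v -> p <= q -> v \in S.
Proof.
move=> cv hv hrv qp.
suff c0 j i l : fock_coef (i, j.+1, l) v = 0.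
  apply: mem_by_coef => -[[i [|j]] l]; first by move=> _; apply: reach_edge_left.
  by rewrite c0 eqxx.
elim: j i l => [|j IH] i l; apply/eqP/negP => /negP c0.
  have e1 := weight_left hv c0; have e2 := weight_right hrv c0.
  case: i c0 e1 => [|i] c0 e1; first by lia.
  have := coef_casimir i 0 q v; rewrite cv (linfZ (@fock_coef_linear K _)).
  have -> : q + 2 = l by lia.
  rewrite -[LHS]addr0 => /addrI/esym/eqP; rewrite mulf_eq0 (negbTE c0).
  by rewrite pnatr_eq0.
have e1 := weight_left hv c0; have e2 := weight_right hrv c0.
case: i c0 e1 => [|i] c0 e1; first by lia.
have := coef_casimir i j.+1 (l - 2) v; rewrite cv (linfZ (@fock_coef_linear K _)).
rewrite subrK IH scaler0 mulr0 add0r => /esym/eqP; rewrite mulf_eq0 (negbTE c0).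
by rewrite pnatr_eq0.
Qed.

(** By induction on the degree in beta and bbeta.  If c is not the value of the Casimir
operator on a singular vector of weight p, then v is a nonzero multiple of f (e v),
and e v is again a weight eigenvector, of smaller degree; likewise on the right.
If c is that value on both sides, v is supported on an edge, i.e. on monomials
with a zero exponent. *)
Lemma casimir_eigen v (p q : int) (c : K) : casimir v = c *: v ->
  act (hL K) v = p%:~R *: v -> act (hR K) v = q%:~R *: v -> v \in S.
Proof.
have [n bound] : exists n, forall i j l, (n <= i + j)%N -> fock_coef (i, j, l) v = 0.
  have /combinationsP[D ->] := monomial_span v.
  exists (\max_(t <- dom D) (t.1.1 + t.1.2)).+1%N => i j l le.
  rewrite fock_coef_lift coeff_outdom //; apply: contraL le => tD; rewrite -ltnNge ltnS.
  exact: (leq_bigmax_seq (F := fun t => (t.1.1 + t.1.2)%N) _ tD).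
elim: n v p q bound => [|n IH] v p q bound cv hv hrv.
  by apply: mem_by_coef => -[[i j] l]; rewrite bound ?eqxx.
have left_ok : c != (p * (p + 2))%:~R -> v \in S.
  move=> ne; have nz : c - (p * (p + 2))%:~R != 0 by rewrite subr_eq0.
  have eS : act (eL K) v \in S.
    apply: (IH _ (p + 2) q).
    - by move=> i j l le; rewrite coef_eL bound ?mulr0.
    - by rewrite casimir_eL cv (linfZ (act_lin _)).
    - rewrite (tripleHE (left_triple M)) hv (linfZ (act_lin _)) -scalerDl.
      by rewrite intrD.
    - by rewrite -left_right hrv (linfZ (act_lin _)).
  rewrite -[v]scale1r -(mulVf nz) -scalerA; apply: rpredZ.
  rewrite scalerBl -cv casimir_left hv (linfZ (act_lin _)) hv !scalerA.
  rewrite -!addrA -scalerBl -scalerDl addrA.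
  have -> : p%:~R * p%:~R + 2 * p%:~R - (p * (p + 2))%:~R = 0 :> K.
    by rewrite intrM intrD; ring.
  by rewrite scale0r addr0 rpredZ //; apply: submodule_act.
have right_ok : c != (q * (q + 2))%:~R -> v \in S.
  move=> ne; have nz : c - (q * (q + 2))%:~R != 0 by rewrite subr_eq0.
  have eS : act (eR K) v \in S.
    apply: (IH _ p (q + 2)).
    - by move=> i j l le; rewrite coef_eR bound ?mulr0 // addnS.
    - by rewrite casimir_eR cv (linfZ (act_lin _)).
    - by rewrite left_right hv (linfZ (act_lin _)).
    - rewrite (tripleHE (right_triple M)) hrv (linfZ (act_lin _)) -scalerDl.
      by rewrite intrD.
  rewrite -[v]scale1r -(mulVf nz) -scalerA; apply: rpredZ.
  rewrite scalerBl -cv casimir_right hrv (linfZ (act_lin _)) hrv !scalerA.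
  rewrite -!addrA -scalerBl -scalerDl addrA.
  have -> : q%:~R * q%:~R + 2 * q%:~R - (q * (q + 2))%:~R = 0 :> K.
    by rewrite intrM intrD; ring.
  by rewrite scale0r addr0 rpredZ //; apply: submodule_act.
have [e|/left_ok //] := eqVneq c (p * (p + 2))%:~R.
have [e'|/right_ok //] := eqVneq c (q * (q + 2))%:~R.
have [qp|/Order.POrderTheory.ltW pq] := lerP q p.
  by apply: casimir_edge_right hv hrv qp; rewrite cv e.
by apply: casimir_edge_left hv hrv pq; rewrite cv e'.
Qed.
End Reach.
End Reaching.

(** * Coinvariant linear forms *)

Section Coinvariants.
Variable K : fieldType.

(** Moving F to the left through E^i produces a term in the image of F, killed by
theta, and terms H E^(i-1), on which theta acts through the weight. *)
Lemma raise_coinvariant (V : lmodType K) (E H F : V -> V) (theta : V -> K^o) (p : K) v :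
  sl2_triple E H F -> linear theta -> (forall u, theta (H u) = p * theta u) ->
  (forall u, theta (F u) = 0) -> (forall i, theta (iter i E v) = 0) ->
  forall i, theta (iter i E (F v)) = 0.
Proof.
move=> t lt tH tF + i; elim: i v => [|i IH] v tv; first exact: tF.
have hH u : theta (iter i E (H u)) = (p - (2 * i)%:R) * theta (iter i E u).
  elim: i u {IH} => [|i IH] u; first by rewrite tH muln0 subr0.
  have -> : iter i.+1 E (H u) = iter i E (H (E u)) - 2 *: iter i.+1 E u.
    rewrite !iterSr (tripleHE t) (linfD (lin_iter i (tripleE t))).
    by rewrite (linfZ (lin_iter i (tripleE t))) addrK.
  rewrite (linfD lt) (linfN lt) (linfZ lt) IH -iterSr.
  by rewrite -[_ *: _]/(_ * _) -mulrBl mulnS natrD; congr (_ * _); ring.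
rewrite iterSr (tripleEF t) (linfD (lin_iter i (tripleE t))) (linfD lt).
rewrite IH => [|j]; last by rewrite -iterSr.
by rewrite hH tv mulr0 addr0.
Qed.

Variables (N : lie_module (bi_sl2 K)) (theta : N -> K^o) (p q : K).
Hypothesis ltheta : linear theta.
Hypothesis theta_hL : forall v, theta (act (hL K) v) = p * theta v.
Hypothesis theta_hR : forall v, theta (act (hR K) v) = q * theta v.
Hypothesis theta_fL : forall v, theta (act (fL K) v) = 0.
Hypothesis theta_fR : forall v, theta (act (fR K) v) = 0.

(** By raise_coinvariant the vectors v with theta(eL^i eR^j v) = 0 for all i and j
form a submodule, the largest one on which theta vanishes.  This replaces the
triangular decomposition of the enveloping algebra. *)
Lemma generated_coinvariant (P : N -> Prop) :
  (forall x, P x -> forall i j,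
     theta (iter i (act (eL K)) (iter j (act (eR K)) x)) = 0) ->
  forall v, v \in generated P -> theta v = 0.
Proof.
move=> P0.
pose Z : {pred N} := fun v => `[< forall i j,
  theta (iter i (act (eL K)) (iter j (act (eR K)) v)) = 0 >].
have Zc : submod_closed Z.
  have l i j : linear (fun v : N => theta (iter i (act (eL K)) (iter j (act (eR K)) v))).
    apply: (lin_comp ltheta).
    exact: (lin_comp (lin_iter i (act_lin (eL K))) (lin_iter j (act_lin (eR K)))).
  split=> [|c u v /asboolP hu /asboolP hv]; apply/asboolP => i j.
    exact: (linf0 (l i j)).
  by rewrite (l i j) hu hv scaler0 addr0.
have st (x : bi_sl2 K) v : v \in Subspace Zc -> act x v \in Subspace Zc.
  apply: stable_bi_sl2 => {}v /asboolP hv; apply/asboolP => i j.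
  - rewrite -(iter_comm _ _ (left_right _ _)) -iterSr; exact: hv.
  - rewrite -(iter_comm _ _ (left_right _ _)).
    exact: (raise_coinvariant (left_triple N)).
  - rewrite -iterSr; exact: hv.
  - rewrite (iter_iter_comm _ _ _ (left_right _ _)).
    rewrite -(iter_comm _ _ (fun v => esym (left_right _ _ v))).
    apply: (raise_coinvariant (right_triple N)) => // {}j.
    by rewrite -(iter_iter_comm _ _ _ (left_right _ _)).
move=> v vP; have /asboolP/(_ 0%N 0%N) // : v \in Submodule st.
by apply: generated_min vP => x Px; apply/asboolP; apply: P0.
Qed.
End Coinvariants.

Section CoinvariantForms.
Variable K : numFieldType.
Local Notation x i j l := (@monomial K (i, j, l)).
Local Notation M := (fock_module K).

(** The conditions on the values g of a form on monomials under which the form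
has weights p and q and vanishes on the images of fL and fR. *)
Record coinvariant (p q : K) (g : nat -> nat -> int -> K) : Prop := Coinvariant {
  coinv_hL : forall i j l, (l%:~R - (2 * i)%:R) * g i j l = p * g i j l;
  coinv_hR : forall i j l, (l%:~R - (2 * j)%:R) * g i j l = q * g i j l;
  coinv_fL : forall i j l, (i%:R - l%:~R) * g i.+1 j l = j%:R * g i j.-1 (l - 2);
  coinv_fR : forall i j l, (j%:R - l%:~R) * g i j.+1 l = i%:R * g i.-1 j (l - 2) }.

Lemma coinvariant_swap p q g :
  coinvariant p q g -> coinvariant q p (fun i j l => g j i l).
Proof. by case=> h1 h2 h3 h4; split=> i j l. Qed.

Lemma coinvariant_vanish p q g (P : M -> Prop) : coinvariant p q g ->
  (forall v, P v -> exists a b l, v = x a b l /\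
     forall i j, g (a - i)%N (b - j)%N l = 0) ->
  forall v, v \in generated P -> fock_form g v = 0.
Proof.
case=> h1 h2 h3 h4 P0; have lg := @fock_form_linear K g.
apply: (generated_coinvariant lg (p := p) (q := q)).
- apply: monomial_ext (lin_comp lg (act_lin _)) (lin_scale p lg) _ => i j l.
  by rewrite hL_x (linfZ lg) fock_formE; apply: h1.
- apply: monomial_ext (lin_comp lg (act_lin _)) (lin_scale q lg) _ => i j l.
  by rewrite hR_x (linfZ lg) fock_formE; apply: h2.
- have l0 : linear (fun _ : M => 0 : K^o) by move=> c u v /=; rewrite scaler0 addr0.
  apply: monomial_ext (lin_comp lg (act_lin _)) l0 _ => i j l.
  rewrite fL_x (linfD lg) (linfN lg) !(linfZ lg) !fock_formE.
  by apply/eqP; rewrite subr_eq0; apply/eqP/h3.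
- have l0 : linear (fun _ : M => 0 : K^o) by move=> c u v /=; rewrite scaler0 addr0.
  apply: monomial_ext (lin_comp lg (act_lin _)) l0 _ => i j l.
  rewrite fR_x (linfD lg) (linfN lg) !(linfZ lg) !fock_formE.
  by apply/eqP; rewrite subr_eq0; apply/eqP/h4.
move=> v /P0[a [b [l [-> g0]]]] i j.
have [c ->] := raise_monomial K i j a b l.
by rewrite (linfZ lg) fock_formE g0 scaler0.
Qed.

(** The coinvariance equations have, up to a scalar, one solution of weights
(n, -n-2). *)
Definition mixed_coef (n i j : nat) (l : int) : K :=
  if (l == n%:Z + (2 * i)%:Z) && (j == i + n.+1)%N then (-1) ^+ i else 0.

Lemma mixed_coinvariant (n : nat) :
  coinvariant n%:~R (- n%:Z - 2)%:~R (mixed_coef n).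
Proof.
split=> i j l; rewrite /mixed_coef.
- case: ifP => [/andP[/eqP -> _]|_]; last by rewrite !mulr0.
  by rewrite intrD -!pmulrn addrK.
- case: ifP => [/andP[/eqP -> /eqP ->]|_]; last by rewrite !mulr0.
  by rewrite !intrD mulrNz -!pmulrn !natrM natrD; ring.
- case: j => [|j]; first by rewrite andbF mul0r mulr0.
  have -> : (l == n%:Z + (2 * i.+1)%:Z) && (j.+1 == i.+1 + n.+1)%N
    = (l - 2 == n%:Z + (2 * i)%:Z) && (j == i + n.+1)%N by lia.
  case: ifP => [/andP[/eqP el /eqP ->]|_]; last by rewrite !mulr0.
  have -> : l = n%:Z + (2 * i.+1)%:Z by lia.
  by rewrite !intrD -!pmulrn exprS -natr1 !natrM !natrD -!natr1; ring.
case: i => [|i].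
  case: ifP => [/andP[/eqP -> /eqP [->]]|_]; last by rewrite mulr0 mul0r.
  by rewrite add0n muln0 addr0 -pmulrn subrr !mul0r.
have -> : (l == n%:Z + (2 * i.+1)%:Z) && (j.+1 == i.+1 + n.+1)%N
  = (l - 2 == n%:Z + (2 * i)%:Z) && (j == i + n.+1)%N by lia.
case: ifP => [/andP[/eqP el /eqP ->]|_]; last by rewrite !mulr0.
have -> : l = n%:Z + (2 * i.+1)%:Z by lia.
by rewrite !intrD -!pmulrn exprS !natrM !natrD -!natr1; ring.
Qed.

(** The equations in weights (-n-2, -n-2) force the value 0 at the exponents i <= n
and then determine the rest from the value at n + 1. *)
Definition top_coef (n i j : nat) (l : int) : K :=
  if (l + n%:Z + 2 == (2 * i)%:Z) && (j == i) then (-1) ^+ i * 'C(i, n.+1)%:R else 0.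

Lemma top_coef_step (n i : nat) :
  (i%:R - n%:R) * ('C(i.+1, n.+1)%:R : K) = i.+1%:R * 'C(i, n.+1)%:R.
Proof.
have [lt|le] := ltnP i n.
  by rewrite !bin_small ?mulr0 // (leq_trans lt).
by rewrite -natrB // -!natrM mul_bin_down.
Qed.

Lemma top_coinvariant (n : nat) :
  coinvariant (- n%:Z - 2)%:~R (- n%:Z - 2)%:~R (top_coef n).
Proof.
have step (i : nat) (l : int) : l - 2 + n%:Z + 2 = (2 * i)%:Z ->
    (i%:R - l%:~R) * ((-1) ^+ i.+1 * 'C(i.+1, n.+1)%:R)
    = i.+1%:R * ((-1) ^+ i * 'C(i, n.+1)%:R) :> K.
  move=> e; have -> : l = (2 * i)%:Z - n%:Z by lia.
  rewrite intrB -!pmulrn natrM exprS [RHS]mulrCA -top_coef_step; ring.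
split=> i j l; rewrite /top_coef.
- case: ifP => [/andP[/eqP e _]|_]; last by rewrite !mulr0.
  by rewrite [(2 * i)%:R]pmulrn -intrB -e; congr (_%:~R * _); lia.
- case: ifP => [/andP[/eqP e /eqP ->]|_]; last by rewrite !mulr0.
  by rewrite [(2 * i)%:R]pmulrn -intrB -e; congr (_%:~R * _); lia.
- case: j => [|j]; first by rewrite andbF mul0r mulr0.
  have -> : (l + n%:Z + 2 == (2 * i.+1)%:Z) && (j.+1 == i.+1)
    = (l - 2 + n%:Z + 2 == (2 * i)%:Z) && (j == i) by lia.
  case: ifP => [/andP[/eqP el /eqP ->]|_]; last by rewrite !mulr0.
  exact: step.
case: i => [|i]; first by rewrite andbF mul0r mulr0.
have -> : (l + n%:Z + 2 == (2 * i.+1)%:Z) && (j.+1 == i.+1)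
  = (l - 2 + n%:Z + 2 == (2 * i)%:Z) && (j == i) by lia.
case: ifP => [/andP[/eqP el /eqP ->]|_]; last by rewrite !mulr0.
exact: step.
Qed.
End CoinvariantForms.

(** * The filtration *)

Section Layers.
Variable K : numFieldType.
Local Notation x i j l := (@monomial K (i, j, l)).
Local Notation M := (fock_module K).

Definition vacuum (l : int) : M := x 0 0 l.

Definition mixed (s : nat * bool) : M :=
  if s.2 then x 0 s.1.+1 s.1%:Z else x s.1.+1 0 s.1%:Z.

(** The weight of mixed s for the first copy of sl2; exchanging the boolean gives
the second one. *)
Definition mixed_weight (s : nat * bool) : int := if s.2 then s.1%:Z else - s.1%:Z - 2.

(** The solution of the two-term recursion that makes all but one of the terms of
casimir (top n) - n(n+2) top n cancel; it is solvable as long as s <= n because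
the diagonal entries differ by 4s(n+1-s). *)
Definition top_scalar (n s : nat) : K :=
  \prod_(r < s) ((n.+1 - r)%N%:R ^+ 2 / (r.+1%:R * (n - r)%N%:R)).

Definition top_term (n s : nat) : M :=
  x (n.+1 - s)%N (n.+1 - s)%N (n%:Z - (2 * s)%:Z).

Definition top (n : nat) : M := \sum_(s < n.+1) top_scalar n s *: top_term n s.

Definition in_layer0 (v : M) : Prop := exists l, v = vacuum l.
Definition in_layer1 (v : M) : Prop := in_layer0 v \/ exists s, v = mixed s.
Definition in_layer2 (v : M) : Prop := in_layer1 v \/ exists n, v = top n.

Definition layer0 := generated in_layer0.
Definition layer1 := generated in_layer1.
Definition layer2 := generated in_layer2.

Lemma vacuum_in0 l : in_layer0 (vacuum l). Proof. by exists l. Qed.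
Lemma mixed_in1 s : in_layer1 (mixed s). Proof. by right; exists s. Qed.
Lemma top_in2 n : in_layer2 (top n). Proof. by right; exists n. Qed.

Lemma vacuum_layer0 l : vacuum l \in layer0.
Proof. exact/mem_generated/vacuum_in0. Qed.
Lemma vacuum_layer1 l : vacuum l \in layer1.
Proof. by apply: mem_generated; left; exists l. Qed.
Lemma mixed_layer1 s : mixed s \in layer1.
Proof. exact/mem_generated/mixed_in1. Qed.

Lemma layer01 v : v \in layer0 -> v \in layer1.
Proof. by apply: generated_min => u ?; apply: mem_generated; left. Qed.
Lemma layer12 v : v \in layer1 -> v \in layer2.
Proof. by apply: generated_min => u ?; apply: mem_generated; left. Qed.

Lemma mixed_edges (S : submodule M) : (forall s, mixed s \in S) ->
  forall n : nat, x 0 n.+1 n%:Z \in S /\ x n.+1 0 n%:Z \in S.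
Proof. by move=> mS n; split; [apply: (mS (n, true)) | apply: (mS (n, false))]. Qed.

Lemma layer2_all v : v \in layer2.
Proof.
have vS l : x 0 0 l \in layer2 by apply/layer12/vacuum_layer1.
have mS := mixed_edges (fun s => layer12 (mixed_layer1 s)).
apply: (reach_all vS mS) => n low.
have tS : top n \in layer2 by exact/mem_generated/top_in2.
(* All terms of top n but the leading one have first exponent at most n. *)
rewrite /top big_ord_recl /= in tS.
have e : top_scalar n 0 *: top_term n 0 = x n.+1 n.+1 n%:Z.
  by rewrite /top_scalar big_ord0 scale1r /top_term subn0 muln0 subr0.
rewrite e in tS; rewrite -[x _ _ _](addrK (\sum_(i < n) top_scalar n (bump 0 i) *: top_term n (bump 0 i))).
apply: rpredB => //; apply: rpred_sum => s _; apply: rpredZ; apply: low.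
by rewrite /bump subSS leq_subr.
Qed.

Lemma casimir_top_term n s : (s <= n)%N ->
  casimir (top_term n s) - (n%:Z * (n%:Z + 2))%:~R *: top_term n s =
  - (4 * (s * (n.+1 - s)))%N%:R *: top_term n s
  + (4 * (n.+1 - s) ^ 2)%N%:R *: top_term n s.+1.
Proof.
move=> le; rewrite /top_term casimir_x addrAC -scalerBl -subnS.
have -> : n%:Z - (2 * s)%:Z - 2 = n%:Z - (2 * s.+1)%:Z by lia.
rewrite mulnn; congr (_ *: _ + _); rewrite -intrB -[X in _ = - X]mulrz_nat -mulrNz.
congr (_%:~R); rewrite natz -(subnKC le) -addnS addKn; move: (n - s)%N => d.
by rewrite !PoszM !PoszD; lia.
Qed.

Lemma top_scalarS n s : (s < n)%N ->
  top_scalar n s.+1 * (4 * (s.+1 * (n.+1 - s.+1)))%N%:R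
  = top_scalar n s * (4 * (n.+1 - s) ^ 2)%N%:R.
Proof.
move=> lt; rewrite {1}/top_scalar big_ord_recr -/(top_scalar n s) /= subSS.
rewrite -mulrA; congr (_ * _); rewrite !natrM.
have ns : (n - s)%N%:R != 0 :> K by rewrite pnatr_eq0 subn_eq0 -ltnNge.
by field; rewrite ns addrC natr1 pnatr_eq0.
Qed.

(** The sum telescopes (top_scalarS); the term that is left is the vacuum of the same
weight, on which the Casimir operator takes the same value.  So top n generates a
nontrivial Jordan block. *)
Lemma casimir_top n : casimir (top n) = (n%:Z * (n%:Z + 2))%:~R *: top n
  + (4 * top_scalar n n) *: vacuum (- n%:Z - 2).
Proof.
pose T (v : M) := casimir v - (n%:Z * (n%:Z + 2))%:~R *: v.
have lT : linear T.
  by apply: lin_sub; [exact: casimir_linear | exact/lin_scale/lin_id].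
suff part m : (m <= n)%N -> \sum_(s < m.+1) top_scalar n s *: T (top_term n s)
    = (top_scalar n m * (4 * (n.+1 - m) ^ 2)%N%:R) *: top_term n m.+1.
  have : T (top n) = (4 * top_scalar n n) *: vacuum (- n%:Z - 2).
    rewrite (linf_sum lT) (eq_bigr _ (fun s _ => linfZ lT _ _)) part //.
    rewrite subSnn exp1n muln1 mulrC; congr (_ *: _).
    by rewrite /top_term subnn; congr (x _ _ _); lia.
  by rewrite /T => <-; rewrite addrC subrK.
elim: m => [|m IH] le.
  rewrite big_ord_recr big_ord0 /= add0r /T casimir_top_term // mul0n muln0 oppr0 scale0r.
  by rewrite add0r scalerA.
rewrite big_ord_recr /= IH ?(ltnW le) // /T casimir_top_term // scalerDr !scalerA.
by rewrite mulrN scaleNr top_scalarS // addrA subrr add0r.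
Qed.

Lemma vacuum_eL l : act (eL K) (vacuum l) = 0.
Proof. by rewrite /vacuum eL_x oppr0 scale0r. Qed.
Lemma vacuum_eR l : act (eR K) (vacuum l) = 0.
Proof. by rewrite /vacuum eR_x oppr0 scale0r. Qed.
Lemma vacuum_hL l : act (hL K) (vacuum l) = l%:~R *: vacuum l.
Proof. by rewrite /vacuum hL_x muln0 subr0. Qed.
Lemma vacuum_hR l : act (hR K) (vacuum l) = l%:~R *: vacuum l.
Proof. by rewrite /vacuum hR_x muln0 subr0. Qed.

Lemma vacuum_neq0 l : vacuum l != 0.
Proof.
apply/eqP => e; have := fock_coefE K (0%N, 0%N, l) 0 0 l.
rewrite -/(vacuum l) e (linf0 (@fock_coef_linear K _)) eqxx => /esym/eqP.
by rewrite oner_eq0.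
Qed.

Lemma top_hL n : act (hL K) (top n) = (- n%:Z - 2)%:~R *: top n.
Proof.
rewrite /top (linf_sum (act_lin _)) scaler_sumr; apply: eq_bigr => s _.
rewrite (linfZ (act_lin _)) /top_term hL_x !scalerA mulrC; congr (_ * _ *: _).
by rewrite [X in _ - X]pmulrn -intrB; congr (_%:~R); have := ltn_ord s; lia.
Qed.

Lemma top_hR n : act (hR K) (top n) = (- n%:Z - 2)%:~R *: top n.
Proof.
rewrite /top (linf_sum (act_lin _)) scaler_sumr; apply: eq_bigr => s _.
rewrite (linfZ (act_lin _)) /top_term hR_x !scalerA mulrC; congr (_ * _ *: _).
by rewrite [X in _ - X]pmulrn -intrB; congr (_%:~R); have := ltn_ord s; lia.
Qed.

(** e kills the vacuum that obstructs top n from being a Casimir eigenvector. *)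
Lemma top_eL n : act (eL K) (top n) \in layer1.
Proof.
apply: (casimir_eigen vacuum_layer1 (mixed_edges mixed_layer1)
  (p := - n%:Z) (q := - n%:Z - 2) (c := (n%:Z * (n%:Z + 2))%:~R)).
- rewrite casimir_eL casimir_top (linfD (act_lin _)) !(linfZ (act_lin _)).
  by rewrite vacuum_eL scaler0 addr0.
- rewrite (tripleHE (left_triple M)) top_hL (linfZ (act_lin _)) -scalerDl.
  by rewrite intrB subrK.
- by rewrite -left_right top_hR (linfZ (act_lin _)).
Qed.

Lemma top_eR n : act (eR K) (top n) \in layer1.
Proof.
apply: (casimir_eigen vacuum_layer1 (mixed_edges mixed_layer1)
  (p := - n%:Z - 2) (q := - n%:Z) (c := (n%:Z * (n%:Z + 2))%:~R)).
- rewrite casimir_eR casimir_top (linfD (act_lin _)) !(linfZ (act_lin _)).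
  by rewrite vacuum_eR scaler0 addr0.
- by rewrite left_right top_hL (linfZ (act_lin _)).
- rewrite (tripleHE (right_triple M)) top_hR (linfZ (act_lin _)) -scalerDl.
  by rewrite intrB subrK.
Qed.

(** The form top_coef n vanishes on all monomials with a zero exponent and on
all terms of top n except the leading one. *)
Lemma top_notin n : top n \notin layer1.
Proof.
apply/negP => tS; have := coinvariant_vanish (top_coinvariant K n) _ tS.
have lf := @fock_form_linear K (top_coef K n).
rewrite /top (linf_sum lf) big_ord_recl big1 => [|s _]; last first.
  rewrite (linfZ lf) fock_formE /top_coef; case: ifP => _; last exact: scaler0.
  by rewrite bin_small ?mulr0; [exact: scaler0 | rewrite /= /bump; lia].
rewrite addr0 (linfZ lf) fock_formE /top_coef /top_scalar big_ord0 subn0 muln0 subr0.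
rewrite ifT; last by rewrite eqxx andbT; lia.
rewrite binn mulr1 scale1r => e; have := @signr_eq0 K n.+1.
rewrite e ?eqxx // => v [[l ->]|[[m []] ->]].
- by exists 0%N, 0%N, l; split=> // i j; rewrite /top_coef !sub0n mulr0; case: ifP.
- exists 0%N, m.+1, m%:Z; split=> // i j; rewrite /top_coef sub0n mulr0.
  by case: ifP.
exists m.+1, 0%N, m%:Z; split=> // i j; rewrite /top_coef sub0n.
by case: ifP => // /andP[_ /eqP <-]; rewrite mulr0.
Qed.

Lemma mixed_right n : mixed (n, true) = x 0 n.+1 n%:Z. Proof. by []. Qed.
Lemma mixed_left n : mixed (n, false) = x n.+1 0 n%:Z. Proof. by []. Qed.

Lemma mixed_hL s : act (hL K) (mixed s) = (mixed_weight s)%:~R *: mixed s.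
Proof.
case: s => n []; rewrite (mixed_right, mixed_left) hL_x /mixed_weight /=.
  by rewrite muln0 subr0.
by rewrite [X in _ - X]pmulrn -intrB; congr (_%:~R *: _); lia.
Qed.

Lemma mixed_hR s :
  act (hR K) (mixed s) = (mixed_weight (s.1, ~~ s.2))%:~R *: mixed s.
Proof.
case: s => n []; rewrite (mixed_right, mixed_left) hR_x /mixed_weight /=.
  by rewrite [X in _ - X]pmulrn -intrB; congr (_%:~R *: _); lia.
by rewrite muln0 subr0.
Qed.

Lemma mixed_eL s : act (eL K) (mixed s) \in layer0.
Proof.
case: s => n []; rewrite (mixed_right, mixed_left) eL_x.
  by rewrite oppr0 scale0r rpred0.
by apply: rpredZ; apply: (reach_edge_left_le vacuum_layer0).
Qed.

Lemma mixed_eR s : act (eR K) (mixed s) \in layer0.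
Proof.
case: s => n []; rewrite (mixed_right, mixed_left) eR_x.
  by apply: rpredZ; apply: (reach_edge_right_le vacuum_layer0).
by rewrite oppr0 scale0r rpred0.
Qed.

Lemma mixed_notin s : mixed s \notin layer0.
Proof.
have vac0 g : (forall l, g 0%N 0%N l = 0 :> K) -> forall v : M, in_layer0 v ->
    exists a b l, v = x a b l /\ forall i j, g (a - i)%N (b - j)%N l = 0.
  by move=> g0 v [l ->]; exists 0%N, 0%N, l; split=> // i j; rewrite !sub0n.
case: s => n; have c0 l : mixed_coef K n 0 0 l = 0 by rewrite /mixed_coef andbF.
case; apply/negP => mS.
  have := coinvariant_vanish (mixed_coinvariant K n) (vac0 _ c0) mS.
  rewrite mixed_right fock_formE /mixed_coef muln0 addr0 !eqxx => /eqP.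
  by rewrite oner_eq0.
have := coinvariant_vanish (coinvariant_swap (mixed_coinvariant K n))
  (vac0 (fun i j l => mixed_coef K n j i l) c0) mS.
rewrite mixed_left fock_formE /mixed_coef muln0 addr0 !eqxx => /eqP.
by rewrite oner_eq0.
Qed.

(** The vector is killed by eL because n - n = 0, and by eR because f^(n+1) commutes
with fbar^n and kills the vacuum of weight n. *)
Lemma mixed_true_vanish n : iter n.+1 (act (fL K)) (mixed (n, true)) \in layer0.
Proof.
rewrite mixed_right; set y := x _ _ _.
have ye : act (eL K) y = 0 by rewrite /y eL_x oppr0 scale0r.
have yh : act (hL K) y = n%:R *: y by rewrite /y hL_x muln0 subr0.
apply: (reach_singular vacuum_layer0).
  by rewrite (raise_lower1 (left_triple M) ye yh) subrr mulr0 scale0r.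
rewrite (iter_comm _ _ (fun v => esym (left_right _ _ v))) eR_x.
have nz : \prod_(k < n) (k%:R - (n%:Z)%:~R) != 0 :> K.
  apply/prodf_neq0 => k _; rewrite subr_nat_int intr_eq0 subr_eq0 eqz_nat.
  by rewrite ltn_eqF.
have -> : x 0 n.+1.-1 n%:Z = (\prod_(k < n) (k%:R - (n%:Z)%:~R))^-1
    *: iter n (act (fR K)) (vacuum n%:Z).
  by rewrite lower_right_monomial scalerA mulVf // scale1r.
rewrite !(linfZ (lin_iter _ (act_lin _))) (iter_iter_comm _ _ _ (left_right _ _)).
rewrite lower_left_vanish ?(linf0 (lin_iter _ (act_lin _))) ?scaler0 //.
by rewrite /hw_norm big_ord_recr /= -pmulrn subrr !mulr0.
Qed.

Lemma mixed_false_vanish n : iter n.+1 (act (fR K)) (mixed (n, false)) \in layer0.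
Proof.
rewrite mixed_left; set y := x _ _ _.
have ye : act (eR K) y = 0 by rewrite /y eR_x oppr0 scale0r.
have yh : act (hR K) y = n%:R *: y by rewrite /y hR_x muln0 subr0.
apply: (reach_singular vacuum_layer0); last first.
  by rewrite (raise_lower1 (right_triple M) ye yh) subrr mulr0 scale0r.
rewrite (iter_comm _ _ (left_right _ _)) eL_x.
have nz : \prod_(k < n) (k%:R - (n%:Z)%:~R) != 0 :> K.
  apply/prodf_neq0 => k _; rewrite subr_nat_int intr_eq0 subr_eq0 eqz_nat.
  by rewrite ltn_eqF.
have -> : x n.+1.-1 0 n%:Z = (\prod_(k < n) (k%:R - (n%:Z)%:~R))^-1
    *: iter n (act (fL K)) (vacuum n%:Z).
  by rewrite lower_left_monomial scalerA mulVf // scale1r.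
rewrite !(linfZ (lin_iter _ (act_lin _))).
rewrite (iter_iter_comm _ _ _ (fun v => esym (left_right _ _ v))).
rewrite lower_right_vanish ?(linf0 (lin_iter _ (act_lin _))) ?scaler0 //.
by rewrite /hw_norm big_ord_recr /= -pmulrn subrr !mulr0.
Qed.

Lemma mixed_fL s i : hw_norm ((mixed_weight s)%:~R : K) i = 0 ->
  iter i (act (fL K)) (mixed s) \in layer0.
Proof.
move/hw_norm_int_eq0 => [k]; case: s => n [] ki e; rewrite /mixed_weight /= in e.
  have {e} e : n = k by case: e.
  rewrite -(subnK ki) -e iterD; elim: (i - n.+1)%N => [|j IH].
    exact: mixed_true_vanish.
  exact: (submodule_act (fL K) IH).
by lia.
Qed.

Lemma mixed_fR s i : hw_norm ((mixed_weight (s.1, ~~ s.2))%:~R : K) i = 0 ->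
  iter i (act (fR K)) (mixed s) \in layer0.
Proof.
move/hw_norm_int_eq0 => [k]; case: s => n [] ki e; rewrite /mixed_weight /= in e.
  by lia.
have {e} e : n = k by case: e.
rewrite -(subnK ki) -e iterD; elim: (i - n.+1)%N => [|j IH].
  exact: mixed_false_vanish.
exact: (submodule_act (fR K) IH).
Qed.
End Layers.

Theorem theorem1p3 (R : realType) (V : int -> lie_module (sl2 R[i]))
    (V_hw : forall l : int, irreducible_hw l%:~R (V l)) :
  exists F0 F1 F2 : submodule (fock_module R[i]),
    [/\ {subset submodule_space F0 <= submodule_space F1},
        {subset submodule_space F1 <= submodule_space F2},
        (forall v, v \in submodule_space F2)
      & [/\ module_iso (subquotient F2 F1)
              (dsum_module (fun l : nat =>
                 tensor_module (V (- l%:Z - 2)) (restricted_dual (V (- l%:Z - 2))))),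
            module_iso (subquotient F1 F0)
              (dsum_module (fun l : nat =>
                 pair_module
                   (tensor_module (V l%:Z) (restricted_dual (V (- l%:Z - 2))))
                   (tensor_module (V (- l%:Z - 2)) (restricted_dual (V l%:Z)))))
          & module_iso (sub_module F0)
              (dsum_module (fun l : int =>
                 tensor_module (V l) (restricted_dual (V l))))]].
Proof.
pose gen l := cid (irreducible_hw_generator (@pchar_num R[i]) (V_hw l)).
pose v l : V l := projT1 (gen l).
have gv l : hw_generator (l%:~R : R[i]) (v l) := projT2 (gen l).
pose form l := cid (top_form (@pchar_num R[i]) (gv l)).
pose phi l : restricted_dual (V l) := projT1 (form l).
have phiP l : val (phi l) (v l) = 1 /\ forall y, val (phi l) (act (sl2_f _) y) = 0 :=
  projT2 (form l).
have gphi l : hw_generator (l%:~R : R[i]) (phi l).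
  by have [e z] := phiP l; apply: (dual_hw_generator (@pchar_num _) (gv l)).
(* Separated by phi k on the first factor and by evaluation at v l on the second. *)
have top0 k l : tens (v k) (phi l) != 0.
  have lev : linear (fun psi : restricted_dual (V l) => val psi (v l)).
    by move=> a f g; apply: rdual_valE.
  apply: (tens_neq0 (rdual_linear (phi k)) lev); by rewrite (phiP _).1 oner_neq0.
have sys (I : choiceType) (a b : I -> int) :=
  @tensor_hw_system _ I (fun s => (a s)%:~R) (fun s => (b s)%:~R) _ _
    (fun s => v (a s)) (fun s => phi (b s)) (fun s => gv (a s)) (fun s => gphi (b s))
    (fun s => top0 (a s) (b s)).
exists (layer0 R[i]), (layer1 R[i]), (layer2 R[i]); split.
- exact: layer01.
- exact: layer12.
- exact: layer2_all.
split.
- apply: (hw_system_iso (a := fun n : nat => (- n%:Z - 2)%:~R)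
    (b := fun n : nat => (- n%:Z - 2)%:~R) _ _ (sys _ _ _)).
    by move=> m n [/intr_inj]; lia.
  apply: (subquotient_hw_system (@top_in2 R[i])).
  + exact: top_notin.
  + exact: top_eL.
  + exact: top_eR.
  + exact: top_hL.
  + exact: top_hR.
  + by move=> n i /hw_norm_int_eq0[k _]; lia.
  + by move=> n i /hw_norm_int_eq0[k _]; lia.
  + by move=> u [uP|]; [left; apply: mem_generated | right].
- pose a (s : nat * bool) := mixed_weight s.
  pose b (s : nat * bool) := mixed_weight (s.1, ~~ s.2).
  apply: module_iso_trans (dsum_pair_iso (fun s : nat * bool =>
    tensor_module (V (a s)) (restricted_dual (V (b s))))).
  apply: (hw_system_iso (a := fun s => (a s)%:~R) (b := fun s => (b s)%:~R)
    _ _ (sys _ a b)).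
    move=> [m c] [n d] [/intr_inj]; rewrite /a /mixed_weight /=.
    by case: c d => [] []; move=> e _; congr pair; lia.
  apply: (subquotient_hw_system (@mixed_in1 R[i])).
  + exact: mixed_notin.
  + exact: mixed_eL.
  + exact: mixed_eR.
  + exact: mixed_hL.
  + exact: mixed_hR.
  + exact: mixed_fL.
  + exact: mixed_fR.
  + by move=> u [uP|]; [left; apply: mem_generated | right].
apply: (hw_system_iso (a := fun l : int => l%:~R) (b := fun l : int => l%:~R)
  _ _ (sys _ _ _)).
  by move=> m n [/intr_inj].
apply: (generated_hw_system (@vacuum_in0 R[i])) => //.
+ exact: vacuum_neq0.
+ exact: vacuum_eL.
+ exact: vacuum_eR.
+ exact: vacuum_hL.
+ exact: vacuum_hR.
+ by move=> l i; apply: lower_left_vanish.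
+ by move=> l i; apply: lower_right_vanish.
Qed.
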